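(* Let $X_1,\dots,X_M\in\mathbb{R}^3$ be distinct points and $Z_1,\dots,Z_M>0$. The $\Gamma$-limit $G^0$ of the functionals $G^0_\varepsilon$ as $\varepsilon\to0$, with respect to weak* convergence, exists on $\mathcal{P}^-$ (i.e. $G^{0-}=G^{0+}=:G^0$) and is given, for every $\rho\in\mathcal{P}^-$, by $$G^0(\rho)=-\frac14\sum_{k=1}^M Z_k^2\,\rho(\{X_k\}).$$
   Context: $\mathcal{P}$ is the set of Borel probability measures on $\mathbb{R}^3$ and $\mathcal{P}^-$ the set of nonnegative Borel measures $\rho$ on $\mathbb{R}^3$ with $\int d\rho\le 1$; weak* convergence is tested against continuous functions vanishing at infinity. For $\rho\in\mathcal{P}$: $T(\rho)=\int_{\mathbb{R}^3}|\nabla\sqrt\rho|^2\,dx$ if $\rho$ is absolutely continuous with (density satisfying) $\sqrt\rho\in H^1(\mathbb{R}^3)$, and $T(\rho)=+\infty$ otherwise; $U(\rho)=\sum_{k=1}^M Z_k\int\frac{1}{|x-X_k|}\,d\rho(x)$. For $\varepsilon>0$, $G^0_\varepsilon(\rho)=\varepsilon^2T(\rho)-\varepsilon U(\rho)$, with $G^0_\varepsilon(\rho)=+\infty$ if $T(\rho)=+\infty$. For $\rho\in\mathcal{P}^-$, $G^{0-}(\rho)$ and $G^{0+}(\rho)$ are the infima of $\liminf_{\varepsilon\to0}G^0_\varepsilon(\rho_\varepsilon)$ and $\limsup_{\varepsilon\to0}G^0_\varepsilon(\rho_\varepsilon)$ respectively, over all families $(\rho_\varepsilon)_{\varepsilon>0}$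 in $\mathcal{P}$ converging weakly* to $\rho$ as $\varepsilon\to0$. *)

(* Defs.v *)
From HB Require Import structures.
From mathcomp Require Export all_boot all_order all_algebra.
From mathcomp Require Export all_classical all_reals all_analysis.

Set Implicit Arguments.
Unset Strict Implicit.
Unset Printing Implicit Defensive.

Import Order.TTheory GRing.Theory Num.Theory.
Import numFieldNormedType.Exports.

Local Open Scope classical_set_scope.
Local Open Scope ring_scope.

(* The product topology is the usual topology of R^3.  The library norm on a
   product is the sup norm, hence the separate Euclidean norm [enorm]. *)
Notation R3 R := (R * R * R)%type.

(* The same carrier with the measurable structure on which [lebesgue_measure]
   lives; its product sigma-algebra is the Borel sigma-algebra of R^3. *)
Notation mR3 R :=
  (measurableTypeR R * measurableTypeR R * measurableTypeR R)%type.

Section Lebesgue3.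
Context {R : realType}.

(* The library's sigma-finiteness instance for products is not inferred by
   unification here, so it is rebuilt for the two products below. *)
Lemma product_sigma_finite d1 d2 (T1 : measurableType d1)
    (T2 : measurableType d2) (m1 : {sigma_finite_measure set T1 -> \bar R})
    (m2 : {sigma_finite_measure set T2 -> \bar R}) :
  sigma_finite setT (m1 \x m2)%E.
Proof.
have /sigma_finiteP[F [TF ndF Foo]] := sigma_finiteT m1.
have /sigma_finiteP[G [TG ndG Goo]] := sigma_finiteT m2.
exists (fun n => F n `*` G n).
  rewrite -setXTT TF TG predeqE => -[x y]; split.
    move=> [/= [n _ Fnx] [k _ Gky]]; exists (maxn n k) => //; split.
    - by move: x Fnx; exact/subsetPset/ndF/leq_maxl.
    - by move: y Gky; exact/subsetPset/ndG/leq_maxr.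
  by move=> [n _ []/= ? ?]; split; exists n.
move=> k; have [? ?] := Foo k; have [? ?] := Goo k.
split; first exact: measurableX.
by rewrite product_measure1E// lte_mul_pinfty// ge0_fin_numE.
Qed.

Definition leb2 : set (measurableTypeR R * measurableTypeR R) -> \bar R :=
  (@lebesgue_measure R \x @lebesgue_measure R)%E.
HB.instance Definition _ := Measure.on leb2.
HB.instance Definition _ :=
  Measure_isSigmaFinite.Build _ _ _ leb2 (product_sigma_finite _ _).

Definition leb3 : set (mR3 R) -> \bar R :=
  (leb2 \x @lebesgue_measure R)%E.
HB.instance Definition _ := Measure.on leb3.
HB.instance Definition _ :=
  Measure_isSigmaFinite.Build _ _ _ leb3 (product_sigma_finite _ _).

End Lebesgue3.

Section Kinetic.
Context {R : realType}.
Implicit Types (u g phi : R3 R -> R) (i : 'I_3).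

Definition enorm (x : R3 R) : R :=
  Num.sqrt (x.1.1 ^+ 2 + x.1.2 ^+ 2 + x.2 ^+ 2).

Definition basis3 i : R3 R :=
  ((i == 0%N :> nat)%:R, (i == 1%N :> nat)%:R, (i == 2%N :> nat)%:R).

Fixpoint Ck (k : nat) phi : Prop :=
  continuous phi /\
  match k with
  | 0 => True
  | k'.+1 => forall i, (forall x, derivable phi x (basis3 i)) /\
                       Ck k' ('D_(basis3 i) phi)
  end.

Definition test_function phi : Prop :=
  (forall k, Ck k phi) /\ compact (closure [set x | phi x != 0]).

Definition weak_partial i u g : Prop :=
  forall phi, test_function phi ->
    \int[leb3]_x (u x * 'D_(basis3 i) phi x) = - \int[leb3]_x (g x * phi x).

Definition L2 u : Prop := u \in Lfun leb3 2%:E.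

Definition H1 u : Prop :=
  L2 u /\ forall i, exists2 g, L2 g & weak_partial i u g.

(* A weak partial derivative is unique almost everywhere, so integrals do not
   depend on which one is chosen. *)
Definition weak_grad u i : R3 R -> R :=
  xget (cst 0) [set g | L2 g /\ weak_partial i u g].

Implicit Types rho : probability (mR3 R) R.

Definition sqrt_density rho (x : R3 R) : R :=
  Num.sqrt (fine (Radon_Nikodym (charge_of_finite_measure rho) leb3 x)).

Definition kinetic rho : \bar R :=
  if `[< rho `<< leb3 /\ H1 (sqrt_density rho) >]
  then (\int[leb3]_x (\sum_(i < 3) weak_grad (sqrt_density rho) i x ^+ 2)%:E)%E
  else +oo%E.

End Kinetic.

Section Gamma_limit.
Context {R : realType}.

Definition vanishes_at_infinity (f : R3 R -> R) : Prop :=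
  forall e : R, 0 < e ->
    exists2 K, compact K & forall x, ~ K x -> `|f x| < e.

Definition weak_star_cvg (rho_ : R -> probability (mR3 R) R)
    (rho : subprobability (mR3 R) R) : Prop :=
  forall f : R3 R -> R, continuous f -> vanishes_at_infinity f ->
    (\int[rho_ e]_x f x) @[e --> 0^'+] --> \int[rho]_x f x.

Implicit Types (F : R -> probability (mR3 R) R -> \bar R)
  (rho : subprobability (mR3 R) R).

(* Families are functions on all of [R], but only their values at e > 0
   matter. *)
Definition Gamma_liminf F rho : \bar R :=
  ereal_inf [set limf_einf (fun e => F e (rho_ e)) 0^'+
            | rho_ in [set rho_ | weak_star_cvg rho_ rho]].

Definition Gamma_limsup F rho : \bar R :=
  ereal_inf [set limf_esup (fun e => F e (rho_ e)) 0^'+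
            | rho_ in [set rho_ | weak_star_cvg rho_ rho]].

Definition is_Gamma_limit F (G : subprobability (mR3 R) R -> \bar R) : Prop :=
  forall rho, Gamma_liminf F rho = G rho /\ Gamma_limsup F rho = G rho.

End Gamma_limit.

Section Functional.
Context {R : realType} {M : nat} (X : 'I_M -> R3 R) (Z : 'I_M -> R).
Implicit Types rho : probability (mR3 R) R.

(* The inverse is the extended-real one, equal to +oo at x = X k. *)
Definition potential rho : \bar R :=
  (\sum_(k < M) (Z k)%:E * \int[rho]_x ((enorm (x - X k))%:E)^-1)%E.

Definition G0_ (e : R) rho : \bar R :=
  if kinetic rho == +oo%E then +oo%E
  else ((e ^+ 2)%:E * kinetic rho - e%:E * potential rho)%E.

End Functional.

(* Main.v *)
(* Lower bound. For a bounded C^1 field F, expanding the square in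
     0 <= \int | e grad u + F u |^2
   and integrating by parts gives
     e^2 \int |grad u|^2 >= \int (e div F - |F|^2) u^2,      u = sqrt rho.
   Take F = sum_k F_k with F_k radial around X_k, |F_k| close to Z_k / 2 near X_k
   and decaying at scale eta, and e div F_k >= e Z_k / |x - X_k| - O(e / eta).
   Then G_e(rho) >= - \int |F|^2 d rho - O(e), and letting e -> 0, then eta -> 0,
   leaves - sum_k (Z_k / 2)^2 rho{X_k}.

   Upper bound. Replace each point mass of rho by a copy of the probability
   density exp(- sqrt (d^2 + |s|^2)) / W, a smoothing of the hydrogen ground
   state, at scale e / Z_k at X_k and at scale sqrt e elsewhere; send the missing
   mass 1 - rho(R^3) to infinity. By convexity of the Fisher information the
   kinetic energy of the mixture is at most the average of those of the bumps. *)

From HB Require Import structures.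
Require Import Defs.
From mathcomp Require Import all_boot all_order all_algebra.
From mathcomp Require Import all_classical all_reals all_analysis.
From mathcomp Require Import measurable_realfun ring lra.
Import Order.TTheory GRing.Theory Num.Theory.
Import numFieldNormedType.Exports.
Local Open Scope classical_set_scope.
Local Open Scope ring_scope.

Set Implicit Arguments.
Unset Strict Implicit.
Unset Printing Implicit Defensive.

(** * Integration on R^3 *)

(** The value Z_k / 2 comes from the divergence 2 / r of the radial unit vector field in dimension
    3: a field of length a around X_k has e div F of order 2 a e / r, and matching the Coulomb term
    e Z_k / r forces a = Z_k / 2. The obstacle in the lower bound is that u has only weak
    derivatives, tested against smooth compactly supported functions, and u F is not such a
    function. The argument therefore runs on difference quotients of u, whose L^2 norms are
    controlled by duality; this is what the density of test functions in L^2 is for. In the upper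
    bound, exp(-|s|) has a kink at the nucleus. Smoothing makes every bump, hence the mixture,
    differentiable, at the price of a factor tau in [1 - d/2, 1]: in natural units the profile has
    kinetic energy tau/4 and Coulomb integral at least tau/2, so a nucleus gains at least tau Z_k^2
    / 4 per unit mass. A recovery family has d fixed and misses the limit by O(d), which suffices
    because the upper Gamma-limit is an infimum over families. *)

Section Affine1.
Context {R : realType}.
Notation mu := (@lebesgue_measure R).
Local Open Scope ereal_scope.

Lemma measurable_affine (a b : R) :
  measurable_fun setT (fun t : measurableTypeR R => (a * t + b)%R : measurableTypeR R).
Proof. by apply: measurable_funD => //; apply: measurable_funM. Qed.

Definition affine_pushforward (a b : R) :
  {measure set (measurableTypeR R) -> \bar R} :=
  measure_function_pushforward__canonical__measure_function_Measure mu
    (measurable_affine a b).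

(** Uniqueness of Lebesgue measure: the preimage of []u, v]] is an interval of length (v - u) / a,
    and the factor [a] restores v - u. *)
Lemma lebesgue_measure_affine (a b : R) (a0 : (0 < a)%R) (A : set (measurableTypeR R)) :
  measurable A ->
  mscale (NngNum (ltW a0)) (affine_pushforward a b) A = mu A.
Proof.
move=> mA; apply/esym/lebesgue_measure_unique => //= _ [[u v]] _ <-.
rewrite /mscale/= /pushforward.
have -> : (fun t : measurableTypeR R => (a * t + b)%R) @^-1` `]u, v] =
   `]((u - b) / a)%R, ((v - b) / a)%R]%classic.
  apply/seteqP; split => t /=;
    by rewrite !in_itv/= ltr_pdivrMr// ler_pdivlMr// mulrC ltrBlDr lerBrDr.
rewrite !lebesgue_measure_itv/= !lte_fin ltr_pM2r ?invr_gt0// ltrD2r.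
case: ifPn => _; rewrite ?mule0//.
rewrite -!EFinB -EFinM; congr EFin; field; lra.
Qed.

Lemma ge0_integral_affine (a b : R) (f : measurableTypeR R -> \bar R) :
  (0 < a)%R -> measurable_fun setT f -> (forall x, 0 <= f x) ->
  a%:E * \int[mu]_t f (a * t + b)%R = \int[mu]_t f t.
Proof.
move=> a0 mf f0.
transitivity (a%:E * \int[affine_pushforward a b]_t f t).
  congr (_ * _); rewrite [RHS]ge0_integral_pushforward//; exact: measurable_affine.
rewrite -[LHS]/((NngNum (ltW a0))%:num%:E * \int[affine_pushforward a b]_t f t).
rewrite -ge0_integral_mscale//.
apply: eq_measure_integral => A mA _.
exact: lebesgue_measure_affine.
Qed.

End Affine1.

Section Leb3.
Context {R : realType}.
Notation mu := (@lebesgue_measure R).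
Local Open Scope ereal_scope.

Lemma leb3_iter (f : mR3 R -> \bar R) : measurable_fun setT f -> (forall x, 0 <= f x) ->
  \int[leb3]_x f x = \int[mu]_x \int[mu]_y \int[mu]_z f ((x, y), z).
Proof.
move=> mf f0.
transitivity (\int[leb2]_x fubini_F mu f x).
  exact: fubini_tonelli1.
transitivity (\int[mu]_x fubini_F mu (fubini_F mu f) x).
  apply: fubini_tonelli1 => //.
    apply: measurable_fun_fubini_tonelli_F => //.
  by move=> x; apply: integral_ge0.
by [].
Qed.

Definition aff3 (a : R) (v x : R3 R) : R3 R :=
  ((a * x.1.1 + v.1.1, a * x.1.2 + v.1.2), a * x.2 + v.2)%R.

Lemma measurable_aff3 a v : measurable_fun setT (aff3 a v : mR3 R -> mR3 R).
Proof.
apply: measurable_fun_pair; first apply: measurable_fun_pair;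
  apply: measurable_funD => //; apply: measurable_funM => //.
- exact: (measurableT_comp measurable_fst measurable_fst).
- exact: (measurableT_comp measurable_snd measurable_fst).
Qed.

(** Tonelli and the one-dimensional substitution, from the innermost variable outwards, each
    contributing a factor [a]. [G] and [H] are the partial integrals of [f]; in [G1] and [H1] the
    inner variables are already substituted. *)
Lemma ge0_integral_aff3 (a : R) (v : R3 R) (f : mR3 R -> \bar R) : (0 < a)%R ->
  measurable_fun setT f -> (forall x, 0 <= f x) ->
  (a ^+ 3)%:E * \int[leb3]_x f (aff3 a v x) = \int[leb3]_x f x.
Proof.
move=> a0 mf f0.
rewrite !leb3_iter//; last exact: measurableT_comp mf (measurable_aff3 _ _).
have -> : (a ^+ 3)%:E = a%:E * (a%:E * a%:E) by rewrite -!EFinM exprS expr2.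
have ma b := measurable_affine a b.
pose G (x y : R) := \int[mu]_z f ((x, y), z).
have mG : measurable_fun setT (fun p : measurableTypeR R * measurableTypeR R => G p.1 p.2).
  have := @measurable_fun_fubini_tonelli_F _ _ _ _ _ mu f mf f0.
  by apply: eq_measurable_fun => -[].
have G0 x y : 0 <= G x y by apply: integral_ge0.
pose H (x : R) := \int[mu]_y G x y.
have mH : measurable_fun setT (H : measurableTypeR R -> _).
  exact: (@measurable_fun_fubini_tonelli_F _ _ _ _ _ mu _ mG (fun _ => G0 _ _)).
have H0 x : 0 <= H x by apply: integral_ge0.
have mGx x : measurable_fun setT (G x : measurableTypeR R -> _).
  exact: (measurableT_comp mG (measurable_fun_pair (measurable_cst x) (@measurable_id _ _ _))).
have mfxy x y : measurable_fun setT ((fun z => f ((x, y), z)) : measurableTypeR R -> _).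
  exact: (measurableT_comp mf (measurable_fun_pair (measurable_cst (x, y)) (@measurable_id _ _ _))).
pose G1 (x y : R) := \int[mu]_z f (x, y, (a * z + v.2)%R).
have m1 : measurable_fun setT (fun p : mR3 R => f (p.1, (a * p.2 + v.2)%R)).
  apply: (measurableT_comp mf); apply: measurable_fun_pair => //.
  exact: (measurableT_comp (ma v.2)).
have mG1 : measurable_fun setT (fun p : measurableTypeR R * measurableTypeR R => G1 p.1 p.2).
  have := @measurable_fun_fubini_tonelli_F _ _ _ _ _ mu _ m1 (fun _ => f0 _).
  by apply: eq_measurable_fun => -[].
have G10 x y : 0 <= G1 x y by apply: integral_ge0.
have GE x y : G x y = a%:E * G1 x y.
  exact/esym/(@ge0_integral_affine _ a v.2 _ a0 (mfxy x y) (fun _ => f0 _)).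
pose H1 (x : R) := \int[mu]_y G1 x (a * y + v.1.2)%R.
have m2 : measurable_fun setT (fun p : measurableTypeR R * measurableTypeR R => G1 p.1 (a * p.2 + v.1.2)%R).
  apply: (measurableT_comp mG1 (g := fun p => (p.1, (a * p.2 + v.1.2)%R))).
  apply: measurable_fun_pair => //; exact: (measurableT_comp (ma v.1.2)).
have mH1 : measurable_fun setT (H1 : measurableTypeR R -> _).
  exact: (@measurable_fun_fubini_tonelli_F _ _ _ _ _ mu _ m2 (fun _ => G10 _ _)).
have H10 x : 0 <= H1 x by apply: integral_ge0.
have mG1x x : measurable_fun setT (G1 x : measurableTypeR R -> _).
  exact: (measurableT_comp mG1 (measurable_fun_pair (measurable_cst x) (@measurable_id _ _ _))).
have HE x : H x = a%:E * (a%:E * H1 x).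
  rewrite /H; under eq_integral do rewrite GE.
  rewrite ge0_integralZl_EFin ?ltW//; congr (_ * _).
  exact/esym/(@ge0_integral_affine _ a v.1.2 _ a0 (mG1x x) (G10 x)).
transitivity (\int[mu]_x H x); last by [].
under [RHS]eq_integral do rewrite HE.
rewrite ge0_integralZl_EFin ?ltW//; last 2 first.
  by move=> x _; rewrite mule_ge0// lee_fin ltW.
  exact: measurable_funeM.
rewrite ge0_integralZl_EFin ?ltW// -!muleA; congr (_ * (_ * _)).
exact: (@ge0_integral_affine _ a v.1.1 _ a0 mH1 H10).
Qed.

End Leb3.

(** * Borel measurability of open sets and continuous functions *)

Section Continuous3.
Context {R : realType}.

(** The sigma-algebra is a product, so an open set is written as a countable union of boxes with
    rational centres and radii 1/(n+1). [C] replaces the boxes not contained in [U] by the empty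
    set, so that the union can run over all indices. *)
Lemma open_measurable3 (U : set (R3 R)) : open U -> measurable (U : set (mR3 R)).
Proof.
move=> oU.
pose B (q1 q2 q3 : rat) (n : nat) : set (mR3 R) :=
  (ball (ratr q1 : R) n.+1%:R^-1 `*` ball (ratr q2 : R) n.+1%:R^-1) `*`
   ball (ratr q3 : R) n.+1%:R^-1.
have mB q1 q2 q3 n : measurable (B q1 q2 q3 n).
  by apply: measurableX; [apply: measurableX|]; exact: measurable_ball.
pose C q1 q2 q3 n := if `[< B q1 q2 q3 n `<=` U >] then B q1 q2 q3 n else set0.
have mC q1 q2 q3 n : measurable (C q1 q2 q3 n) by rewrite /C; case: ifP.
have -> : U = \bigcup_q1 \bigcup_q2 \bigcup_q3 \bigcup_n C q1 q2 q3 n.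
  apply/seteqP; split => [x Ux|x [q1 _ [q2 _ [q3 _ [n _]]]]]; last first.
    by rewrite /C; case: asboolP => // + Bx; exact.
  have /nbhs_ballP[e /= e0 xeU] : nbhs x U by exact: open_nbhs_nbhs.
  have [n] : exists n : nat, n.+1%:R^-1 < e / 2.
    have [n] := @near_infty_natSinv_lt R (PosNum (divr_gt0 e0 (ltr0Sn R 1))).
    by move=> _ /(_ n (leqnn n)) ?; exists n.
  move=> ne.
  have n0 : 0 < n.+1%:R^-1 :> R by rewrite invr_gt0.
  have near_rat (t : R) : exists q, ball (ratr q : R) n.+1%:R^-1 t.
    have [q] := @rat_in_itvoo R t (t + n.+1%:R^-1) ltac:(by rewrite ltrDl).
    rewrite in_itv/= => /andP[tq qt]; exists q.
    by rewrite -ball_normE/= gtr0_norm ?subr_gt0// ltrBlDl.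
  have [q1 h1] := near_rat x.1.1; have [q2 h2] := near_rat x.1.2.
  have [q3 h3] := near_rat x.2.
  exists q1 => //; exists q2 => //; exists q3 => //; exists n => //.
  (* The centre of the box is within 1/(n+1) of both [x] and [y], and twice this radius is below
     [e]. *)
  have BU : B q1 q2 q3 n `<=` U.
    move=> y [[/= y1 y2] y3]; apply: xeU.
    have tri (a b c : R) : ball a n.+1%:R^-1 b -> ball a n.+1%:R^-1 c -> ball b e c.
      move=> ab ac; apply: (@le_ball _ _ _ (n.+1%:R^-1 + n.+1%:R^-1)).
        by rewrite [leRHS]splitr lerD// ltW.
      exact: ball_triangle (ball_sym ab) ac.
    by split; [split|]; [exact: tri h1 y1|exact: tri h2 y2|exact: tri h3 y3].
  by rewrite /C asboolT//; split => //; split.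
by do 3 apply: bigcupT_measurable_rat => ?; exact: bigcupT_measurable.
Qed.

Lemma continuous_measurable3 (f : R3 R -> R) : continuous f ->
  measurable_fun setT (f : mR3 R -> R).
Proof.
move=> /continuousP cf; apply: (measurability _ (RGenOpens.measurableE R)).
move=> _ [_ [a [b ->] <-]]; rewrite setTI; apply: open_measurable3.
exact/cf/interval_open.
Qed.

End Continuous3.

(** * Translations and dilations *)

Section Shift.
Context {R : realType}.

Lemma ge0_integral_affine3 (a : R) (v : R3 R) (f : mR3 R -> \bar R) : 0 < a ->
  measurable_fun setT f -> (forall x, 0 <= f x)%E ->
  ((a ^+ 3)%:E * \int[leb3]_x f (a *: x + v)%R = \int[leb3]_x f x)%E.
Proof. by move=> a0 mf f0; rewrite -(ge0_integral_aff3 v a0 mf f0). Qed.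

Lemma measurable_affine3 (a : R) (v : R3 R) :
  measurable_fun setT ((fun x => a *: x + v) : mR3 R -> mR3 R).
Proof. exact: measurable_aff3. Qed.

Lemma measurable_shift3 (v : R3 R) :
  measurable_fun setT ((fun x => x + v) : mR3 R -> mR3 R).
Proof.
have := measurable_affine3 1 v; apply: eq_measurable_fun => x _.
by rewrite scale1r.
Qed.

Lemma ge0_integral_shift3 (v : R3 R) (f : mR3 R -> \bar R) :
  measurable_fun setT f -> (forall x, 0 <= f x)%E ->
  (\int[leb3]_x f (x + v)%R = \int[leb3]_x f x)%E.
Proof.
move=> mf f0; rewrite -[RHS](ge0_integral_affine3 v ltr01 mf f0) expr1n mul1e.
by apply: eq_integral => x _; rewrite scale1r.
Qed.

Lemma integral_shift3 (v : R3 R) (f : mR3 R -> \bar R) :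
  measurable_fun setT f ->
  (\int[leb3]_x f (x + v)%R = \int[leb3]_x f x)%E.
Proof.
move=> mf; rewrite [LHS]integralE [RHS]integralE; congr (_ - _)%E.
- transitivity (\int[leb3]_x (funepos f) (x + v)%R)%E.
    by apply: eq_integral => x _; rewrite !funeposE.
  by apply: ge0_integral_shift3 => //; apply: measurable_funepos.
- transitivity (\int[leb3]_x (funeneg f) (x + v)%R)%E.
    by apply: eq_integral => x _; rewrite !funenegE.
  by apply: ge0_integral_shift3 => //; apply: measurable_funeneg.
Qed.

Lemma integrable_shift3 (v : R3 R) (f : mR3 R -> \bar R) :
  leb3.-integrable setT f -> leb3.-integrable setT (fun x => f (x + v)).
Proof.
move=> /integrableP[mf foo]; apply/integrableP; split.
  exact: measurableT_comp mf (measurable_shift3 v).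
rewrite (@ge0_integral_shift3 v (fun x => `|f x|%E))//.
exact: measurableT_comp.
Qed.

End Shift.

(** * Square-integrable functions *)

Section SquareIntegrable.
Context {R : realType}.
Implicit Types (u w : R3 R -> R).

Definition measurable3 (f : R3 R -> R) := measurable_fun setT (f : mR3 R -> R).
Definition integrable3 (f : R3 R -> R) :=
  leb3.-integrable setT (fun x : mR3 R => (f x)%:E).

Lemma integrable3_measurable f : integrable3 f -> measurable3 f.
Proof. by move=> /measurable_int/measurable_EFinP. Qed.

Lemma L2P u : L2 u <-> measurable3 u /\ integrable3 (fun x => u x ^+ 2).
Proof.
split=> [u2|[mu iu]].
  split; last exact: Lfun2_integrable_sqr.
  by move: u2; rewrite /L2 inE => /andP[]; rewrite inE.
rewrite /L2 inE; apply/andP; split; rewrite inE//= /finite_norm unlock/=.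
rewrite poweR_lty//.
move/integrableP : iu => [_]; apply: le_lt_trans.
rewrite ge0_le_integral//.
- apply/measurable_EFinP.
  apply/(@measurableT_comp _ _ _ _ _ _ (fun x : R => x `^ 2)%R) => //.
  exact/measurableT_comp.
- do 2 apply: measurableT_comp => //.
  exact: (@measurable_funX _ (mR3 R) R).
- by move=> x _ /=; rewrite lee_fin powR_mulrn// -normrX.
Qed.

Lemma L2_measurable u : L2 u -> measurable3 u.
Proof. by case/L2P. Qed.

Lemma L2_integrable u : L2 u -> integrable3 (fun x => u x ^+ 2).
Proof. by case/L2P. Qed.

Lemma measurable3D f g : measurable3 f -> measurable3 g ->
  measurable3 (fun x => f x + g x).
Proof. exact: (@measurable_funD _ (mR3 R) R setT f g). Qed.

Lemma measurable3B f g : measurable3 f -> measurable3 g ->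
  measurable3 (fun x => f x - g x).
Proof. exact: (@measurable_funB _ (mR3 R) R setT f g). Qed.

Lemma measurable3M f g : measurable3 f -> measurable3 g ->
  measurable3 (fun x => f x * g x).
Proof. exact: (@measurable_funM _ (mR3 R) R setT f g). Qed.

Lemma measurable3X f n : measurable3 f -> measurable3 (fun x => f x ^+ n).
Proof. exact: (@measurable_funX _ (mR3 R) R setT f n). Qed.

Lemma measurable3_cst (c : R) : measurable3 (fun=> c).
Proof. exact: measurable_cst. Qed.

Lemma measurable3_shift f v : measurable3 f -> measurable3 (fun x => f (x + v)).
Proof. by move=> mf; exact: measurableT_comp mf (measurable_shift3 v). Qed.

Lemma le_integrable3 f g : measurable3 f -> integrable3 g ->
  (forall x, `|f x| <= `|g x|) -> integrable3 f.
Proof.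
move=> mf ig fg; apply: le_integrable ig => //; first exact/measurable_EFinP.
by move=> x _ /=; rewrite lee_fin.
Qed.

Lemma integrable3D f g : integrable3 f -> integrable3 g ->
  integrable3 (fun x => f x + g x).
Proof. by move=> /integrableD h /h; apply. Qed.

Lemma integrable3B f g : integrable3 f -> integrable3 g ->
  integrable3 (fun x => f x - g x).
Proof. by move=> /integrableB h /h; apply. Qed.

Lemma integrable3Z c f : integrable3 f -> integrable3 (fun x => c * f x).
Proof. by move=> /integrableZl h; apply: h. Qed.

Lemma integrable3_norm f : integrable3 f -> integrable3 (fun x => `|f x|).
Proof. by move=> ?; apply: integrable_norm. Qed.

Lemma integrable3_shift f v : integrable3 f -> integrable3 (fun x => f (x + v)).
Proof. by move=> /(integrable_shift3 v). Qed.

Lemma Rintegral_shift3 f v : measurable3 f ->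
  \int[leb3]_x f (x + v) = \int[leb3]_x f x.
Proof.
by move=> mf; congr fine; apply: (integral_shift3 v); apply/measurable_EFinP.
Qed.

Lemma integrable3_bounded f g (C : R) : measurable3 f -> integrable3 g ->
  (forall x, `|f x| <= C) -> integrable3 (fun x => f x * g x).
Proof.
move=> mf ig fC; apply: (@le_integrable3 _ (fun x => C * g x)).
- by apply: measurable3M => //; exact: integrable3_measurable.
- exact: integrable3Z.
- move=> x; rewrite !normrM ler_wpM2r// (le_trans (fC x))//.
  exact: ler_norm.
Qed.

Lemma L2_mul u w : L2 u -> L2 w -> integrable3 (fun x => u x * w x).
Proof.
move=> /L2P[mu iu] /L2P[mw iw].
apply: (@le_integrable3 _ (fun x => u x ^+ 2 + w x ^+ 2)).
- exact: measurable3M.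
- exact: integrable3D.
- move=> x; rewrite [leRHS]ger0_norm ?addr_ge0 ?sqr_ge0//.
  by rewrite ler_norml; apply/andP; split; nra.
Qed.

Lemma L2D u w : L2 u -> L2 w -> L2 (fun x => u x + w x).
Proof.
move=> u2 w2; have [mu iu] := (L2P _).1 u2; have [mw iw] := (L2P _).1 w2.
apply/L2P; split; first exact: measurable3D.
rewrite (_ : (fun x => _) = (fun x => u x ^+ 2 + 2 * (u x * w x) + w x ^+ 2)).
  by do ![apply: integrable3D|apply: integrable3Z] => //; exact: L2_mul.
by apply/funext => x; rewrite sqrrD mulr_natl.
Qed.

Lemma L2Z c u : L2 u -> L2 (fun x => c * u x).
Proof.
move=> /L2P[mu iu]; apply/L2P; split.
  exact: (measurable3M (measurable3_cst c) mu).
under [X in integrable3 X]eq_fun do rewrite exprMn; exact: integrable3Z.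
Qed.

Lemma L2B u w : L2 u -> L2 w -> L2 (fun x => u x - w x).
Proof.
move=> u2 w2; rewrite (_ : (fun x => _) = (fun x => u x + (-1) * w x)).
  by apply: L2D => //; exact: L2Z.
by apply/funext => x; rewrite mulN1r.
Qed.

Lemma L2_shift u v : L2 u -> L2 (fun x => u (x + v)).
Proof.
move=> /L2P[mu iu]; apply/L2P; split; first exact: measurable3_shift.
exact: (integrable3_shift v iu).
Qed.

Lemma le_L2 u w : measurable3 u -> L2 w -> (forall x, `|u x| <= `|w x|) -> L2 u.
Proof.
move=> mu /L2P[mw iw] uw; apply/L2P; split => //.
apply: le_integrable3 iw _; first exact: measurable3X.
by move=> x; rewrite !normrX lerXn2r// nnegrE.
Qed.

Lemma integral_sq_ge0 u : 0 <= \int[leb3]_x (u x ^+ 2).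
Proof. by apply: Rintegral_ge0 => x _; exact: sqr_ge0. Qed.

Lemma Rintegral3D f g : integrable3 f -> integrable3 g ->
  \int[leb3]_x (f x + g x) = \int[leb3]_x f x + \int[leb3]_x g x.
Proof. by move=> *; exact: RintegralD. Qed.

Lemma Rintegral3B f g : integrable3 f -> integrable3 g ->
  \int[leb3]_x (f x - g x) = \int[leb3]_x f x - \int[leb3]_x g x.
Proof. by move=> *; exact: RintegralB. Qed.

Lemma Rintegral3Z c f : integrable3 f ->
  \int[leb3]_x (c * f x) = c * \int[leb3]_x f x.
Proof. by move=> *; exact: RintegralZl. Qed.

Lemma le_Rintegral3 f g : integrable3 f -> integrable3 g ->
  (forall x, f x <= g x) -> \int[leb3]_x f x <= \int[leb3]_x g x.
Proof. by move=> *; exact: le_Rintegral. Qed.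

Lemma dominated_Rintegral3 (f_ : nat -> R3 R -> R) f g :
  (forall n, measurable3 (f_ n)) -> measurable3 f ->
  (forall x, f_ n x @[n --> \oo] --> f x) -> integrable3 g ->
  (forall n x, `|f_ n x| <= g x) ->
  \int[leb3]_x f_ n x @[n --> \oo] --> \int[leb3]_x f x.
Proof.
move=> mf_ mf cf ig fg.
have [fi _ cv] := @dominated_convergence _ _ _ leb3 setT measurableT
  (fun n x => (f_ n x)%:E) (fun x => (f x)%:E) (fun x => (g x)%:E)
  (fun n => (measurable_EFinP _ _).2 (mf_ n)) ((measurable_EFinP _ _).2 mf)
  ltac:(by apply: aeW => x _; apply/fine_cvgP; split; [exact: nearW|exact: cf])
  ig ltac:(by apply: aeW => x n _; rewrite lee_fin).
apply: fine_cvg.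
by rewrite fineK//; exact: integrable_fin_num.
Qed.

End SquareIntegrable.

(** * Test functions and weak derivatives *)

Section Lines.
Context {R : realType}.
Implicit Types (f : R3 R -> R) (x v : R3 R).

Lemma is_derive_line f x v (t d : R) :
  is_derive (x + t *: v) v f d -> is_derive t (1 : R) (fun s : R => f (x + s *: v)) d.
Proof.
have E : (fun h : R => h^-1 *: ((f \o shift (x + t *: v)) (h *: v) - f (x + t *: v)))
   = (fun h : R => h^-1 *: (((fun s : R => f (x + s *: v)) \o shift t) (h *: (1 : R)) - f (x + t *: v))).
  apply/funext => h /=; congr (_ *: (f _ - _)).
  by rewrite [h *: 1]mulr1 scalerDl addrCA addrC -addrA [_ + x]addrC.
move=> [fd fE]; split.
- by move: fd; rewrite /derivable E.
- by rewrite -fE /derive E.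
Qed.

Lemma line_is_derive f x v (d : R) :
  is_derive (0 : R) 1 (fun s : R => f (x + s *: v)) d -> is_derive x v f d.
Proof.
have E : (fun h : R => h^-1 *: ((f \o shift x) (h *: v) - f x))
   = (fun h : R => h^-1 *: (((fun s : R => f (x + s *: v)) \o shift 0) (h *: (1 : R)) - f (x + (0:R) *: v))).
  apply/funext => h /=; congr (_ *: (f _ - f _)).
    by rewrite [h *: 1]mulr1 addr0 addrC.
  by rewrite scale0r addr0.
move=> [fd fE]; split.
- by rewrite /derivable E.
- by rewrite -fE /derive E.
Qed.

Lemma is_derive_shift3 f x v w (d : R) :
  is_derive (x + w) v f d -> is_derive x v (fun y => f (y + w)) d.
Proof.
have E : (fun h : R => h^-1 *: ((f \o shift (x + w)) (h *: v) - f (x + w)))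
   = (fun h : R => h^-1 *: (((fun y => f (y + w)) \o shift x) (h *: v) - f (x + w))).
  by apply/funext => h /=; rewrite addrA.
move=> [fd fE]; split.
- by move: fd; rewrite /derivable E.
- by rewrite -fE /derive E.
Qed.

End Lines.

(** * The smooth functions exp(-c/t), extended by 0 *)

Section Theta.
Context {R : realType}.
Variable c : R.
Hypothesis c0 : 0 < c.

(* The factor [t^-m] makes the family closed under differentiation. *)
Definition theta (m : nat) (t : R) : R :=
  if 0 < t then t^-1 ^+ m * expR (- c * t^-1) else 0.

Lemma theta_ge0 m t : 0 <= theta m t.
Proof.
rewrite /theta; case: ifPn => // t0.
by rewrite mulr_ge0 ?expR_ge0// exprn_ge0// invr_ge0 ltW.
Qed.

(** A single term of the exponential series, exp(c/t) >= (c/t)^(m+1) / (m+1)!, absorbs the factor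
    t^-m and leaves one power of t. The linear bound gives differentiability at 0. *)
Lemma theta_le m t : theta m t <= (m.+1)`!%:R / c ^+ m.+1 * `|t|.
Proof.
rewrite /theta; case: ifPn => t0; last first.
  by rewrite mulr_ge0// divr_ge0// exprn_ge0// ltW.
rewrite gtr0_norm// mulNr expRN.
have ct0 : 0 <= c * t^-1 by rewrite mulr_ge0 ?invr_ge0 ?ltW.
have /(le_trans _) : (c * t^-1) ^+ m.+1 / m.+1`!%:R <= expR (c * t^-1).
  by apply: le_trans (expR_ge1Dxn m ct0); rewrite lerDr.
move=> /(_ _ (lexx _)) h.
rewrite ler_pdivrMr ?expR_gt0//.
apply: (@le_trans _ _ (m.+1`!%:R / c ^+ m.+1 * t * ((c * t^-1) ^+ m.+1 / m.+1`!%:R))); last first.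
  by rewrite ler_wpM2l// mulr_ge0 ?(ltW t0)// divr_ge0// exprn_ge0// ltW.
rewrite exprMn exprSr [t^-1 ^+ m.+1]exprSr.
have ? : m.+1`!%:R != 0 :> R by rewrite pnatr_eq0 -lt0n fact_gt0.
have ? : c ^+ m != 0 by rewrite expf_neq0// gt_eqF.
rewrite le_eqVlt; apply/orP; left; apply/eqP; field.
by apply/and4P; split => //; rewrite gt_eqF.
Qed.

Lemma theta_mul m t : t^-1 * theta m t = theta m.+1 t.
Proof. by rewrite /theta; case: ifPn; rewrite ?mulr0// exprS mulrA. Qed.

Lemma is_derive_theta m (t : R) :
  is_derive t (1 : R) (theta m) (c * theta m.+2 t - m%:R * theta m.+1 t).
Proof.
have [t0|t0|->] := ltgtP t 0.
- apply: (@near_eq_is_derive _ _ _ (cst 0)) => //.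
    near=> s; rewrite /theta ifN// -leNgt ltW//=.
    near: s; exact: lt_nbhsl.
  have tf : (0 < t) = false by apply/negbTE; rewrite -leNgt ltW.
  by rewrite /theta tf !mulr0 subr0; exact: is_derive_cst.
- apply: (@near_eq_is_derive _ R R (fun t : R => t^-1 ^+ m * expR (- c * t^-1))).
    near=> s; rewrite /theta ifT//.
    near: s; exact: lt_nbhsr.
  rewrite /theta t0.
  have tn : t != 0 by rewrite gt_eqF.
  have td : is_derive t (1 : R) (fun s : R => s^-1) (- t ^- 2).
    have := @is_deriveV _ id t 1 1 tn (is_derive_id _ _).
    by move/is_derive_eq; apply; rewrite [LHS]mulr1.
  have ed : is_derive t (1 : R) (fun s => expR (- c * s^-1)) (expR (- c * t^-1) * (- c * - t ^- 2)).
    have := @is_derive1_comp _ expR (fun s : R => - c * s^-1) t _ _ (is_derive_expR _)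
      (@is_deriveZ _ _ _ (fun s : R => s^-1) (- c) t 1 _ td).
    exact.
  have pd : is_derive t (1 : R) (fun s : R => s^-1 ^+ m) (m%:R * t^-1 ^+ m.-1 * - t ^- 2).
    have := @is_deriveX _ _ (fun s : R => s^-1) m t 1 _ td.
    by rewrite [X in is_derive _ _ X _](_ : _ = (fun s => s^-1 ^+ m))//; apply/funext => s; rewrite fctE.
  have := @is_deriveM _ _ _ _ _ _ _ _ pd ed.
  move/is_derive_eq; apply.
  rewrite /GRing.scale/= !exprS; case: m {pd} => [|m].
    by rewrite !mul0r; field.
  rewrite -[m.+1.-1]/m !exprS; field.
  by [].
- have th0 n : theta n 0 = 0 by rewrite /theta ltxx.
  rewrite !th0 !mulr0 subr0.
  (* The difference quotient at 0 is [theta m.+1 h] by [theta_mul], and this is O(|h|). *)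
  have cv : h^-1 *: ((theta m \o shift 0) (h *: (1 : R)) - theta m 0) @[h --> 0^'] --> (0 : R).
    have K0 : 0 < (m.+2)`!%:R / c ^+ m.+2 :> R.
      by rewrite divr_gt0 ?exprn_gt0// ltr0n fact_gt0.
    apply/cvgr0Pnorm_lt => e e0; near=> h.
    have hn0 : h != 0 by near: h; exact: nbhs_dnbhs_neq.
    rewrite /= addr0 [h *: 1]mulr1 th0 subr0 [_ *: _]theta_mul ger0_norm ?theta_ge0//.
    apply: le_lt_trans (theta_le _ _) _.
    rewrite mulrC -ltr_pdivlMr//.
    near: h; apply: dnbhs0_lt; by rewrite divr_gt0.
  split; first by apply/cvg_ex; exists 0; exact: cv.
  exact: cvg_lim cv.
Unshelve. all: by end_near. Qed.

Lemma continuous_theta m : continuous (theta m).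
Proof.
move=> t; have [d _] := is_derive_theta m t.
exact/differentiable_continuous/derivable1_diffP.
Qed.

End Theta.

(** * Closure properties of C^k functions *)

Section CkTheory.
Context {R : realType}.
Implicit Types (f g : R3 R -> R) (i : 'I_3).

Lemma CkW k f : Ck k.+1 f -> Ck k f.
Proof.
elim: k f => [|k IH] f [cf h]; first by split.
split => // i; have [d hd] := h i; split => //.
exact: IH.
Qed.

Lemma CkS k f (df : 'I_3 -> R3 R -> R) : continuous f ->
  (forall i x, is_derive x (basis3 i) f (df i x)) -> (forall i, Ck k (df i)) ->
  Ck k.+1 f.
Proof.
move=> cf fd dk; split => // i; split => [x|]; first by case: (fd i x).
suff -> : 'D_(basis3 i) f = df i by [].
by apply/funext => x; case: (fd i x).
Qed.

Lemma CkD k f g : Ck k f -> Ck k g -> Ck k (f \+ g).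
Proof.
elim: k f g => [|k IH] f g [cf hf] [cg hg].
  by split => // x; apply: cvgD; [exact: cf|exact: cg].
apply: (@CkS _ _ (fun i => 'D_(basis3 i) f \+ 'D_(basis3 i) g)).
- by move=> x; apply: cvgD; [exact: cf|exact: cg].
- by move=> i x; apply: is_deriveD; apply: derivableP; [case: (hf i)|case: (hg i)].
- by move=> i; apply: IH; [case: (hf i)|case: (hg i)].
Qed.

Lemma CkM k f g : Ck k f -> Ck k g -> Ck k (f \* g).
Proof.
elim: k f g => [|k IH] f g; [move=> [cf hf] [cg hg]|move=> Cf Cg].
  by split => // x; apply: cvgM; [exact: cf|exact: cg].
have [cf hf] := Cf; have [cg hg] := Cg.
apply: (@CkS _ _ (fun i => (f \* 'D_(basis3 i) g) \+ (g \* 'D_(basis3 i) f))).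
- by move=> x; apply: cvgM; [exact: cf|exact: cg].
- by move=> i x; apply: is_deriveM; apply: derivableP; [case: (hf i)|case: (hg i)].
- by move=> i; apply: CkD; apply: IH; (exact: CkW || by [case: (hf i)|case: (hg i)]).
Qed.

Lemma Ck_cst k (c : R) : Ck k (cst c).
Proof.
elim: k c => [|k IH] c; first by split => // x; exact: cvg_cst.
apply: (@CkS _ _ (fun i => cst 0)) => // x; first exact: cvg_cst.
Qed.

Lemma CkZ k (c : R) f : Ck k f -> Ck k (c \*: f).
Proof. by move=> cf; apply: (@CkM k (cst c)) => //; exact: Ck_cst. Qed.

Lemma continuous_shift3 f (v : R3 R) : continuous f ->
  continuous (fun x : R3 R => f (x + v)).
Proof.
move=> cf x; apply: (@continuous_comp _ _ _ (fun x : R3 R => x + v)).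
  by apply: cvgD; [exact: cvg_id|exact: cvg_cst].
exact: cf.
Qed.

Lemma Ck_shift k f (v : R3 R) : Ck k f -> Ck k (fun x : R3 R => f (x + v)).
Proof.
elim: k f => [|k IH] f [cf hf]; first by split => //; exact: continuous_shift3.
apply: (@CkS _ _ (fun i (x : R3 R) => ('D_(basis3 i) f) (x + v))).
- exact: continuous_shift3.
- by move=> i x; apply: is_derive_shift3; apply: derivableP; case: (hf i).
- by move=> i; have [_ /IH] := hf i.
Qed.

Lemma is_derive_affine (a b t : R) : is_derive t (1 : R) (fun s : R => a + s * b) b.
Proof.
have h1 := @is_deriveZ R R R id b t 1 1 (is_derive_id _ _).
have h2 := @is_deriveD R R R (cst a) (b \*: id) t 1 0 _ (is_derive_cst _ _ _) h1.
have -> : (fun s : R => a + s * b) = cst a + (b \*: id).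
  by apply/funext => s; rewrite fctE [s * b]mulrC.
by move/is_derive_eq: h2; apply; rewrite add0r [_ *: _]mulr1.
Qed.

(** The function [l] is affine with slopes [d i], so each partial derivative of [theta c m \o l] is
    a combination of [theta c m.+2 \o l] and [theta c m.+1 \o l]. Hence the induction on [k] is
    uniform in [m]. *)
Lemma Ck_theta k (c : R) m (l : R3 R -> R) (d : 'I_3 -> R) : 0 < c -> continuous l ->
  (forall i x t, l (x + t *: basis3 i) = l x + t * d i) ->
  Ck k (theta c m \o l).
Proof.
move=> c0 cl ld; elim: k m => [|k IH] m; have ct : continuous (theta c m \o l).
  by move=> x; apply: continuous_comp; [exact: cl|exact: continuous_theta].
  by split.
  by move=> x; apply: continuous_comp; [exact: cl|exact: continuous_theta].
apply: (@CkS _ _ (fun i => (d i * c) \*: (theta c m.+2 \o l) \+ (- (d i * m%:R)) \*: (theta c m.+1 \o l))) => //.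
  move=> i x; apply: line_is_derive.
  have -> : (fun s : R => (theta c m \o l) (x + s *: basis3 i)) = theta c m \o (fun s => l x + s * d i).
    by apply/funext => s /=; rewrite ld.
  have dl : is_derive (0 : R) 1 (fun s : R => l x + s * d i) (d i).
    exact: is_derive_affine.
  apply: is_derive_eq.
    apply: (@is_derive1_comp _ (theta c m)) => //; exact: is_derive_theta.
  by rewrite /= mul0r addr0 /GRing.scale/=; ring.
by move=> i; apply: CkD; apply: CkZ.
Qed.

End CkTheory.

(** * Test functions *)

Section TestFunctions.
Context {R : realType}.
Implicit Types (f g phi : R3 R -> R) (i : 'I_3) (x v : R3 R).

Definition cube (n : R) : set (R3 R) := (`[-n, n] `*` `[-n, n]) `*` `[-n, n].

Lemma compact_cube n : compact (cube n).
Proof. by do 2 (apply: compact_setX; last exact: segment_compact); exact: segment_compact. Qed.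

Lemma measurable_cube n : measurable (cube n : set (mR3 R)).
Proof. by do 2 apply: measurableX => //. Qed.

Lemma leb3_box (I J K : set (measurableTypeR R)) :
  measurable I -> measurable J -> measurable K ->
  leb3 ((I `*` J) `*` K) =
  (lebesgue_measure I * lebesgue_measure J * lebesgue_measure K)%E.
Proof.
move=> mI mJ mK; rewrite /leb3 product_measure1E//; last exact: measurableX.
by congr (_ * _)%E; rewrite -product_measure1E.
Qed.

Lemma leb3_cube_lty n : (leb3 (cube n : set (mR3 R)) < +oo)%E.
Proof.
rewrite leb3_box// lebesgue_measure_itv/=.
by case: ifP => _; rewrite ?mul0e// -!EFinB -!EFinM ltry.
Qed.

Lemma integrable3_cube n (C : R) : integrable3 (fun x => C * \1_(cube n) x).
Proof.
apply: integrable3Z; apply/integrableP; split.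
  by apply/measurable_EFinP; apply: measurable_indic; exact: measurable_cube.
under eq_integral do rewrite gee0_abs ?lee_fin//.
rewrite integral_indic//; last exact: measurable_cube.
by rewrite setIT; exact: leb3_cube_lty.
Qed.

Lemma test_functionI f (K : set (R3 R)) : (forall k, Ck k f) -> compact K ->
  (forall x, ~ K x -> f x = 0) -> test_function f.
Proof.
move=> cf cK fK; split => //.
have cl : closed K by apply: compact_closed => //; exact: norm_hausdorff.
apply: subclosed_compact cK _; first exact: closed_closure.
rewrite [X in _ `<=` X](closure_id K).1//; apply: closure_subset => x /= /eqP fx.
by apply: contrapT => /fK.
Qed.

Lemma test_supportP f : test_function f ->
  exists K, [/\ compact K, closed K & forall x, ~ K x -> f x = 0].
Proof.
move=> [_ cK]; exists (closure [set x | f x != 0]); split => //.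
  exact: closed_closure.
move=> x nx; apply/eqP/negPn/negP => fx; apply: nx.
exact: subset_closure.
Qed.

Lemma compact_cubeP (K : set (R3 R)) : compact K -> exists2 n : R, 0 < n & K `<=` cube n.
Proof.
move=> /compact_bounded [M [Mr MK]]; exists (Num.max 1 (M + 1)).
  by rewrite lt_max ltr01.
move=> x Kx; have := MK (Num.max 1 (M + 1)) _ x Kx.
rewrite lt_max ltrDl ltr01 orbT => /(_ isT).
by rewrite /Num.norm/= !ge_max !ler_norml => /andP[/andP[? ?] ?];
  split; [split|]; rewrite /= in_itv.
Qed.

Lemma test_supp f : test_function f ->
  exists2 n : R, 0 < n & forall x, ~ cube n x -> f x = 0.
Proof.
move=> /test_supportP[K [/compact_cubeP[n n0 Kn] _ fK]]; exists n => //.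
by move=> x nx; apply: fK; apply: contra_not nx; exact: Kn.
Qed.

Lemma test_continuous f : test_function f -> continuous f.
Proof. by move=> [/(_ 0%N) []]. Qed.

Lemma test_measurable f : test_function f -> measurable3 f.
Proof. by move=> /test_continuous; exact: continuous_measurable3. Qed.

Lemma test_bounded f : test_function f ->
  exists2 C : R, 0 < C & forall x, `|f x| <= C.
Proof.
move=> tf; have [K [cK _ fK]] := test_supportP tf.
have : compact (f @` K).
  by apply: continuous_compact cK; apply: continuous_subspaceT; exact: test_continuous.
move=> /compact_bounded[M [Mr MK]]; exists (Num.max 1 (M + 1)).
  by rewrite lt_max ltr01.
move=> x; have [Kx|nKx] := pselect (K x); last first.
  by rewrite fK// normr0 le_max ler01.
apply: MK; last by exists x.
by rewrite lt_max ltrDl ltr01 orbT.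
Qed.

Lemma test_le f : test_function f -> exists n C : R, [/\ 0 < n, 0 < C &
  forall x, `|f x| <= C * \1_(cube n) x].
Proof.
move=> tf; have [n n0 fn] := test_supp tf; have [C C0 fC] := test_bounded tf.
exists n, C; split => // x; rewrite indicE; have [xn|xn] := boolP (x \in cube n).
  by rewrite mulr1.
by rewrite fn ?normr0 ?mulr0//; move/negP: xn; rewrite inE.
Qed.

Lemma test_integrable f : test_function f -> integrable3 f.
Proof.
move=> tf; have [n [C [n0 C0 fC]]] := test_le tf.
apply: le_integrable3 (integrable3_cube n C) _; first exact: test_measurable.
move=> x; apply: le_trans (fC x) _; exact: ler_norm.
Qed.

Lemma test_L2 f : test_function f -> L2 f.
Proof.
move=> tf; apply/L2P; split; first exact: test_measurable.
have [C C0 fC] := test_bounded tf.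
under [X in integrable3 X]eq_fun do rewrite expr2.
apply: integrable3_bounded fC; first exact: test_measurable.
exact: test_integrable.
Qed.

Lemma test_derive i f : test_function f -> test_function ('D_(basis3 i) f).
Proof.
move=> tf; have [K [cK Kc fK]] := test_supportP tf.
apply: (@test_functionI _ K) => //.
  by move=> k; have [/(_ k.+1)[_ /(_ i)[]]] := tf.
move=> x nKx; have := @near_eq_derive _ _ _ f (cst 0) x (basis3 i).
rewrite derive_cst; apply.
have : \near x, ~ K x by move/closed_openC: Kc; rewrite openE; apply.
by apply: filterS => y /fK ->.
Qed.

Lemma test_is_derive i f x : test_function f ->
  is_derive x (basis3 i) f ('D_(basis3 i) f x).
Proof. by move=> [/(_ 1)[_ /(_ i)[fd _]] _]; apply: derivableP; exact: fd. Qed.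

Lemma test_shift f v : test_function f -> test_function (fun x => f (x + v)).
Proof.
move=> tf; have [K [cK Kc fK]] := test_supportP tf.
apply: (@test_functionI _ ((fun x => x - v) @` K)).
- by move=> k; apply: Ck_shift; case: tf.
- apply: continuous_compact cK; apply: continuous_subspaceT => x.
  by apply: cvgD; [exact: cvg_id|exact: cvg_cst].
- move=> x nx; apply: fK; apply: contra_not nx => Kx; exists (x + v) => //.
  by rewrite addrK.
Qed.

Lemma derive_shift3 i f v x : test_function f ->
  'D_(basis3 i) (fun y => f (y + v)) x = 'D_(basis3 i) f (x + v).
Proof.
move=> tf; have := @is_derive_shift3 _ f x (basis3 i) v ('D_(basis3 i) f (x + v)).
by move=> /(_ (test_is_derive i _ tf))[].
Qed.

Lemma testD f g : test_function f -> test_function g -> test_function (f \+ g).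
Proof.
move=> tf tg; have [K [cK Kc fK]] := test_supportP tf.
have [L [cL Lc gL]] := test_supportP tg.
apply: (@test_functionI _ (K `|` L)).
- by move=> k; apply: CkD; [case: tf|case: tg].
- exact: compactU.
- by move=> x /not_orP[? ?]; rewrite /= fK// gL// addr0.
Qed.

Lemma testZ (c : R) f : test_function f -> test_function (c \*: f).
Proof.
move=> tf; have [K [cK Kc fK]] := test_supportP tf.
apply: (@test_functionI _ K) => //.
- by move=> k; apply: CkZ; case: tf.
- by move=> x ?; rewrite /= fK// scaler0.
Qed.

End TestFunctions.

(** * Density of test functions in L^2 *)

Section Density.
Context {R : realType}.
Implicit Types (f g phi w : R3 R -> R) (i : 'I_3) (x v : R3 R).

Definition test_approx w := L2 w /\ forall e : R, 0 < e ->
  exists2 phi, test_function phi & \int[leb3]_x ((w x - phi x) ^+ 2) < e.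

Lemma integral_sqD u w : L2 u -> L2 w ->
  \int[leb3]_x ((u x + w x) ^+ 2) <=
  2 * \int[leb3]_x (u x ^+ 2) + 2 * \int[leb3]_x (w x ^+ 2).
Proof.
move=> u2 w2; have iu := L2_integrable u2; have iw := L2_integrable w2.
rewrite -!Rintegral3Z// -Rintegral3D//; [|exact: integrable3Z..].
apply: le_Rintegral3.
- exact/L2_integrable/L2D.
- by apply: integrable3D; exact: integrable3Z.
- by move=> x; have := sqr_ge0 (u x - w x); nra.
Qed.

Lemma test_approxZD (c : R) u w : test_approx u -> test_approx w ->
  test_approx (fun x => u x + c * w x).
Proof.
move=> [u2 hu] [w2 hw]; split; first by apply: L2D => //; exact: L2Z.
move=> e e0.
have d0 : 0 < e / (4 * (1 + c ^+ 2)).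
  by rewrite divr_gt0// mulr_gt0// ltr_wpDr// sqr_ge0.
have [p tp hp] := hu _ d0; have [q tq hq] := hw _ d0.
exists (p \+ (c \*: q)); first by apply: testD => //; exact: testZ.
have up2 := L2B u2 (test_L2 tp); have wq2 := L2B w2 (test_L2 tq).
have -> : (fun x => (u x + c * w x - (p \+ c \*: q) x) ^+ 2) =
   (fun x => ((u x - p x) + (c * (w x - q x))) ^+ 2).
  by apply/funext => x; congr (_ ^+ 2); rewrite /= /GRing.scale/=; ring.
apply: le_lt_trans (integral_sqD up2 (L2Z c wq2)) _.
under [X in _ + _ * X]eq_Rintegral do rewrite exprMn.
rewrite Rintegral3Z; last exact: L2_integrable.
set a := Rintegral _ _ _ in hp *; set b := Rintegral _ _ _ in hq *.
have c1 : 0 < 4 * (1 + c ^+ 2) by rewrite mulr_gt0// ltr_wpDr// sqr_ge0.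
move: hp hq; rewrite !ltr_pdivlMr// => hp hq.
have a0 : 0 <= a by exact: integral_sq_ge0.
have b0 : 0 <= b by exact: integral_sq_ge0.
have := sqr_ge0 c; nra.
Qed.

Lemma test_approx_test phi : test_function phi -> test_approx phi.
Proof.
move=> tp; split; first exact: test_L2.
move=> e e0; exists phi => //.
under eq_Rintegral do rewrite subrr expr0n/=.
by rewrite Rintegral_cst// mul0r.
Qed.

Lemma test_approx0 : test_approx (fun=> 0).
Proof.
apply: test_approx_test; apply: (@test_functionI _ _ (cube 0)) => //.
  by move=> k; exact: Ck_cst.
exact: compact_cube.
Qed.

Lemma test_approx_cvg (w_ : nat -> R3 R -> R) w g :
  (forall n, test_approx (w_ n)) -> measurable3 w -> L2 g ->
  (forall n x, `|w x - w_ n x| <= `|g x|) ->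
  (forall x, w_ n x @[n --> \oo] --> w x) -> test_approx w.
Proof.
move=> aw mw g2 wg cw.
have mw_ n : measurable3 (w_ n) by apply: L2_measurable; case: (aw n).
have d2 n : L2 (fun x => w x - w_ n x) by apply: le_L2 g2 (wg n); exact: measurable3B.
split.
  have -> : w = (fun x => w_ 0 x + (w x - w_ 0 x)) by apply/funext => x; ring.
  by apply: L2D => //; case: (aw 0).
move=> e e0.
have cv : \int[leb3]_x ((w x - w_ n x) ^+ 2) @[n --> \oo] --> \int[leb3]_x (0 : R).
  apply: (@dominated_Rintegral3 _ _ (fun=> 0) (fun x => g x ^+ 2)).
  - by move=> n; apply: measurable3X; exact: measurable3B.
  - exact: measurable3_cst.
  - move=> x; rewrite (_ : 0 = (w x - w x) * (w x - w x)); last by rewrite subrr mulr0.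
    under eq_fun do rewrite expr2.
    by apply: cvgM; apply: cvgB => //; exact: cvg_cst.
  - exact: L2_integrable.
  - by move=> n x; rewrite normrX -[leRHS]ger0_norm ?sqr_ge0// normrX lerXn2r// nnegrE.
rewrite Rintegral_cst// mul0r in cv.
have e4 : 0 < e / 4 by rewrite divr_gt0.
have /cvgr0Pnorm_lt /(_ _ e4) [n _ /(_ n (leqnn n))] := cv.
rewrite ger0_norm ?integral_sq_ge0// => hn.
have [p tp hp] := (aw n).2 _ e4; exists p => //.
have -> : (fun x => (w x - p x) ^+ 2) = (fun x => ((w x - w_ n x) + (w_ n x - p x)) ^+ 2).
  by apply/funext => x; congr (_ ^+ 2); ring.
apply: le_lt_trans (integral_sqD (d2 n) (L2B (aw n).1 (test_L2 tp))) _.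
lra.
Qed.

(** With c = 1/(n+1), exp(-c/t) tends to 1 from below for t > 0, so these smooth functions
    approximate the indicator of the open interval ]a, b[ from below. *)
Definition bump n (a b t : R) := theta n.+1%:R^-1 0 (t - a) * theta n.+1%:R^-1 0 (b - t).

Lemma theta_cvg (t : R) : theta n.+1%:R^-1 0 t @[n --> \oo] --> ((0 < t)%R%:R : R).
Proof.
rewrite /theta; case: (boolP (0 < t)) => t0 /=; last exact: cvg_cst.
under eq_fun do rewrite expr0 mul1r.
have h : - (n.+1%:R^-1 : R) * t^-1 @[n --> \oo] --> (0 : R).
  rewrite -(mul0r t^-1) -oppr0; apply: cvgM; last exact: cvg_cst.
  apply: cvgN; exact: cvg_harmonic.
by have := cvg_comp _ _ h (@continuous_expR R 0 : expR s @[s --> (0 : R)] --> expR 0); rewrite expR0.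
Qed.

Lemma theta_le1 n (t : R) : `|theta n.+1%:R^-1 0 t| <= (0 < t)%R%:R :> R.
Proof.
rewrite ger0_norm ?theta_ge0//; rewrite /theta; case: ifPn => // t0 /=.
by rewrite expr0 mul1r expR_le1 mulNr oppr_le0 divr_ge0// ltW.
Qed.

Definition box (a b : R3 R) : set (R3 R) :=
  (`]a.1.1, b.1.1[ `*` `]a.1.2, b.1.2[) `*` `]a.2, b.2[.

Lemma box_indicE (a b x : R3 R) : \1_(box a b) x =
  ((0 < x.1.1 - a.1.1)%R%:R * (0 < b.1.1 - x.1.1)%R%:R) *
  ((0 < x.1.2 - a.1.2)%R%:R * (0 < b.1.2 - x.1.2)%R%:R) *
  ((0 < x.2 - a.2)%R%:R * (0 < b.2 - x.2)%R%:R) :> R.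
Proof.
rewrite indicE -!natrM !mulnb; congr ((nat_of_bool _)%:R).
rewrite !subr_gt0; apply/idP/idP.
  by rewrite inE => -[[]]/=; rewrite !in_itv/= => -> -> ->.
by move=> /andP[/andP[h1 h2] h3]; rewrite inE; split; [split|]; rewrite /= in_itv.
Qed.

Lemma box_sub_cube (a b : R3 R) : exists n, box a b `<=` cube n.
Proof.
exists (`|a.1.1| + `|b.1.1| + `|a.1.2| + `|b.1.2| + `|a.2| + `|b.2|).
move=> x [[]]/=; rewrite !in_itv/= => /andP[a1 b1] /andP[a2 b2] /andP[a3 b3].
have := ler_norm a.1.1; have := ler_norm (- a.1.1); have := ler_norm b.1.1; have := ler_norm (- b.1.1).
have := ler_norm a.1.2; have := ler_norm (- a.1.2); have := ler_norm b.1.2; have := ler_norm (- b.1.2).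
have := ler_norm a.2; have := ler_norm (- a.2); have := ler_norm b.2; have := ler_norm (- b.2).
rewrite !normrN => *.
by split; [split|]; rewrite /= in_itv/=; apply/andP; split; lra.
Qed.

Lemma measurable_box (a b : R3 R) : measurable (box a b : set (mR3 R)).
Proof. by do 2 apply: measurableX => //. Qed.

Lemma L2_indic (A : set (mR3 R)) n : measurable A -> A `<=` cube n ->
  L2 (\1_A : R3 R -> R).
Proof.
move=> mA An; apply: (@le_L2 _ _ (\1_(cube n))).
- exact: measurable_indic.
- apply/L2P; split; first by apply: measurable_indic; exact: measurable_cube.
  have := integrable3_cube n 1; congr (integrable3 _); apply/funext => x.
  by rewrite mul1r indicE; case: (_ \in _); rewrite ?expr1n ?expr0n.
- move=> x; rewrite !indicE !ger0_norm// ler_nat.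
  case: (boolP (x \in A)) => //; rewrite inE => /An; rewrite -inE => ->//.
Qed.

Definition box_bump n (a b x : R3 R) :=
  bump n a.1.1 b.1.1 x.1.1 * bump n a.1.2 b.1.2 x.1.2 * bump n a.2 b.2 x.2.

Lemma continuous_x1 : continuous (fun x : R3 R => x.1.1).
Proof. by move=> x; apply: cvg_comp; exact: cvg_fst. Qed.
Lemma continuous_x2 : continuous (fun x : R3 R => x.1.2).
Proof. by move=> x; apply: cvg_comp; [exact: cvg_fst|exact: cvg_snd]. Qed.
Lemma continuous_x3 : continuous (fun x : R3 R => x.2).
Proof. by move=> x; exact: cvg_snd. Qed.

Lemma Ck_bump k n (a b : R) (l : R3 R -> R) (d : 'I_3 -> R) : continuous l ->
  (forall i x t, l (x + t *: basis3 i) = l x + t * d i) ->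
  Ck k (fun x => bump n a b (l x)).
Proof.
move=> cl ld; apply: CkM.
- apply: (@Ck_theta _ k _ 0 (fun x => l x - a) d); first by rewrite invr_gt0.
  + by move=> x; apply: cvgB; [exact: cl|exact: cvg_cst].
  + by move=> i x t; rewrite ld; ring.
- apply: (@Ck_theta _ k _ 0 (fun x => b - l x) (fun i => - d i)); first by rewrite invr_gt0.
  + by move=> x; apply: cvgB; [exact: cvg_cst|exact: cl].
  + by move=> i x t; rewrite ld; ring.
Qed.

Lemma box_bump_le n (a b x : R3 R) : `|box_bump n a b x| <= \1_(box a b) x.
Proof.
rewrite box_indicE /box_bump /bump !normrM.
by rewrite !ler_pM ?mulr_ge0 ?theta_le1.
Qed.

Lemma test_box_bump n (a b : R3 R) : test_function (box_bump n a b).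
Proof.
have [N bN] := box_sub_cube a b.
apply: (@test_functionI _ _ (cube N)); last 2 first.
- exact: compact_cube.
- move=> x nx; apply/eqP; rewrite -normr_le0.
  apply: le_trans (box_bump_le n a b x) _.
  by rewrite indicE memNset//; apply: contra_not nx; exact: bN.
move=> k; apply: CkM; first apply: CkM.
- apply: (@Ck_bump _ _ _ _ _ (fun i => (i == 0%N :> nat)%:R)); first exact: continuous_x1.
  by [].
- apply: (@Ck_bump _ _ _ _ _ (fun i => (i == 1%N :> nat)%:R)); first exact: continuous_x2.
  by [].
- apply: (@Ck_bump _ _ _ _ _ (fun i => (i == 2%N :> nat)%:R)); first exact: continuous_x3.
  by [].
Qed.

Lemma box_bump_cvg (a b x : R3 R) : box_bump n a b x @[n --> \oo] --> (\1_(box a b) x : R).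
Proof.
rewrite box_indicE; apply: cvgM; first apply: cvgM.
all: by apply: cvgM; exact: theta_cvg.
Qed.

Lemma test_approx_box (a b : R3 R) : test_approx (\1_(box a b)).
Proof.
have [N bN] := box_sub_cube a b; have mb := measurable_box a b.
apply: (@test_approx_cvg (fun n => box_bump n a b) _ (fun x => 2 * \1_(box a b) x)).
- by move=> n; apply: test_approx_test; exact: test_box_bump.
- exact: measurable_indic.
- by apply: L2Z; exact: L2_indic bN.
- move=> n x; rewrite [leRHS]ger0_norm ?mulr_ge0// mulrDl mul1r.
  apply: le_trans (ler_normB _ _) _; rewrite lerD ?box_bump_le//.
  by rewrite ger0_norm.
- exact: box_bump_cvg.
Qed.

End Density.

Section Density2.
Context {R : realType}.
Implicit Types (f g phi w : R3 R -> R) (i : 'I_3) (x v : R3 R).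

Definition boxes : set (set (mR3 R)) := [set box a b | a in setT & b in setT].

Lemma setI_closed_boxes : setI_closed boxes.
Proof.
move=> _ _ [a _ [b _ <-]] [c _ [d _ <-]].
exists ((Num.max a.1.1 c.1.1, Num.max a.1.2 c.1.2), Num.max a.2 c.2) => //.
exists ((Num.min b.1.1 d.1.1, Num.min b.1.2 d.1.2), Num.min b.2 d.2) => //.
apply/seteqP; split => x.
  move=> [[]]/=; rewrite !in_itv/= !gt_max !lt_min.
  move=> /andP[/andP[? ?] /andP[? ?]] /andP[/andP[? ?] /andP[? ?]].
  move=> /andP[/andP[? ?] /andP[? ?]].
  by split; split; [split| |split|]; rewrite /= in_itv/=; apply/andP.
move=> [[[]]]/=; rewrite !in_itv/= => /andP[? ?] /andP[? ?] /andP[? ?].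
move=> [[]]/=; rewrite !in_itv/= => /andP[? ?] /andP[? ?] /andP[? ?].
by split; [split|]; rewrite /= in_itv/= gt_max lt_min; apply/andP; split; apply/andP.
Qed.

Lemma in_box_seq (x : R3 R) : exists n : nat,
  [/\ - n%:R < x.1.1 < n%:R, - n%:R < x.1.2 < n%:R & - n%:R < x.2 < n%:R].
Proof.
pose s := `|x.1.1| + `|x.1.2| + `|x.2|.
exists (Num.truncn s).+1.
have : s < (Num.truncn s).+1%:R by exact: truncnS_gt.
have := normr_ge0 x.1.1; have := normr_ge0 x.1.2; have := normr_ge0 x.2.
by rewrite /s => *; split; rewrite -ltr_norml; lra.
Qed.

(** It suffices that the three coordinates are measurable for the sigma-algebra generated by boxes.
    The preimage of an interval under a coordinate is unbounded in the other two directions, hence a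
    countable union of boxes whose other sides are ]-n, n[. *)
Lemma measurable3_boxes : @measurable _ (mR3 R) = <<s boxes >>.
Proof.
pose T := g_sigma_algebraType boxes.
have mG (A : set (mR3 R)) : boxes A -> measurable (A : set T).
  by move=> GA; exact: sub_sigma_algebra.
pose v (n : nat) (a : R) : R3 R := ((a, n%:R), n%:R).
have m1 : measurable_fun setT ((fun x => x.1.1) : T -> R).
  apply: (measurability _ (RGenOpens.measurableE R)).
  move=> _ [_ [a [b ->]] <-]; rewrite setTI.
  rewrite [X in measurable X](_ : _ = \bigcup_n box ((a, - n%:R), - n%:R) ((b, n%:R), n%:R)).
    by apply: bigcupT_measurable => n; apply: mG; do 2 eexists => //.
  apply/seteqP; split => x /=; last by move=> [n _ [[]]].
  by move=> xab; have [n [? ? ?]] := in_box_seq x; exists n.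
have m2 : measurable_fun setT ((fun x => x.1.2) : T -> R).
  apply: (measurability _ (RGenOpens.measurableE R)).
  move=> _ [_ [a [b ->]] <-]; rewrite setTI.
  rewrite [X in measurable X](_ : _ = \bigcup_n box ((- n%:R, a), - n%:R) ((n%:R, b), n%:R)).
    by apply: bigcupT_measurable => n; apply: mG; do 2 eexists => //.
  apply/seteqP; split => x /=; last by move=> [n _ [[]]].
  by move=> xab; have [n [? ? ?]] := in_box_seq x; exists n.
have m3 : measurable_fun setT ((fun x => x.2) : T -> R).
  apply: (measurability _ (RGenOpens.measurableE R)).
  move=> _ [_ [a [b ->]] <-]; rewrite setTI.
  rewrite [X in measurable X](_ : _ = \bigcup_n box ((- n%:R, - n%:R), a) ((n%:R, n%:R), b)).
    by apply: bigcupT_measurable => n; apply: mG; do 2 eexists => //.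
  apply/seteqP; split => x /=; last by move=> [n _ [[]]].
  by move=> xab; have [n [? ? ?]] := in_box_seq x; exists n.
have mid : measurable_fun setT ((fun x => ((x.1.1, x.1.2), x.2)) : T -> mR3 R).
  by apply: measurable_fun_pair => //; exact: measurable_fun_pair.
apply/seteqP; split => A.
  move=> mA; have := mid measurableT A mA; rewrite setTI.
  by congr (_ _); apply/seteqP; split => -[[]].
apply: smallest_sub; first exact: sigma_algebra_measurable.
by move=> _ [a _ [b _ <-]]; exact: measurable_box.
Qed.

(** Dynkin's theorem on the pi-system of boxes. Intersecting with the fixed bounded box [B] keeps
    every indicator in L^2, including those of the whole space and of complements. *)
Lemma test_approx_indic n (A : set (mR3 R)) : measurable A ->
  test_approx (\1_(A `&` box ((- n%:R, - n%:R), - n%:R) ((n%:R, n%:R), n%:R)) : R3 R -> R).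
Proof.
set B := box _ _.
have [N BN] : exists N : R, B `<=` cube N by exact: box_sub_cube.
have mB : measurable (B : set (mR3 R)) by exact: measurable_box.
rewrite measurable3_boxes; move: A.
apply: (dynkin_induction measurable3_boxes setI_closed_boxes).
- by rewrite setTI; exact: test_approx_box.
- move=> A GA; have : boxes (A `&` B) by apply: setI_closed_boxes => //; do 2 eexists => //.
  by move=> [a _ [b _ <-]]; exact: test_approx_box.
- move=> S mS aS; have aB : test_approx \1_B by exact: test_approx_box.
  have := test_approxZD (-1) aB aS; congr (test_approx _); apply/funext => x.
  rewrite !indicE !in_setI in_setC; case: (x \in S); case: (x \in B); rewrite /=; ring.
- move=> F mF tF aF.
  (* By disjointness at most one index contributes, so the partial sum is 0 or 1 according to
     whether that index is below [m]. *)
  have sE m x : \sum_(k < m) \1_(F k `&` B) x =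
      if pselect (exists j, (F j `&` B) x) is left e then ((projT1 (cid e) < m)%N)%:R else 0 :> R.
    case: pselect => [e|ne]; last first.
      by rewrite big1// => k _; rewrite indicE memNset// => ?; apply: ne; exists k.
    case: (cid e) => j /= [Fjx Bx].
    under eq_bigr => k _.
      rewrite (_ : \1_(F k `&` B) x = if (k : nat) == j then 1 else 0); last first.
        rewrite indicE; case: eqP => [->|/eqP kj]; first by rewrite mem_set.
        rewrite memNset// => -[Fkx _]; move/trivIsetP : tF => /(_ k j I I kj) /seteqP[+ _].
        by move=> /(_ x); apply.
      over.
    by rewrite -big_mkcond/= (big_ord1_eq _ (fun=> 1)); case: ifP.
  have cE x : \1_(\bigcup_k F k `&` B) x =
      if pselect (exists j, (F j `&` B) x) is left e then 1 else 0 :> R.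
    rewrite indicE; case: pselect => [[j [Fj Bx]]|ne].
      by rewrite mem_set//; split => //; exists j.
    by rewrite memNset// => -[[j _ Fj] Bx]; apply: ne; exists j.
  apply: (@test_approx_cvg _ (fun m x => \sum_(k < m) \1_(F k `&` B) x) _ (\1_B)).
  + elim=> [|m IH].
      by under eq_fun do rewrite big_ord0; exact: test_approx0.
    under eq_fun do rewrite big_ord_recr/= -[X in _ + X]mul1r.
    exact: test_approxZD.
  + apply: measurable_indic; apply: measurableI => //; exact: bigcupT_measurable.
  + exact: L2_indic BN.
  + move=> m x; rewrite sE cE; case: pselect => [e|_]; last by rewrite subrr normr0.
    case: (cid e) => j [_ Bx] /=; rewrite indicE mem_set//.
    by case: (j < m)%N; rewrite ?subrr ?normr0 ?subr0.
  + move=> x; under eq_fun do rewrite sE; rewrite cE.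
    case: pselect => [e|_]; last exact: cvg_cst.
    apply: cvg_near_cst; exists (projT1 (cid e)).+1 => // m /= jm.
    by rewrite jm.
Qed.

Import HBNNSimple.

Lemma test_approx_nnsfun n (h : {nnsfun (mR3 R) >-> R}) :
  test_approx (fun x => h x * \1_(box ((- n%:R, - n%:R), - n%:R) ((n%:R, n%:R), n%:R)) x).
Proof.
set B := box _ _.
under eq_fun do rewrite fimfunE fsbig_finite//= big_distrl/=.
elim: (finmap.enum_fset _) => [|y s IH].
  by under eq_fun do rewrite big_nil; exact: test_approx0.
under eq_fun do rewrite big_cons addrC.
have -> : (fun x => \sum_(j <- s) j * \1_(h @^-1` [set j]) x * \1_B x +
    y * \1_(h @^-1` [set y]) x * \1_B x) =
  (fun x => \sum_(j <- s) j * \1_(h @^-1` [set j]) x * \1_B x +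
    y * \1_(h @^-1` [set y] `&` B) x).
  by apply/funext => x; rewrite -mulrA indicI.
by apply: test_approxZD => //; exact: test_approx_indic.
Qed.

Lemma test_approx_L2_ge0 w : L2 w -> (forall x, 0 <= w x) -> test_approx w.
Proof.
move=> w2 w0.
have mw : measurable_fun setT (fun x : mR3 R => (w x)%:E).
  by apply/measurable_EFinP; exact: L2_measurable.
pose h := nnsfun_approx measurableT mw.
have hcv x : h n x @[n --> \oo] --> w x.
  have := @cvg_nnsfun_approx _ _ _ _ measurableT _ mw (fun x _ => w0 x) x I.
  by move=> /fine_cvgP[_].
have hle n x : 0 <= h n x <= w x.
  rewrite fun_ge0/=; have /cvg_lim <-// := hcv x.
  apply: nondecreasing_cvgn_le; last by apply: cvgP; exact: hcv.
  by move=> m k mk; have /lefP := nd_nnsfun_approx measurableT mw mk; exact.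
pose B n : set (R3 R) := box ((- n%:R, - n%:R), - n%:R) ((n%:R, n%:R), n%:R).
apply: (@test_approx_cvg _ (fun n x => h n x * \1_(B n) x) _ w) => //.
- by move=> n; exact: test_approx_nnsfun.
- exact: L2_measurable.
- move=> n x; rewrite indicE; have /andP[h0 hw] := hle n x.
  by case: (_ \in _); rewrite ?mulr1 ?mulr0 !ger0_norm ?subr_ge0 ?subr0 ?gerBl.
- move=> x; rewrite -[w x]mulr1; apply: cvgM; first exact: hcv.
  have [N hN] := in_box_seq x.
  apply: cvg_near_cst; exists N => // m /= Nm; rewrite indicE mem_set//.
  have Nm' : N%:R <= m%:R :> R by rewrite ler_nat.
  move: hN => [/andP[? ?] /andP[? ?] /andP[? ?]].
  by split; [split|]; rewrite /= in_itv/=; apply/andP; split; lra.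
Qed.

Lemma test_approx_L2 w : L2 w -> test_approx w.
Proof.
move=> w2; have mw := L2_measurable w2.
have -> : w = (fun x => Num.max (w x) 0 + (-1) * Num.max (- w x) 0).
  by apply/funext => x; rewrite /Num.max; case: (ltP (w x) 0) => ?;
    case: (ltP (- w x) 0) => ?; lra.
apply: test_approxZD; apply: test_approx_L2_ge0.
- apply: le_L2 w2 _; first exact: measurable_maxr.
  by move=> x; rewrite /Num.max; case: ltP; rewrite ?normr0.
- by move=> x; rewrite le_max lexx orbT.
- apply: le_L2 w2 _; first by apply: measurable_maxr => //; exact: measurableT_comp.
  by move=> x; rewrite /Num.max; case: ltP; rewrite ?normr0 ?normrN.
- by move=> x; rewrite le_max lexx orbT.
Qed.

(** For [phi] close to [w] in L^2, |w|^2 = |w - phi|^2 + 2 <w, phi> - |phi|^2 is at most e + C. The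
    hypothesis is quadratic in [phi] because AM-GM delivers that form directly, without square roots
    of norms. *)
Lemma test_dual_bound w (C : R) : L2 w ->
  (forall phi, test_function phi ->
    2 * \int[leb3]_x (w x * phi x) <= C + \int[leb3]_x (phi x ^+ 2)) ->
  \int[leb3]_x (w x ^+ 2) <= C.
Proof.
move=> w2 wC; apply/ler_addgt0Pr => e e0.
have [_ /(_ _ e0)[phi tp hp]] := test_approx_L2 w2.
have p2 := test_L2 tp.
have := wC _ tp.
have E : \int[leb3]_x ((w x - phi x) ^+ 2) =
   \int[leb3]_x (w x ^+ 2) - 2 * \int[leb3]_x (w x * phi x) + \int[leb3]_x (phi x ^+ 2).
  rewrite -Rintegral3Z; last exact: L2_mul.
  have i1 := L2_integrable w2; have i2 := integrable3Z 2 (L2_mul w2 p2).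
  have i3 := L2_integrable p2.
  rewrite -Rintegral3B// -Rintegral3D//; last exact: integrable3B.
  by apply: eq_Rintegral => x _; ring.
by rewrite E in hp; lra.
Qed.

End Density2.

(** * Weak derivatives and difference quotients *)

Section WeakDerivatives.
Context {R : realType}.
Implicit Types (f g u phi w : R3 R -> R) (i : 'I_3) (x v : R3 R).

Lemma cube_shift n i (s h : R) x : `|s| <= h ->
  cube n (x + s *: basis3 i) -> cube (n + h) x.
Proof.
rewrite ler_norml => /andP[s1 s2] [[]]/=; rewrite !in_itv/=.
rewrite /GRing.scale/=.
move=> /andP[? ?] /andP[? ?] /andP[? ?].
have P (b : bool) : - h <= s * b%:R <= h.
  by case: b; rewrite ?mulr1 ?mulr0; apply/andP; split; lra.
have /andP[? ?] := P (i == 0%N :> nat); have /andP[? ?] := P (i == 1%N :> nat).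
have /andP[? ?] := P (i == 2%N :> nat).
by split; [split|]; rewrite /= in_itv/=; apply/andP; split; lra.
Qed.

(** Differentiation under the integral sign. For |t| < h the shifted derivatives of [phi] are all
    supported in one cube enlarged by [h], so |u| times a multiple of its indicator dominates them;
    it is integrable as a product of L^2 functions. *)
Lemma is_derive_pairing i u phi (h s : R) : L2 u -> test_function phi ->
  -h < s < h ->
  is_derive s (1 : R) (fun t : R => \int[leb3]_x (u x * phi (x + t *: basis3 i)))
    (\int[leb3]_x (u x * 'D_(basis3 i) phi (x + s *: basis3 i))).
Proof.
move=> u2 tp sh; have tdp := test_derive i tp.
have [n [C [n0 C0 dC]]] := test_le tdp.
pose f (t : R) (x : mR3 R) := u x * phi (x + t *: basis3 i).
pose G (x : mR3 R) : R := `|u x * (C * \1_(cube (n + h)) x)|.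
have fd t x : is_derive t (1 : R) (f ^~ x) (u x * 'D_(basis3 i) phi (x + t *: basis3 i)).
  have h1 := is_derive_line (test_is_derive i (x + t *: basis3 i) tp).
  exact: (@is_deriveZ _ _ _ (fun t : R => phi (x + t *: basis3 i)) (u x) t 1 _ h1).
have d1 t x : partial1of2 f t x = u x * 'D_(basis3 i) phi (x + t *: basis3 i).
  by rewrite partial1of2E; have [] := fd t x.
have intf t : integrable3 (f t) by apply: L2_mul => //; exact: (test_L2 (test_shift _ tp)).
have L2cube : L2 (fun x => C * \1_(cube (n + h)) x).
  by apply: L2Z; apply: (@L2_indic _ _ (n + h)) => //; exact: measurable_cube.
have intG : integrable3 G by apply/integrable3_norm/L2_mul.
have Gub t x : t \in `]-h, h[ -> `|partial1of2 f t x| <= G x.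
  rewrite in_itv/= => /andP[t1 t2].
  rewrite d1 /G !normrM ler_wpM2l// [`|C|]gtr0_norm// [`|\1__ _|]ger0_norm//.
  apply: le_trans (dC _) _; rewrite ler_wpM2l ?(ltW C0)// !indicE ler_nat.
  case: (boolP (_ \in cube n)) => //; rewrite inE => /cube_shift.
  move=> /(_ h) hc; rewrite mem_set//; apply: hc.
  by rewrite ler_norml; apply/andP; split; apply: ltW.
have cv := @cvg_differentiation_under_integral _ _ _ leb3 f setT measurableT s (-h) h
  ltac:(by rewrite /= in_itv) (fun t _ => intf t)
  (fun t x _ _ => @ex_derive _ _ _ _ _ _ _ (fd t x)) G (fun=> normr_ge0 _) intG
  (fun t x It _ => Gub t x It).
have E : \int[leb3]_x (u x * 'D_(basis3 i) phi (x + s *: basis3 i)) =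
   \int[leb3]_y partial1of2 f s y by apply: eq_Rintegral => x _; rewrite d1.
rewrite E; split.
- by apply/cvg_ex; eexists; under eq_fun do rewrite [_ *: 1]mulr1; exact: cv.
- rewrite /derive; under eq_fun do rewrite [_ *: 1]mulr1.
  exact: cvg_lim cv.
Qed.

Lemma L2_AMGM (c : R) f g : L2 f -> L2 g ->
  2 * c * \int[leb3]_x (f x * g x) <=
  c ^+ 2 * \int[leb3]_x (f x ^+ 2) + \int[leb3]_x (g x ^+ 2).
Proof.
move=> f2 g2; have i1 := L2_integrable f2; have i2 := L2_integrable g2.
have i3 := L2_mul f2 g2.
rewrite -!Rintegral3Z// -Rintegral3D//; last exact: integrable3Z.
apply: le_Rintegral3; first exact: integrable3Z.
  by apply: integrable3D => //; exact: integrable3Z.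
by move=> x; have := sqr_ge0 (c * f x - g x); nra.
Qed.

(* By duality with test functions: [t |-> \int u phi(x + t e_i)] is differentiable
   with derivative [- \int g phi(x + t e_i)], so the mean value theorem applies. *)
Lemma shift_diff_bound i u g (h : R) : L2 u -> L2 g -> weak_partial i u g -> 0 < h ->
  \int[leb3]_x ((u (x + h *: basis3 i) - u x) ^+ 2) <=
  h ^+ 2 * \int[leb3]_x (g x ^+ 2).
Proof.
move=> u2 g2 wg h0.
have us2 : L2 (fun x => u (x + h *: basis3 i)) by exact: L2_shift.
apply: test_dual_bound; first exact: L2B.
move=> phi tp; have p2 := test_L2 tp.
pose K (t : R) := \int[leb3]_x (u x * phi (x + t *: basis3 i)).
(* Shifting [u] by [h] amounts to shifting [phi] by [-h], hence the interval [-h, 0]. *)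
have Kd (t : R) : -h <= t <= 0 -> is_derive t (1 : R) K
    (- \int[leb3]_x (g x * phi (x + t *: basis3 i))).
  move=> /andP[t1 t2].
  rewrite -wg; last exact: test_shift.
  under [X in is_derive _ _ _ X]eq_Rintegral do rewrite derive_shift3//.
  by apply: (@is_derive_pairing _ _ _ (h + 1)) => //; apply/andP; split; lra.
have hn : - h < 0 by rewrite oppr_lt0.
have [c cI Kc] := @MVT _ K _ (-h) 0 hn
  (fun t It => Kd t (subset_itv_oo_cc It))
  ltac:(apply: derivable_within_continuous => t It; have [] := Kd t It; exact).
have cI' : -h <= c <= 0 by have := subset_itv_oo_cc cI; rewrite in_itv.
have E : \int[leb3]_x ((u (x + h *: basis3 i) - u x) * phi x) =
    h * \int[leb3]_x (g x * phi (x + c *: basis3 i)).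
  transitivity (K (-h) - K 0).
    rewrite /K; under eq_Rintegral do rewrite mulrBl.
    rewrite Rintegral3B; [|exact: L2_mul..]; congr (_ - _).
      rewrite -[RHS](Rintegral_shift3 (h *: basis3 i)).
        by apply: eq_Rintegral => x _; rewrite scaleNr addrK.
      apply: measurable3M; first exact: L2_measurable.
      by apply: measurable3_shift; exact: test_measurable.
    by apply: eq_Rintegral => x _; rewrite scale0r addr0.
  by move: Kc; rewrite sub0r opprK mulNr => Kc; rewrite -opprB Kc opprK mulrC.
(* The mean value point [c] depends on [phi], but translating [phi] preserves its L^2 norm, so the
   bound does not see [c]. *)
rewrite E mulrA; apply: le_trans (L2_AMGM h g2 (test_L2 (test_shift _ tp))) _.
rewrite lerD2l (Rintegral_shift3 _ (f := fun x => phi x ^+ 2))//.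
by apply: measurable3X; exact: test_measurable.
Qed.

Lemma L2_eq0 w : L2 w -> \int[leb3]_x (w x ^+ 2) <= 0 ->
  {ae leb3, forall x, w x = 0}.
Proof.
move=> w2 w0.
have : (\int[leb3]_x `|(w x ^+ 2)%:E| = 0)%E.
  have := integral_sq_ge0 w; rewrite le_eqVlt ltNge w0 orbF => /eqP e0.
  under eq_integral do rewrite gee0_abs ?lee_fin ?sqr_ge0//.
  rewrite -[LHS]fineK; first by rewrite -[fine _]/(Rintegral _ _ _) -e0.
  by apply: integrable_fin_num => //; exact: L2_integrable.
have mw : measurable_fun setT (fun x : mR3 R => (w x ^+ 2)%:E).
  by apply/measurable_EFinP; apply: (measurable3X 2); exact: L2_measurable.
move=> /(ae_eq_integral_abs leb3 measurableT mw).1.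
by apply: filterS => x /(_ I) [] /eqP; rewrite sqrf_eq0 => /eqP.
Qed.

(** The difference g1 - g2 is orthogonal to every test function, so the duality bound applies with
    constant 0. *)
Lemma weak_partial_unique i u g1 g2 : L2 g1 -> L2 g2 ->
  weak_partial i u g1 -> weak_partial i u g2 -> {ae leb3, forall x, g1 x = g2 x}.
Proof.
move=> h1 h2 w1 w2.
have : {ae leb3, forall x, g1 x - g2 x = 0}.
  apply: L2_eq0; first exact: L2B.
  apply: test_dual_bound; first exact: L2B.
  move=> phi tp; under eq_Rintegral do rewrite mulrBl.
  rewrite Rintegral3B; [|by apply: L2_mul => //; exact: test_L2..].
  have := w1 _ tp; rewrite w2// => /oppr_inj ->.
  by rewrite subrr mulr0 add0r integral_sq_ge0.
move=> [N [mN N0 sN]]; exists N; split => // x /= nx.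
by apply: sN => /= /eqP; rewrite subr_eq0 => /eqP.
Qed.

End WeakDerivatives.

(** * Lower bound *)

Section Virial.
Context {R : realType}.
Implicit Types (f g u phi w F : R3 R -> R) (i : 'I_3) (x v : R3 R).

Lemma diff_quotient_cvg (V : normedModType R) (F : V -> R) (x v : V) (d : R) (t_ : nat -> R) : is_derive x v F d ->
  (forall n, t_ n != 0) -> t_ n @[n --> \oo] --> (0 : R) ->
  (t_ n)^-1 * (F (x + t_ n *: v) - F x) @[n --> \oo] --> d.
Proof.
move=> [/cvg_ex[/= l Fl] <-] tn0 t0.
have -> : 'D_v F x = l by exact: cvg_lim Fl.
move/cvgr_dnbhsP : Fl => /(_ t_ (conj tn0 t0)).
by under eq_fun do rewrite [_ + x]addrC.
Qed.

Lemma line_lipschitz F dF v (L : R) : (forall x, is_derive x v F (dF x)) ->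
  (forall x, `|dF x| <= L) -> forall x (t : R), `|F (x + t *: v) - F x| <= L * `|t|.
Proof.
move=> Fd dL.
have pos x (t : R) : 0 < t -> `|F (x + t *: v) - F x| <= L * t.
  move=> t0; pose f (s : R) := F (x + s *: v).
  have fd (s : R) : is_derive s (1 : R) f (dF (x + s *: v)) by exact: is_derive_line.
  have [c _ fc] := @MVT _ f _ 0 t t0 (fun s _ => fd s)
    ltac:(by apply: derivable_within_continuous => s _; have [] := fd s).
  have -> : F x = f 0 by rewrite /f scale0r addr0.
  by rewrite fc subr0 normrM [`|t|]gtr0_norm// ler_wpM2r// ltW.
move=> x t; have [t0|t0|->] := ltgtP t 0.
- have := pos (x + t *: v) (- t); rewrite oppr_gt0 => /(_ t0).
  by rewrite scaleNr addrK distrC [`|t|]ltr0_norm.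
- by rewrite [`|t|]gtr0_norm//; exact: pos.
- by rewrite scale0r addr0 subrr !normr0 mulr0.
Qed.

(* With [a = u x] and [b = u (x + h e_i)], expand
   [0 <= (e (b - a) / h + F x (b + a) / 2)^2], integrate, and shift variables so
   that the difference quotient falls on [F]; then let [h] tend to 0. This avoids
   a product rule for weak derivatives. *)
Lemma virial_bound i u g F dF (e C L : R) : 0 < e -> L2 u -> L2 g ->
  weak_partial i u g -> measurable3 F -> measurable3 dF ->
  (forall x, `|F x| <= C) -> (forall x, `|dF x| <= L) ->
  (forall x, is_derive x (basis3 i) F (dF x)) ->
  \int[leb3]_x (u x ^+ 2 * (e * dF x - F x ^+ 2)) <=
    e ^+ 2 * \int[leb3]_x (g x ^+ 2).
Proof.
move=> e0 u2 g2 wg mF mdF FC dL Fd.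
have mu := L2_measurable u2; have iu2 := L2_integrable u2.
have C0 : 0 <= C by apply: le_trans (FC 0).
have L0 : 0 <= L by apply: le_trans (dL 0).
have FF x : F x ^+ 2 <= C ^+ 2 by have := FC x; rewrite ler_norml => /andP[? ?]; nra.
pose h (n : nat) : R := n.+1%:R^-1.
have h0 n : 0 < h n by rewrite invr_gt0.
have hh : h n @[n --> \oo] --> (0 : R) by exact: cvg_harmonic.
(* A discrete form of e dF - F^2. The differences are backward because moving [u (x + h e_i)] back
   to [x] evaluates [F] at x - h e_i. *)
pose Q n x := e * ((h n)^-1 * (F x - F (x - h n *: basis3 i)))
    - 2^-1 * (F (x - h n *: basis3 i) ^+ 2 + F x ^+ 2).
have mFs n : measurable3 (fun x => F (x - h n *: basis3 i)) by exact: measurable3_shift.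
have mQ n : measurable3 (Q n).
  apply: measurable3B; apply: (measurable3M (measurable3_cst _)).
    by apply: (measurable3M (measurable3_cst _)); exact: measurable3B.
  by apply: measurable3D; exact: (measurable3X 2).
have lipF x n : `|F x - F (x - h n *: basis3 i)| <= L * h n.
  have := line_lipschitz Fd dL x (- h n).
  by rewrite scaleNr distrC [`|- h n|]normrN [`|h n|]gtr0_norm.
have Qb n x : `|Q n x| <= e * L + C ^+ 2.
  apply: le_trans (ler_normB _ _) _; apply: lerD.
    rewrite normrM gtr0_norm// ler_wpM2l ?(ltW e0)// normrM [`|_^-1|]gtr0_norm ?invr_gt0//.
    by rewrite mulrC ler_pdivrMr//.
  rewrite ger0_norm ?mulr_ge0 ?addr_ge0 ?sqr_ge0//.
  have := FF x; have := FF (x - h n *: basis3 i); lra.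
have cv : \int[leb3]_x (u x ^+ 2 * Q n x) @[n --> \oo] -->
    \int[leb3]_x (u x ^+ 2 * (e * dF x - F x ^+ 2)).
  apply: (@dominated_Rintegral3 _ _ _ (fun x => (e * L + C ^+ 2) * u x ^+ 2)).
  - by move=> n; apply: measurable3M => //; exact: (measurable3X 2).
  - apply: measurable3M; first exact: (measurable3X 2).
    apply: measurable3B; first exact: (measurable3M (measurable3_cst _)).
    exact: (measurable3X 2).
  - move=> x; apply: cvgM; first exact: cvg_cst.
    have dq := diff_quotient_cvg (Fd x) (t_ := fun n => - h n).
    have {}dq : (h n)^-1 * (F x - F (x - h n *: basis3 i)) @[n --> \oo] --> dF x.
      under eq_fun => n do rewrite -mulrNN -invrN opprB -scaleNr.
      by apply: dq; [move=> n; rewrite oppr_eq0 gt_eqF|rewrite -oppr0; exact: cvgN].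
    apply: cvgB; first by apply: cvgM => //; exact: cvg_cst.
    have Fc : F (x - h n *: basis3 i) @[n --> \oo] --> F x.
      have : h n * ((h n)^-1 * (F x - F (x - h n *: basis3 i))) @[n --> \oo] --> 0 * dF x by exact: cvgM.
      rewrite mul0r; under eq_fun => n do rewrite mulrA divff ?gt_eqF// mul1r.
      move=> /(cvgB (cvg_cst (F x))); rewrite subr0.
      apply: cvg_trans; apply: near_eq_cvg; apply: nearW => n.
      by rewrite [LHS]subKr.
    rewrite [X in _ --> X](_ : _ = 2^-1 * (F x ^+ 2 + F x ^+ 2)); last by field.
    apply: cvgM; first exact: cvg_cst.
    apply: cvgD; last exact: cvg_cst.
    under eq_fun do rewrite expr2; rewrite expr2; exact: cvgM.
  - exact: integrable3Z.
  - move=> n x; rewrite normrM mulrC [`|_ ^+ 2|]ger0_norm ?sqr_ge0//.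
    by rewrite ler_wpM2r// sqr_ge0.
have bd n : \int[leb3]_x (u x ^+ 2 * Q n x) <= e ^+ 2 * \int[leb3]_x (g x ^+ 2).
  have us2 : L2 (fun x => u (x + h n *: basis3 i)) by exact: L2_shift.
  pose D x := u (x + h n *: basis3 i) - u x.
  have D2 : L2 D by exact: L2B.
  apply: (@le_trans _ _ (e ^+ 2 * ((h n) ^- 2 * \int[leb3]_x (D x ^+ 2)))); last first.
    rewrite ler_wpM2l ?sqr_ge0// mulrC ler_pdivrMr ?exprn_gt0// mulrC.
    exact: shift_diff_bound.
  pose A x := F x * (e * (h n)^-1) * u x ^+ 2 - 2^-1 * F x ^+ 2 * u x ^+ 2.
  pose B x := F x * (e * (h n)^-1) * u (x + h n *: basis3 i) ^+ 2 + 2^-1 * F x ^+ 2 * u (x + h n *: basis3 i) ^+ 2.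
  have bint w : L2 w -> integrable3 (fun x => F x * (e * (h n)^-1) * w x ^+ 2) /\ integrable3 (fun x => 2^-1 * F x ^+ 2 * w x ^+ 2).
    move=> w2; split.
      apply: (@integrable3_bounded _ (fun x => F x * (e * (h n)^-1)) (fun x => w x ^+ 2) (C * (e * (h n)^-1))).
      - exact: (measurable3M mF (measurable3_cst _)).
      - exact: L2_integrable.
      - have eh : 0 <= e / h n by rewrite divr_ge0// ltW.
        by move=> x; rewrite normrM [`|e / h n|]ger0_norm// ler_wpM2r.
    apply: (@integrable3_bounded _ (fun x => 2^-1 * F x ^+ 2) (fun x => w x ^+ 2) (C ^+ 2)).
    - by apply: (measurable3M (measurable3_cst _)); exact: (measurable3X 2).
    - exact: L2_integrable.
    - move=> x; have := FF x; have F0 := sqr_ge0 (F x) => ?.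
      by rewrite ger0_norm; lra.
  have [iA1 iA2] := bint _ u2; have [iB1 iB2] := bint _ us2.
  have iA : integrable3 A by exact: integrable3B.
  have iB : integrable3 B by exact: integrable3D.
  have iBs : integrable3 (fun x => B (x - h n *: basis3 i)) by exact: integrable3_shift.
  have -> : \int[leb3]_x (u x ^+ 2 * Q n x) = \int[leb3]_x (A x - B x).
    rewrite Rintegral3B// -[X in _ - X](Rintegral_shift3 (- (h n *: basis3 i))); last exact: integrable3_measurable.
    rewrite -Rintegral3B//; apply: eq_Rintegral => x _.
    by rewrite /A /B /Q subrK; ring.
  have iD := L2_integrable D2.
  rewrite -(Rintegral3Z _ iD) -(Rintegral3Z _ (integrable3Z _ iD)).
  apply: le_Rintegral3.
  - exact: integrable3B.
  - by do 2 apply: integrable3Z; exact: L2_integrable.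
  - move=> x; rewrite /A /B /D; set a := u x; set b := u (x + _).
    (* The second square turns F^2 (b + a)^2 / 4 into F^2 (a^2 + b^2) / 2, where [a] and [b] are
       separated; only then can the terms in [b] be shifted on their own. *)
    rewrite -subr_ge0 [leRHS](_ : _ = (e / h n * (b - a) + F x * (b + a) / 2) ^+ 2 + (F x * (b - a) / 2) ^+ 2).
      by rewrite addr_ge0// sqr_ge0.
    by field; rewrite gt_eqF.
have /cvg_lim <- // := cv.
by apply: limr_le; [apply: cvgP; exact: cv|apply: nearW].
Qed.

End Virial.

(** * The regularized radial field and its divergence *)

Section Field.
Context {R : realType}.
Implicit Types (x y v X : R3 R) (i j : 'I_3).

Definition co i x : R := if i == 0%N :> nat then x.1.1 else
  if i == 1%N :> nat then x.1.2 else x.2.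

Definition sq3 x : R := \sum_(i < 3) co i x ^+ 2.

Lemma sq3E x : sq3 x = x.1.1 ^+ 2 + x.1.2 ^+ 2 + x.2 ^+ 2.
Proof. by rewrite /sq3 !big_ord_recr big_ord0 /= add0r. Qed.

Lemma enormE x : enorm x = Num.sqrt (sq3 x).
Proof. by rewrite sq3E. Qed.

Lemma sq3_ge0 x : 0 <= sq3 x.
Proof. by apply: sumr_ge0 => i _; exact: sqr_ge0. Qed.

Lemma co_sq_le i x : co i x ^+ 2 <= sq3 x.
Proof. by rewrite /sq3 (bigD1 i)//= lerDl sumr_ge0// => j _; exact: sqr_ge0. Qed.

Lemma co_line i j x (t : R) : co i (x + t *: basis3 j) = co i x + t * (i == j)%:R.
Proof.
rewrite /co; case: i j => [[|[|[|//]]] ?] [[|[|[|//]]] ?] /=;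
  by rewrite /GRing.scale/= ?mulr0 ?mulr1.
Qed.

Lemma coZ i (a : R) x : co i (a *: x) = a * co i x.
Proof. by rewrite /co; case: ifP => // _; case: ifP. Qed.

Lemma sq3Z (a : R) x : sq3 (a *: x) = a ^+ 2 * sq3 x.
Proof. by rewrite /sq3 mulr_sumr; apply: eq_bigr => i _; rewrite coZ exprMn. Qed.

Lemma continuous_co i : continuous (co i).
Proof.
rewrite /co; case: i => [[|[|[|//]]] ?] /=.
- exact: continuous_x1.
- exact: continuous_x2.
- exact: continuous_x3.
Qed.

Lemma continuous_sq3 : continuous sq3.
Proof.
have csq (f : R3 R -> R) : continuous f -> continuous (fun x => f x ^+ 2).
  by move=> cf x; under eq_fun do rewrite expr2; apply: cvgM; exact: cf.
rewrite (_ : sq3 = fun x => x.1.1 ^+ 2 + x.1.2 ^+ 2 + x.2 ^+ 2); last first.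
  by apply/funext => x; rewrite sq3E.
move=> x; apply: cvgD; first apply: cvgD.
- exact/csq/continuous_x1.
- exact/csq/continuous_x2.
- exact/csq/continuous_x3.
Qed.

Lemma measurable_co i : measurable3 (co i).
Proof. by apply: continuous_measurable3; exact: continuous_co. Qed.

Lemma measurable_sq3 : measurable3 sq3.
Proof. by apply: continuous_measurable3; exact: continuous_sq3. Qed.

(** A smooth substitute for the Euclidean norm: bounded below by [d] and decreasing to |x| as [d]
    decreases to 0. *)
Definition soft (d : R) x : R := Num.sqrt (d ^+ 2 + sq3 x).

Section Soft.
Variable d : R.
Hypothesis d0 : 0 < d.

Lemma soft_arg_gt0 x : 0 < d ^+ 2 + sq3 x.
Proof. by rewrite ltr_wpDr ?sq3_ge0// exprn_gt0. Qed.

Lemma soft_gt0 x : 0 < soft d x.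
Proof. by rewrite sqrtr_gt0 soft_arg_gt0. Qed.

Lemma soft_sq x : soft d x ^+ 2 = d ^+ 2 + sq3 x.
Proof. by rewrite sqr_sqrtr// ltW// soft_arg_gt0. Qed.

Lemma soft_ge x : d <= soft d x.
Proof.
by rewrite -(ler_sqr (x := d)) ?nnegrE ?(ltW d0) ?(ltW (soft_gt0 x))// soft_sq lerDl sq3_ge0.
Qed.

Lemma continuous_soft : continuous (soft d).
Proof.
move=> x; apply: (@continuous_comp _ _ _ (fun y => d ^+ 2 + sq3 y) Num.sqrt).
  by apply: cvgD; [exact: cvg_cst|exact: continuous_sq3].
exact: sqrt_continuous.
Qed.

Lemma is_derive_soft i x : is_derive x (basis3 i) (soft d) (co i x / soft d x).
Proof.
apply: line_is_derive.
(* Only the [i]-th coordinate moves along the line, so the argument of the root is a quadratic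
   polynomial in [t]. *)
pose q (t : R) := d ^+ 2 + sq3 x - co i x ^+ 2 + (co i x + t) ^+ 2.
have qE (t : R) : d ^+ 2 + sq3 (x + t *: basis3 i) = q t.
  rewrite /q /sq3 [in LHS](bigD1 i)//= [in RHS](bigD1 i)//= co_line eqxx mulr1.
  under eq_bigr => j ji do rewrite co_line (negbTE ji) mulr0 addr0.
  by ring.
have -> : (fun s : R => soft d (x + s *: basis3 i)) = Num.sqrt \o q.
  by apply/funext => t; rewrite /soft qE.
have q0 : q 0 = d ^+ 2 + sq3 x by rewrite /q addr0; ring.
have qd : is_derive (0 : R) (1 : R) q (2 * co i x).
  have h1 : is_derive (0 : R) (1 : R) (fun t : R => co i x + t) 1.
    have := is_derive_affine (co i x) 1 0; congr (is_derive _ _ _ _).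
    by apply/funext => t; rewrite mulr1.
  have h2 := @is_deriveX _ _ (fun t : R => co i x + t) 2 0 1 1 h1.
  have h3 := @is_deriveD R R R (cst (d ^+ 2 + sq3 x - co i x ^+ 2)) _ 0 1 0 _ (is_derive_cst _ _ _) h2.
  move/is_derive_eq: h3; apply.
  by rewrite /= add0r addr0 expr1 [_ *: _]mulr1 mulr_natl.
have sd := @is_derive1_sqrt R (q 0) ltac:(rewrite q0; exact: soft_arg_gt0).
have := @is_derive1_comp _ Num.sqrt q 0 _ _ sd qd.
move/is_derive_eq; apply; rewrite q0 -/(soft d x); field.
by rewrite gt_eqF// soft_gt0.
Qed.

End Soft.

Lemma is_derive_inv3 (f : R3 R -> R) x v (df : R) : f x != 0 ->
  is_derive x v f df -> is_derive x v (fun y => (f y)^-1) (- (f x) ^- 2 * df).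
Proof.
move=> f0 [fd fE]; split; first exact: derivableV.
by rewrite deriveV// fE.
Qed.

Lemma is_derive_mul3 (f g : R3 R -> R) x v (df dg : R) :
  is_derive x v f df -> is_derive x v g dg ->
  is_derive x v (fun y => f y * g y) (f x * dg + g x * df).
Proof. by move=> h1 h2; exact: (@is_deriveM _ _ f g x v df dg h1 h2). Qed.

Lemma is_derive_add3 (f g : R3 R -> R) x v (df dg : R) :
  is_derive x v f df -> is_derive x v g dg ->
  is_derive x v (fun y => f y + g y) (df + dg).
Proof. by move=> h1 h2; exact: (@is_deriveD _ _ _ f g x v df dg h1 h2). Qed.

Lemma is_derive_cst3 (c : R) x v : is_derive x v (fun _ : R3 R => c) (0 : R).
Proof. exact: is_derive_cst. Qed.

Lemma is_derive_scale3 (c : R) (f : R3 R -> R) x v (df : R) :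
  is_derive x v f df -> is_derive x v (fun y => c * f y) (c * df).
Proof.
move=> h; have := is_derive_mul3 (is_derive_cst3 c x v) h.
by move/is_derive_eq; apply; rewrite mulr0 addr0.
Qed.

Lemma is_derive_co i x : is_derive x (basis3 i) (co i) (1 : R).
Proof.
apply: line_is_derive; have := is_derive_affine (co i x) 1 0.
by congr (is_derive _ _ _ _); apply/funext => s; rewrite co_line eqxx.
Qed.

(* A regularization of [(x - X) / |x - X|], cut off at distance [eta]; [d] smooths
   the singularity and tends to 0 first. *)
Definition fld (d eta : R) X i x : R :=
  co i (x - X) * (eta ^+ 2 * (soft d (x - X) * (eta ^+ 2 + soft d (x - X) ^+ 2))^-1).

(** The derivative of the [i]-th component in direction [i], factored so that [i] enters only
    through the square of a coordinate; summing over [i] then expresses the divergence by [soft]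
    alone. *)
Definition dfld (d eta : R) X i x : R :=
  eta ^+ 2 * (soft d (x - X) * (eta ^+ 2 + soft d (x - X) ^+ 2))^-1 *
  (1 - co i (x - X) ^+ 2 * ((soft d (x - X)) ^- 2 + 2 / (eta ^+ 2 + soft d (x - X) ^+ 2))).

Section Fld.
Variables (d eta : R).
Hypothesis d0 : 0 < d.
Hypothesis eta0 : 0 < eta.

Lemma is_derive_fld X i x : is_derive x (basis3 i) (fld d eta X i) (dfld d eta X i x).
Proof.
apply: (@is_derive_shift3 _ (fun y => co i y * (eta ^+ 2 * (soft d y * (eta ^+ 2 + soft d y ^+ 2))^-1))).
set y := x + - X; rewrite /dfld -/y.
have s0 := soft_gt0 d0 y.
have e0 : 0 < eta ^+ 2 + soft d y ^+ 2 by rewrite addr_gt0// exprn_gt0.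
have hs := is_derive_soft d0 i y.
have hs2 := is_derive_mul3 hs hs.
have h1 := is_derive_add3 (is_derive_cst3 (eta ^+ 2) y (basis3 i)) hs2.
have h2 := is_derive_mul3 hs h1.
have ne : soft d y * (eta ^+ 2 + soft d y * soft d y) != 0.
  by rewrite gt_eqF// mulr_gt0// -expr2.
have h3 := is_derive_inv3 ne h2.
have h4 := is_derive_mul3 (is_derive_co i y) (is_derive_scale3 (eta ^+ 2) h3).
move/is_derive_eq: h4; apply.
rewrite -!expr2; field.
by rewrite ?gt_eqF.
Qed.

Lemma fld_factor_bounds X x :
  0 <= eta ^+ 2 * (soft d (x - X) * (eta ^+ 2 + soft d (x - X) ^+ 2))^-1
    <= (soft d (x - X))^-1.
Proof.
set r := soft d (x - X); have r0 : 0 < r by exact: soft_gt0.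
have e0 : 0 < eta ^+ 2 by rewrite exprn_gt0.
have er : 0 < eta ^+ 2 + r ^+ 2 by rewrite addr_gt0// exprn_gt0.
apply/andP; split; first by rewrite mulr_ge0 ?ltW// invr_gt0 mulr_gt0.
rewrite ler_pdivrMr ?mulr_gt0// mulrA mulVf ?gt_eqF// mul1r lerDl.
exact: sqr_ge0.
Qed.

Lemma fld_bounded X i x : `|fld d eta X i x| <= 1.
Proof.
rewrite /fld normrM; set r := soft d (x - X).
have r0 : 0 < r by exact: soft_gt0.
have /andP[g0 g1] := fld_factor_bounds X x; rewrite -/r in g0 g1.
rewrite (ger0_norm g0); apply: (@le_trans _ _ (r * r^-1)); last by rewrite divff ?gt_eqF.
apply: ler_pM => //; rewrite -(ger0_norm (ltW r0)) -ler_sqr ?nnegrE// !real_normK ?num_real//.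
rewrite soft_sq//; apply: le_trans (co_sq_le _ _) _.
by rewrite lerDr sqr_ge0.
Qed.

(** The bound blows up as [d] tends to 0, which is harmless: [virial_bound] asks for some bound on
    the derivative, and its conclusion does not contain it. *)
Lemma dfld_bounded X i x : `|dfld d eta X i x| <= 2 / d.
Proof.
rewrite /dfld normrM; set r := soft d (x - X); set c := co i (x - X).
have r0 : 0 < r by exact: soft_gt0.
have dr : d <= r by exact: soft_ge.
have /andP[g0 g1] := fld_factor_bounds X x; rewrite -/r in g0 g1.
rewrite (ger0_norm g0) mulrC; apply: ler_pM => //; last first.
  by apply: le_trans g1 _; rewrite lef_pV2.
have e0 : 0 < eta ^+ 2 by rewrite exprn_gt0.
have r20 : 0 < r ^+ 2 by rewrite exprn_gt0.
have er : 0 < eta ^+ 2 + r ^+ 2 by rewrite addr_gt0// exprn_gt0.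
have cr : c ^+ 2 <= r ^+ 2.
  rewrite soft_sq//; apply: le_trans (co_sq_le _ _) _.
  by rewrite lerDr sqr_ge0.
have t1 : 0 <= c ^+ 2 * r ^- 2 <= 1.
  apply/andP; split; first by rewrite mulr_ge0 ?sqr_ge0// invr_ge0 ltW.
  by rewrite ler_pdivrMr// mul1r.
have t2 : 0 <= c ^+ 2 * (2 / (eta ^+ 2 + r ^+ 2)) <= 2.
  apply/andP; split; first by rewrite mulr_ge0 ?sqr_ge0// divr_ge0// ltW.
  by rewrite mulrCA -[leRHS]mulr1 ler_wpM2l// ler_pdivrMr// mul1r; lra.
rewrite mulrDr ler_norml; move: t1 t2 => /andP[? ?] /andP[? ?].
by apply/andP; split; lra.
Qed.

(** With r = soft, the divergence is a multiple of 3 - (r^2 - d^2)(1/r^2 + 2/(eta^2 + r^2)).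
    Dropping the nonnegative terms in d^2 leaves 2 eta^4 / (r (eta^2 + r^2)^2), and its comparison
    with 2/r - 2/eta is a polynomial inequality settled by a sum of squares. *)
Lemma sum_dfld_ge X x :
  2 * ((soft d (x - X))^-1 - eta^-1) <= \sum_(i < 3) dfld d eta X i x.
Proof.
rewrite /dfld; set r := soft d (x - X).
have r0 : 0 < r by exact: soft_gt0.
have er : 0 < eta ^+ 2 + r ^+ 2 by rewrite addr_gt0// exprn_gt0.
rewrite -mulr_sumr sumrB -mulr_suml -/(sq3 (x - X)).
rewrite big_const_ord iter_addr addr0.
have -> : sq3 (x - X) = r ^+ 2 - d ^+ 2 by rewrite soft_sq// addrAC subrr add0r.
have G0 : 0 <= eta ^+ 2 / (r * (eta ^+ 2 + r ^+ 2)).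
  by rewrite divr_ge0 ?sqr_ge0 ?mulr_ge0 ?ltW.
have K0 : 0 <= d ^+ 2 * (r ^- 2 + 2 / (eta ^+ 2 + r ^+ 2)).
  by rewrite mulr_ge0 ?sqr_ge0// addr_ge0 ?invr_ge0 ?sqr_ge0// divr_ge0 ?ltW.
apply: (@le_trans _ _ (eta ^+ 2 / (r * (eta ^+ 2 + r ^+ 2)) * (2 * eta ^+ 2 / (eta ^+ 2 + r ^+ 2)))); last first.
  rewrite ler_wpM2l// -subr_ge0; move: K0; congr (_ <= _); field.
  by rewrite ?gt_eqF.
rewrite -subr_ge0 [leRHS](_ : _ = 2 * (eta ^+ 5 - (eta - r) * (eta ^+ 2 + r ^+ 2) ^+ 2) / (r * eta * (eta ^+ 2 + r ^+ 2) ^+ 2)); last first.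
  by field; rewrite ?gt_eqF.
rewrite divr_ge0 ?mulr_ge0 ?sqr_ge0 ?(ltW r0) ?(ltW eta0) ?(ltW er)//.
rewrite [leRHS](_ : _ = r * ((eta ^+ 2 - eta * r) ^+ 2 + r ^+ 2 * ((eta - r / 2) ^+ 2 + 3 / 4 * r ^+ 2))); last by field.
by rewrite mulr_ge0 ?(ltW r0)// addr_ge0 ?sqr_ge0// mulr_ge0 ?sqr_ge0// addr_ge0 ?sqr_ge0// mulr_ge0 ?sqr_ge0.
Qed.

(** Since |x - X| <= soft, the singular factor cancels. The bound is free of [d], so [d] can tend to
    0 while [eta] stays fixed. *)
Lemma sum_fld_sq_le X x :
  \sum_(i < 3) fld d eta X i x ^+ 2 <= (eta ^+ 2 / (eta ^+ 2 + sq3 (x - X))) ^+ 2.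
Proof.
rewrite /fld; set r := soft d (x - X).
have r0 : 0 < r by exact: soft_gt0.
have er : 0 < eta ^+ 2 + r ^+ 2 by rewrite addr_gt0// exprn_gt0.
under eq_bigr do rewrite exprMn.
rewrite -mulr_suml -/(sq3 (x - X)).
have sr : sq3 (x - X) <= r ^+ 2 by rewrite soft_sq// lerDr sqr_ge0.
apply: (@le_trans _ _ ((eta ^+ 2 / (eta ^+ 2 + r ^+ 2)) ^+ 2)).
  rewrite [leRHS](_ : _ = r ^+ 2 * (eta ^+ 2 / (r * (eta ^+ 2 + r ^+ 2))) ^+ 2); last first.
    by field; rewrite ?gt_eqF.
  by rewrite ler_wpM2r// sqr_ge0.
have es : 0 < eta ^+ 2 + sq3 (x - X) by rewrite ltr_wpDr ?sq3_ge0// exprn_gt0.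
rewrite lerXn2r ?nnegrE ?divr_ge0 ?sqr_ge0 ?(ltW er) ?(ltW es)//.
by rewrite ler_pM2l ?exprn_gt0// lef_pV2// lerD2l.
Qed.

Lemma continuous_fld_factor X :
  continuous (fun x => eta ^+ 2 * (soft d (x - X) * (eta ^+ 2 + soft d (x - X) ^+ 2))^-1).
Proof.
have cs := @continuous_shift3 R _ (- X) (@continuous_soft d).
move=> x; have r0 := soft_gt0 d0 (x - X).
have er : 0 < eta ^+ 2 + soft d (x - X) ^+ 2 by rewrite addr_gt0// exprn_gt0.
apply: cvgM; first exact: cvg_cst.
apply: cvgV; first by rewrite mulf_neq0// gt_eqF.
apply: cvgM; first exact: cs.
apply: cvgD; first exact: cvg_cst.
by under eq_fun do rewrite expr2; rewrite expr2; apply: cvgM; exact: cs.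
Qed.

Lemma measurable_fld X i : measurable3 (fld d eta X i).
Proof.
apply: measurable3M; first by apply: measurable3_shift; exact: measurable_co.
by apply: continuous_measurable3; exact: continuous_fld_factor.
Qed.

Lemma measurable_dfld X i : measurable3 (dfld d eta X i).
Proof.
have cs := @continuous_shift3 R _ (- X) (@continuous_soft d).
apply: measurable3M.
  by apply: continuous_measurable3; exact: continuous_fld_factor.
apply: measurable3B; first exact: measurable3_cst.
apply: measurable3M.
  apply: (measurable3X 2); apply: measurable3_shift; exact: measurable_co.
have cs2 : continuous (fun x => soft d (x - X) ^+ 2).
  by move=> x; under eq_fun do rewrite expr2; apply: cvgM; exact: cs.
apply: continuous_measurable3 => x; have r0 := soft_gt0 d0 (x - X).
have er : 0 < eta ^+ 2 + soft d (x - X) ^+ 2 by rewrite addr_gt0// exprn_gt0.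
apply: cvgD.
  by apply: cvgV; [rewrite expf_neq0// gt_eqF|exact: cs2].
apply: cvgM; first exact: cvg_cst.
apply: cvgV; first by rewrite gt_eqF.
by apply: cvgD; [exact: cvg_cst|exact: cs2].
Qed.

End Fld.
End Field.

(** * A probability measure and the square root of its density *)

Section DensityChange.
Context {R : realType}.
Variable rho : probability (mR3 R) R.
Hypothesis rho_leb : rho `<< leb3.

(** Two Radon-Nikodym derivatives meet here: that of the charge, from which [sqrt_density] is built,
    and the sigma-finite one, which is nonnegative and finite everywhere and carries the change of
    variables. They agree almost everywhere. *)
Lemma ae_sqrt_density : {ae leb3, forall x,
  Radon_Nikodym_SigmaFinite.f rho leb3 x = (sqrt_density rho x ^+ 2)%:E}.
Proof.
have [N [mN N0 sN]] := @ae_eq_Radon_Nikodym_SigmaFinite _ _ _ rho leb3 rho_leb setT measurableT.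
exists N; split => // x /= nx; apply: sN => /= /(_ I) fE; apply: nx.
rewrite /sqrt_density -fE sqr_sqrtr; last first.
  by rewrite fine_ge0// Radon_Nikodym_SigmaFinite.f_ge0.
by rewrite fineK// Radon_Nikodym_SigmaFinite.f_fin_num.
Qed.

Lemma measurable_sqrt_density : measurable3 (sqrt_density rho).
Proof.
have ms : measurable_fun setT (Num.sqrt : R -> R).
  by apply: continuous_measurable_fun; exact: sqrt_continuous.
apply: (measurableT_comp ms); apply: measurableT_comp.
  exact: fine_measurable.
by apply: (measurable_int leb3); exact: Radon_Nikodym_integrable.
Qed.

Lemma ge0_integral_sqrt_density (f : mR3 R -> \bar R) :
  measurable_fun setT f -> (forall x, 0 <= f x)%E ->
  (\int[leb3]_x (f x * (sqrt_density rho x ^+ 2)%:E) = \int[rho]_x f x)%E.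
Proof.
move=> mf f0; rewrite -(Radon_Nikodym_SigmaFinite.change_of_variables rho_leb f0 measurableT mf).
have ms : measurable_fun setT (fun x : mR3 R => (sqrt_density rho x ^+ 2)%:E).
  by apply/measurable_EFinP; apply: (measurable3X 2); exact: measurable_sqrt_density.
have mr := measurable_int leb3 (@Radon_Nikodym_SigmaFinite.f_integrable _ _ _ rho leb3 rho_leb).
apply: ae_eq_integral => //; [exact: emeasurable_funM|exact: emeasurable_funM|].
have [N [mN N0 sN]] := ae_sqrt_density.
exists N; split => // x /= nx; apply: sN => /= fE; apply: nx => _.
by rewrite fE.
Qed.

Lemma ge0_Rintegral_sqrt_density (f : R3 R -> R) :
  measurable3 f -> (forall x, 0 <= f x) ->
  \int[leb3]_x (sqrt_density rho x ^+ 2 * f x) = \int[rho]_x f x.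
Proof.
move=> mf f0; congr fine; rewrite -ge0_integral_sqrt_density//.
  by apply: eq_integral => x _; rewrite -EFinM mulrC.
exact/measurable_EFinP.
Qed.

End DensityChange.

(** * The Coulomb potential as a monotone limit *)

Section Coulomb.
Context {R : realType}.

Let h0 n : 0 < n.+1%:R^-1 :> R. Proof. by rewrite invr_gt0. Qed.

(** At s = 0 the regularized value is n + 1, which tends to +oo, in agreement with the extended
    inverse of 0; elsewhere this is continuity of the root and the inverse. *)
Lemma softV_cvg (s : R3 R) :
  ((soft n.+1%:R^-1 s)^-1)%:E @[n --> \oo] --> (((enorm s)%:E)^-1)%E.
Proof.
rewrite enormE; have := sq3_ge0 s; rewrite le_eqVlt => /predU1P[s0|s0].
  rewrite -s0 sqrtr0 inve0.
  apply/cvgeyPge => B; near=> n.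
  rewrite lee_fin /soft -s0 addr0 sqrtr_sqr gtr0_norm// invrK.
  near: n; exists (Num.truncn B) => // n /= Bn.
  apply: (le_trans (ltW (truncnS_gt B))); by rewrite ler_nat ltnS.
have sn0 : Num.sqrt (sq3 s) != 0 by rewrite gt_eqF// sqrtr_gt0.
rewrite inver (negbTE sn0); apply/fine_cvgP; split; first exact: nearW.
apply: (cvgV sn0); rewrite /soft.
have h2 : n.+1%:R^-1 ^+ 2 + sq3 s @[n --> \oo] --> sq3 s.
  rewrite -[X in _ --> X]add0r; apply: cvgD; last exact: cvg_cst.
  rewrite -(mulr0 0); under eq_fun do rewrite expr2.
  by apply: cvgM; exact: cvg_harmonic.
exact: (cvg_comp _ _ h2 (@sqrt_continuous R (sq3 s))).
Unshelve. all: by end_near. Qed.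

Let measurable_softV (X : R3 R) n :
  measurable_fun setT (fun x : mR3 R => ((soft n.+1%:R^-1 (x - X))^-1)%:E).
Proof.
apply/measurable_EFinP; apply: continuous_measurable3 => x.
apply: cvgV; first by rewrite gt_eqF// soft_gt0.
exact: (@continuous_shift3 R _ (- X) (@continuous_soft _ _)).
Qed.

Lemma measurable_enormV (X : R3 R) :
  measurable_fun setT (fun x : mR3 R => (((enorm (x - X))%:E)^-1)%E).
Proof.
apply: (@emeasurable_fun_cvg _ (mR3 R) R setT
  (fun n x => ((soft n.+1%:R^-1 (x - X))^-1)%:E)) => [n|x _].
  exact: measurable_softV.
exact: softV_cvg.
Qed.

(** Monotone convergence, since 1 / soft increases as its parameter decreases. It gives the limit
    before the Coulomb integral is known to be finite. *)
Lemma soft_inv_cvg (rho : probability (mR3 R) R) (X : R3 R) :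
  (\int[rho]_x ((soft n.+1%:R^-1 (x - X))^-1)%:E)%E @[n --> \oo] -->
  (\int[rho]_x ((enorm (x - X))%:E)^-1)%E.
Proof.
have -> : (\int[rho]_x ((enorm (x - X))%:E)^-1 =
   \int[rho]_x limn (fun n => ((soft n.+1%:R^-1 (x - X))^-1)%:E))%E.
  by apply: eq_integral => x _; apply/esym/cvg_lim => //; exact: softV_cvg.
apply: cvg_monotone_convergence => //.
- by move=> n x _; rewrite lee_fin invr_ge0 ltW// soft_gt0.
- move=> x _ m n mn; rewrite lee_fin lef_pV2 ?posrE ?soft_gt0//.
  rewrite /soft ler_wsqrtr// lerD2r lerXn2r ?nnegrE ?invr_ge0//.
  by rewrite lef_pV2 ?posrE// ler_nat ltnS.
Qed.

End Coulomb.

(** * Finite sums of fields *)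

Section SumOfFields.
Context {R : realType}.

Lemma cauchy_schwarz3 (a b : 'I_3 -> R) (s t : R) : 0 <= s -> 0 <= t ->
  \sum_i a i ^+ 2 <= s ^+ 2 -> \sum_i b i ^+ 2 <= t ^+ 2 ->
  \sum_i a i * b i <= s * t.
Proof.
move=> s0 t0; rewrite !big_ord_recr !big_ord0/= !add0r.
set a1 := a _; set a2 := a _; set a3 := a _; set b1 := b _; set b2 := b _; set b3 := b _.
move=> ha hb.
have h : (a1 * b1 + a2 * b2 + a3 * b3) ^+ 2 <= (s * t) ^+ 2.
  apply: (@le_trans _ _ ((a1 ^+ 2 + a2 ^+ 2 + a3 ^+ 2) * (b1 ^+ 2 + b2 ^+ 2 + b3 ^+ 2))).
    rewrite -subr_ge0 [leRHS](_ : _ = (a1 * b2 - a2 * b1) ^+ 2 + (a1 * b3 - a3 * b1) ^+ 2 + (a2 * b3 - a3 * b2) ^+ 2); last by ring.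
    by rewrite !addr_ge0 ?sqr_ge0.
  by rewrite exprMn ler_pM// !addr_ge0 ?sqr_ge0.
apply: le_trans (ler_norm _) _; rewrite -(ger0_norm (mulr_ge0 s0 t0)).
by rewrite -ler_sqr ?nnegrE// !real_normK ?num_real.
Qed.

(** The triangle inequality for the Euclidean norm in squared form, by induction: the cross terms
    are bounded by Cauchy-Schwarz. *)
Lemma sum_sq_sum_le (J : Type) (r : seq J) (V : J -> 'I_3 -> R) (s : J -> R) :
  (forall j, 0 <= s j) -> (forall j, \sum_i V j i ^+ 2 <= s j ^+ 2) ->
  \sum_i (\sum_(j <- r) V j i) ^+ 2 <= (\sum_(j <- r) s j) ^+ 2.
Proof.
move=> s0 hV; elim: r => [|j r IH].
  by rewrite big_nil; under eq_bigr do rewrite big_nil expr0n; rewrite big1 ?expr0n.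
have S0 : 0 <= \sum_(j <- r) s j by apply: sumr_ge0.
have cs := cauchy_schwarz3 (s0 j) S0 (hV j) IH.
under eq_bigr do rewrite big_cons sqrrD.
rewrite big_cons !big_split/= sqrrD lerD// lerD//.
by rewrite mulr2n lerD.
Qed.

Lemma continuous_sum (J : Type) (r : seq J) (f : J -> R3 R -> R) :
  (forall j, continuous (f j)) -> continuous (fun x => \sum_(j <- r) f j x).
Proof.
move=> cf; elim: r => [|j r IH] x.
  by under eq_fun do rewrite big_nil; exact: cvg_cst.
under eq_fun do rewrite big_cons.
by apply: cvgD; [exact: cf|exact: IH].
Qed.

Lemma measurable3_sum (J : Type) (r : seq J) (f : J -> R3 R -> R) :
  (forall j, measurable3 (f j)) -> measurable3 (fun x => \sum_(j <- r) f j x).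
Proof. by move=> mf; exact: (@measurable_sum _ (mR3 R)). Qed.

Lemma integrable3_sum (J : Type) (r : seq J) (f : J -> R3 R -> R) :
  (forall j, integrable3 (f j)) -> integrable3 (fun x => \sum_(j <- r) f j x).
Proof.
move=> mf; elim: r => [|j r IH].
  under eq_fun do rewrite big_nil; exact: integrable0.
by under eq_fun do rewrite big_cons; exact: integrable3D.
Qed.

Lemma Rintegral3_sum (J : Type) (r : seq J) (f : J -> R3 R -> R) :
  (forall j, integrable3 (f j)) ->
  \int[leb3]_x (\sum_(j <- r) f j x) = \sum_(j <- r) \int[leb3]_x f j x.
Proof.
move=> mf; elim: r => [|j r IH].
  by under eq_Rintegral do rewrite big_nil; rewrite big_nil Rintegral_cst// mul0r.
under eq_Rintegral do rewrite big_cons.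
by rewrite Rintegral3D//; [rewrite big_cons IH|exact: integrable3_sum].
Qed.

Lemma is_derive_sum3 (J : Type) (r : seq J) (f df : J -> R3 R -> R) x v :
  (forall j, is_derive x v (f j) (df j x)) ->
  is_derive x v (fun y => \sum_(j <- r) f j y) (\sum_(j <- r) df j x).
Proof.
move=> fd; elim: r => [|j r IH].
  by under eq_fun do rewrite big_nil; rewrite big_nil; exact: is_derive_cst3.
under eq_fun do rewrite big_cons; rewrite big_cons.
exact: is_derive_add3.
Qed.

End SumOfFields.

(** * Lower bound of the energy at fixed epsilon *)

Section LowerBound.
Context {R : realType} {M : nat} (X : 'I_M -> R3 R) (Z : 'I_M -> R).
Hypothesis Z_gt0 : forall k, 0 < Z k.
Implicit Types rho : probability (mR3 R) R.

(** A majorant, free of [d], of the Euclidean norm of the total field. It is continuous and vanishes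
    at infinity, so its square may be tested against weak* convergence; as [eta] tends to 0 it
    concentrates on the nuclei. *)
Definition peak (eta : R) (x : R3 R) : R :=
  \sum_(k < M) Z k / 2 * (eta ^+ 2 / (eta ^+ 2 + sq3 (x - X k))).

Lemma peak_term_bounds (eta : R) (y : R3 R) : 0 < eta ->
  0 <= eta ^+ 2 / (eta ^+ 2 + sq3 y) <= 1.
Proof.
move=> eta0; have e0 : 0 < eta ^+ 2 + sq3 y by rewrite ltr_wpDr ?sq3_ge0// exprn_gt0.
rewrite divr_ge0 ?sqr_ge0 ?(ltW e0)//= ler_pdivrMr// mul1r lerDl; exact: sq3_ge0.
Qed.

Lemma peak_ge0 eta x : 0 < eta -> 0 <= peak eta x.
Proof.
move=> eta0; apply: sumr_ge0 => k _.
have /andP[? _] := peak_term_bounds (x - X k) eta0.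
by rewrite mulr_ge0// divr_ge0// ltW.
Qed.

Lemma peak_le eta x : 0 < eta -> peak eta x <= \sum_(k < M) Z k / 2.
Proof.
move=> eta0; apply: ler_sum => k _.
have /andP[_ ?] := peak_term_bounds (x - X k) eta0.
by rewrite -[leRHS]mulr1 ler_wpM2l// divr_ge0// ltW.
Qed.

Lemma continuous_peak eta : 0 < eta -> continuous (peak eta).
Proof.
move=> eta0; apply: continuous_sum => k x.
have e0 : 0 < eta ^+ 2 + sq3 (x - X k) by rewrite ltr_wpDr ?sq3_ge0// exprn_gt0.
apply: cvgM; first exact: cvg_cst.
apply: cvgM; first exact: cvg_cst.
apply: cvgV; first by rewrite gt_eqF.
apply: cvgD; first exact: cvg_cst.
exact: (@continuous_shift3 R _ (- X k) (@continuous_sq3 R)).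
Qed.

Lemma integrable_bounded_rho rho (f : R3 R -> R) (C : R) : measurable3 f ->
  (forall x, `|f x| <= C) -> rho.-integrable setT (fun x => (f x)%:E).
Proof.
move=> mf fC; apply: measurable_bounded_integrable => //.
  exact: (le_lt_trans (probability_le1 rho measurableT) (ltry 1)).
exists C; split; first exact: num_real.
by move=> D CD x _; apply: le_trans (fC x) (ltW CD).
Qed.

Lemma measurable_soft_inv (d : R) k : 0 < d ->
  measurable3 (fun x => (soft d (x - X k))^-1).
Proof.
move=> d0; apply: continuous_measurable3 => x.
apply: cvgV; first by rewrite gt_eqF// soft_gt0.
exact: (@continuous_shift3 R _ (- X k) (@continuous_soft _ _)).
Qed.

Lemma virial_sum rho (e eta d : R) : 0 < e -> 0 < eta -> 0 < d ->
  rho `<< leb3 -> H1 (sqrt_density rho) ->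
  (forall i, L2 (weak_grad (sqrt_density rho) i) /\
    weak_partial i (sqrt_density rho) (weak_grad (sqrt_density rho) i)) ->
  e * \sum_(k < M) Z k * \int[rho]_x (soft d (x - X k))^-1 <=
  e ^+ 2 * \int[leb3]_x (\sum_(i < 3) weak_grad (sqrt_density rho) i x ^+ 2) +
  (\int[rho]_x (peak eta x ^+ 2) + e * (\sum_(k < M) Z k) / eta).
Proof.
move=> e0 eta0 d0 rl [u2 _] hg; set u := sqrt_density rho in u2 hg *.
(* By [sum_dfld_ge] the weight [Z k / 2] makes the divergence of the total field at least the sum of
   the Z_k / soft minus the sum of the Z_k / eta. *)
pose F i x := \sum_(k < M) Z k / 2 * fld d eta (X k) i x.
pose dF i x := \sum_(k < M) Z k / 2 * dfld d eta (X k) i x.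
have Z2 k : 0 <= Z k / 2 by rewrite divr_ge0// ltW.
have mF i : measurable3 (F i).
  by apply: measurable3_sum => k; apply: (measurable3M (measurable3_cst _)); exact: measurable_fld.
have mdF i : measurable3 (dF i).
  by apply: measurable3_sum => k; apply: (measurable3M (measurable3_cst _)); exact: measurable_dfld.
pose C := \sum_(k < M) Z k / 2.
have FC i x : `|F i x| <= C.
  apply: le_trans (ler_norm_sum _ _ _) _; apply: ler_sum => k _.
  by rewrite normrM ger0_norm// -[leRHS]mulr1 ler_wpM2l// fld_bounded.
have dFC i x : `|dF i x| <= C * (2 / d).
  apply: le_trans (ler_norm_sum _ _ _) _; rewrite /C mulr_suml; apply: ler_sum => k _.
  by rewrite normrM ger0_norm// ler_wpM2l// dfld_bounded.
have Fd i x : is_derive x (basis3 i) (F i) (dF i x).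
  apply: (@is_derive_sum3 _ _ _ (fun k y => Z k / 2 * fld d eta (X k) i y) (fun k y => Z k / 2 * dfld d eta (X k) i y)) => k.
  by apply: is_derive_scale3; exact: is_derive_fld.
have vb i := virial_bound e0 u2 (hg i).1 (hg i).2 (mF i) (mdF i) (FC i) (dFC i) (Fd i).
have iu := L2_integrable u2.
have F2 i x : `|F i x ^+ 2| <= C ^+ 2.
  by rewrite normrX lerXn2r ?nnegrE//; apply: le_trans (FC i x).
have ibd (h : R3 R -> R) B : measurable3 h -> (forall x, `|h x| <= B) -> integrable3 (fun x => u x ^+ 2 * h x).
  move=> mh hB; under [X in integrable3 X]eq_fun do rewrite mulrC.
  exact: integrable3_bounded hB.
have i1 i : integrable3 (fun x => u x ^+ 2 * (e * dF i x - F i x ^+ 2)).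
  apply: (ibd _ (e * (C * (2 / d)) + C ^+ 2)).
    by apply: measurable3B; [exact: (measurable3M (measurable3_cst _))|exact: (measurable3X 2)].
  move=> x; apply: le_trans (ler_normB _ _) _; rewrite lerD//.
  by rewrite normrM gtr0_norm// ler_pM2l.
have h1 : \int[leb3]_x (\sum_i u x ^+ 2 * (e * dF i x - F i x ^+ 2)) <=
   e ^+ 2 * \int[leb3]_x (\sum_(i < 3) weak_grad u i x ^+ 2).
  rewrite Rintegral3_sum// Rintegral3_sum; last by move=> i; apply: L2_integrable; case: (hg i).
  by rewrite mulr_sumr; apply: ler_sum => i _.
have zi k : integrable3 (fun x => u x ^+ 2 * (soft d (x - X k))^-1).
  apply: (ibd _ d^-1); first exact: measurable_soft_inv.
  move=> x; rewrite gtr0_norm ?invr_gt0 ?soft_gt0// lef_pV2 ?posrE ?soft_gt0//.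
  exact: soft_ge.
have zE k : \int[rho]_x (soft d (x - X k))^-1 = \int[leb3]_x (u x ^+ 2 * (soft d (x - X k))^-1).
  rewrite ge0_Rintegral_sqrt_density//; first exact: measurable_soft_inv.
  by move=> x; rewrite invr_ge0 ltW// soft_gt0.
have mp : measurable3 (fun x => peak eta x ^+ 2).
  by apply: (measurable3X 2); apply: continuous_measurable3; exact: continuous_peak.
have pb x : `|peak eta x ^+ 2| <= C ^+ 2.
  by rewrite normrX lerXn2r ?nnegrE ?ger0_norm ?peak_ge0 ?sumr_ge0 ?peak_le.
have pi : integrable3 (fun x => u x ^+ 2 * peak eta x ^+ 2) by exact: ibd mp pb.
have pE : \int[rho]_x (peak eta x ^+ 2) = \int[leb3]_x (u x ^+ 2 * peak eta x ^+ 2).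
  by rewrite ge0_Rintegral_sqrt_density// => x; exact: sqr_ge0.
have oneE : \int[leb3]_x (u x ^+ 2 * 1) = 1.
  rewrite ge0_Rintegral_sqrt_density//; last exact: measurable3_cst.
  by rewrite Rintegral_cst// mul1r -[RHS]/(fine 1%E); congr fine; exact: probability_setT.
have i1u : integrable3 (fun x => u x ^+ 2 * 1).
  by under [X in integrable3 X]eq_fun do rewrite mulr1.
rewrite pE; apply: (le_trans _ (lerD h1 (lexx _))).
under eq_bigr do rewrite zE.
(* The constant is written as an integral against u^2, of total mass 1, so that the remaining
   inequality can be proved pointwise. *)
have -> : e * (\sum_(k < M) Z k) / eta = e * (\sum_(k < M) Z k) / eta * \int[leb3]_x (u x ^+ 2 * 1).
  by rewrite oneE mulr1.
rewrite -Rintegral3Z// -Rintegral3D//; last exact: integrable3Z.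
rewrite -Rintegral3D//; last 2 first.
- exact: integrable3_sum.
- by apply: integrable3D => //; exact: integrable3Z.
have -> : \sum_(k < M) Z k * \int[leb3]_x (u x ^+ 2 / soft d (x - X k)) =
    \int[leb3]_x (\sum_(k < M) Z k * (u x ^+ 2 / soft d (x - X k))).
  rewrite Rintegral3_sum; last by move=> k; exact: integrable3Z.
  by apply: eq_bigr => k _; rewrite Rintegral3Z.
have sZ : integrable3 (fun x => \sum_(k < M) Z k * (u x ^+ 2 / soft d (x - X k))).
  by apply: integrable3_sum => k; exact: integrable3Z.
rewrite -Rintegral3Z//; apply: le_Rintegral3.
- exact: integrable3Z.
- apply: integrable3D; first exact: integrable3_sum.
  by apply: integrable3D => //; exact: integrable3Z.
move=> x; rewrite -mulr_sumr sumrB -mulr_sumr.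
have -> : \sum_(k < M) Z k * (u x ^+ 2 / soft d (x - X k)) =
   u x ^+ 2 * \sum_(k < M) Z k / soft d (x - X k).
  by rewrite mulr_sumr; apply: eq_bigr => k _; rewrite mulrCA.
have hF : \sum_i F i x ^+ 2 <= peak eta x ^+ 2.
  apply: (@sum_sq_sum_le _ _ _ (fun k i => Z k / 2 * fld d eta (X k) i x)) => k.
    have /andP[? _] := peak_term_bounds (x - X k) eta0; by rewrite mulr_ge0.
  under eq_bigr do rewrite exprMn; rewrite -mulr_sumr [leRHS]exprMn ler_wpM2l ?sqr_ge0//.
  exact: sum_fld_sq_le.
have hdF : \sum_(k < M) Z k / soft d (x - X k) - (\sum_(k < M) Z k) / eta <= \sum_i dF i x.
  rewrite /dF exchange_big/= mulr_suml -sumrB; apply: ler_sum => k _.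
  rewrite -mulr_sumr; apply: le_trans (ler_wpM2l (Z2 k) (sum_dfld_ge d0 eta0 (X k) x)).
  by rewrite le_eqVlt; apply/orP; left; apply/eqP; field; rewrite !gt_eqF// soft_gt0.
set a := \sum_(k < M) _ / _ in hdF *; set b := (\sum_(k < M) Z k) in hdF *.
set c := \sum_i _ in hF *; set dd := \sum_i _ in hdF *.
have u0 := sqr_ge0 (u x); set U := u x ^+ 2 in u0 *; set P := peak eta x ^+ 2 in hF *.
rewrite -subr_ge0 [leRHS](_ : _ = U * (e * (dd - (a - b / eta)) + (P - c))); last by ring.
by rewrite mulr_ge0// addr_ge0 ?subr_ge0// mulr_ge0 ?(ltW e0)// subr_ge0.
Qed.

Lemma energy_lower_bound rho (e eta : R) : 0 < e -> 0 < eta ->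
  ((- (\int[rho]_x (peak eta x ^+ 2) + e * (\sum_(k < M) Z k) / eta))%:E <= G0_ X Z e rho)%E.
Proof.
move=> e0 eta0; rewrite /G0_; case: ifPn => [_|/eqP kfin]; first by rewrite leey.
move: kfin; rewrite /kinetic; case: asboolP => [[rl h1] _|//].
set u := sqrt_density rho.
have [u2 hg] := h1.
have wg i : L2 (weak_grad u i) /\ weak_partial i u (weak_grad u i).
  have [g g2 wg] := hg i.
  by apply: (@xgetPex _ (cst 0) [set g | L2 g /\ weak_partial i u g]); exists g.
have ig : integrable3 (fun x => \sum_(i < 3) weak_grad u i x ^+ 2).
  by apply: integrable3_sum => i; apply: L2_integrable; case: (wg i).
have TE : (\int[leb3]_x (\sum_(i < 3) weak_grad u i x ^+ 2)%:E)%E =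
  (\int[leb3]_x (\sum_(i < 3) weak_grad u i x ^+ 2))%:E.
  by rewrite fineK//; exact: integrable_fin_num.
rewrite TE; set T := \int[leb3]_x (\sum_(i < 3) weak_grad u i x ^+ 2).
set B := \int[rho]_x _ + _.
(* Solved for the Coulomb term, the virial inequality has a right-hand side free of [d]. It
   therefore survives the limit and shows that the potential is finite, which makes the
   extended-real difference in [G0_] an ordinary one. *)
have pot n : (\sum_(k < M) (Z k)%:E * \int[rho]_x ((soft n.+1%:R^-1 (x - X k))^-1)%:E <=
   (e^-1 * (e ^+ 2 * T + B))%:E)%E.
  have n0 : 0 < n.+1%:R^-1 :> R by rewrite invr_gt0.
  have := virial_sum e0 eta0 n0 rl h1 wg.
  rewrite -/u -/T -/B mulrC -ler_pdivlMr// mulrC -lee_fin; apply: le_trans.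
  rewrite -sumEFin; apply: lee_sum => k _; rewrite EFinM lee_wpmul2l ?lee_fin ?(ltW (Z_gt0 k))//.
  rewrite fineK//; apply: integrable_fin_num => //.
  apply: (@integrable_bounded_rho _ _ ((n.+1%:R^-1)^-1)); first exact: measurable_soft_inv.
  move=> x; rewrite gtr0_norm ?invr_gt0 ?soft_gt0// lef_pV2 ?posrE ?soft_gt0//.
  exact: soft_ge.
have potle : (potential X Z rho <= (e^-1 * (e ^+ 2 * T + B))%:E)%E.
  have cv : (\sum_(k < M) (Z k)%:E * \int[rho]_x ((soft n.+1%:R^-1 (x - X k))^-1)%:E)%E
     @[n --> \oo] --> potential X Z rho.
    apply: cvg_nnesum => k _.
      apply: nearW => n; rewrite mule_ge0 ?lee_fin ?(ltW (Z_gt0 k))//.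
      by apply: integral_ge0 => x _; rewrite lee_fin invr_ge0 sqrtr_ge0.
    by apply: cvgeZl => //; exact: soft_inv_cvg.
  by apply: (cvge_le _ cv); exact: nearW.
have pot0 : (0 <= potential X Z rho)%E.
  apply: sume_ge0 => k _; rewrite mule_ge0 ?lee_fin ?(ltW (Z_gt0 k))//.
  by apply: integral_ge0 => x _; rewrite inve_ge0 lee_fin sqrtr_ge0.
have : potential X Z rho \is a fin_num.
  by rewrite ge0_fin_numE// (le_lt_trans potle)// ltry.
move: potle => /[swap] /fineK <-; set p := fine _.
rewrite lee_fin -(ler_pM2l e0) mulrA divff ?gt_eqF// mul1r => pl.
by rewrite -!EFinM -EFinB lee_fin; lra.
Qed.

End LowerBound.

Section Point.
Context {R : realType}.

Lemma measurable_point (X : R3 R) : measurable ([set X] : set (mR3 R)).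
Proof.
rewrite [X in measurable X](_ : _ = ([set X.1.1] `*` [set X.1.2]) `*` [set X.2]).
  by apply: measurableX; [apply: measurableX|].
by apply/seteqP; split => [x ->//|[[x1 x2] x3] [[/= -> ->] ->]]; case: X => -[].
Qed.

End Point.

(** * Lower and upper limits along a filter *)

Section Limf.
Context {R : realType}.

Lemma limf_einf_ge (f : R -> \bar R) (F : set_system R) (c : \bar R) :
  (\forall e \near F, (c <= f e)%E) -> (c <= limf_einf f F)%E.
Proof.
move=> cf; rewrite limf_einfE.
apply: (@le_trans _ _ (ereal_inf (f @` [set e | (c <= f e)%E]))).
  by apply: le_ereal_inf_tmp => _ [e /= ce <-].
by apply: ereal_sup_ubound; exists [set e | (c <= f e)%E].
Qed.

Lemma limf_esup_le (f : R -> \bar R) (F : set_system R) (c : \bar R) :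
  (\forall e \near F, (f e <= c)%E) -> (limf_esup f F <= c)%E.
Proof.
move=> cf; rewrite limf_esupE.
apply: (@le_trans _ _ (ereal_sup (f @` [set e | (f e <= c)%E]))).
  by apply: ereal_inf_lbound; exists [set e | (f e <= c)%E].
by apply: ge_ereal_sup => _ [e /= ce <-].
Qed.

Lemma limf_einf_le_esup (f : R -> \bar R) (F : set_system R) : ProperFilter F ->
  (limf_einf f F <= limf_esup f F)%E.
Proof.
move=> PF; rewrite limf_einfE limf_esupE.
apply: ge_ereal_sup => _ [V FV <-]; apply: le_ereal_inf_tmp => _ [W FW <-].
have [x [Vx Wx]] := filter_ex (filterI FV FW).
apply: (@le_trans _ _ (f x)); first by apply: ereal_inf_lbound; exists x.
by apply: ereal_sup_ubound; exists x.
Qed.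

End Limf.

(** * Functions vanishing at infinity *)

Section Vanishing.
Context {R : realType}.
Implicit Types (f g : R3 R -> R).

Lemma vanish_shift f (v : R3 R) : vanishes_at_infinity f ->
  vanishes_at_infinity (fun x => f (x + v)).
Proof.
move=> vf e e0; have [K cK fK] := vf e e0.
exists ((fun x => x - v) @` K).
  apply: continuous_compact cK; apply: continuous_subspaceT => x.
  by apply: cvgD; [exact: cvg_id|exact: cvg_cst].
move=> x nx; apply: fK; apply: contra_not nx => Kx; exists (x + v) => //.
by rewrite addrK.
Qed.

Lemma vanishD f g : vanishes_at_infinity f -> vanishes_at_infinity g ->
  vanishes_at_infinity (fun x => f x + g x).
Proof.
move=> vf vg e e0; have e2 : 0 < e / 2 by rewrite divr_gt0.
have [K cK fK] := vf _ e2; have [L cL gL] := vg _ e2.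
exists (K `|` L); first exact: compactU.
move=> x /not_orP[nK nL]; rewrite (le_lt_trans (ler_normD _ _))//.
by rewrite (splitr e) ltrD ?fK ?gL.
Qed.

Lemma vanishM f g (C : R) : vanishes_at_infinity f -> (forall x, `|g x| <= C) ->
  vanishes_at_infinity (fun x => g x * f x).
Proof.
move=> vf gC e e0; have C1 : 0 < C + 1.
  by rewrite ltr_wpDl// (le_trans _ (gC 0)).
have [K cK fK] := vf (e / (C + 1)) (divr_gt0 e0 C1).
exists K => // x nx; rewrite normrM.
have := fK x nx; rewrite ltr_pdivlMr// mulrC; apply: le_lt_trans.
by rewrite ler_wpM2r// (le_trans (gC x))// lerDl.
Qed.

Lemma vanish_sum (J : Type) (r : seq J) (f : J -> R3 R -> R) :
  (forall j, vanishes_at_infinity (f j)) ->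
  vanishes_at_infinity (fun x => \sum_(j <- r) f j x).
Proof.
move=> vf; elim: r => [|j r IH].
  move=> e e0; exists set0; first exact: compact0.
  by move=> x _; rewrite big_nil normr0.
by under eq_fun do rewrite big_cons; exact: vanishD.
Qed.

Lemma vanish_lorentz (eta : R) : 0 < eta ->
  vanishes_at_infinity (fun x => eta ^+ 2 / (eta ^+ 2 + sq3 x)).
Proof.
move=> eta0 e e0; have eta2 : 0 < eta ^+ 2 by rewrite exprn_gt0.
(* From n e > eta^2 the quotient is below [e] once |x|^2 > n; from n >= 1 one has n <= n^2, so |x|^2
   <= n puts every coordinate in [-n, n]. *)
pose n := 1 + eta ^+ 2 / e.
have n1 : 1 <= n by rewrite lerDl divr_ge0 ?ltW.
exists (cube n); first exact: compact_cube.
move=> x nx; have es : 0 < eta ^+ 2 + sq3 x by rewrite ltr_wpDr ?sq3_ge0.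
rewrite ger0_norm ?divr_ge0 ?(ltW es) ?(ltW eta2)// ltr_pdivrMr//.
suff h : n < sq3 x.
  have : n * e < sq3 x * e by rewrite ltr_pM2r.
  rewrite /n mulrDl divfK ?gt_eqF// mulrDr mul1r [e * sq3 x]mulrC => h'.
  have : 0 < e * eta ^+ 2 by rewrite mulr_gt0.
  by lra.
rewrite ltNge; apply/negP => sn; apply: nx.
have hc i : - n <= co i x <= n.
  have := le_trans (co_sq_le i x) sn; rewrite -ler_norml => ci.
  have n0 : 0 <= n by apply: le_trans n1.
  rewrite -ler_sqr ?nnegrE// real_normK ?num_real//.
  by apply: (le_trans ci); rewrite expr2 ler_peMl.
have := hc 0; have := hc (inord 1); have := hc (inord 2).
by rewrite /co !inordK//= => h3 h2 h1; split.
Qed.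

End Vanishing.

(** * The liminf inequality *)

Section Liminf.
Context {R : realType} {M : nat} (X : 'I_M -> R3 R) (Z : 'I_M -> R).
Hypothesis X_inj : injective X.
Hypothesis Z_gt0 : forall k, 0 < Z k.
Implicit Types rho : subprobability (mR3 R) R.

(** Dominated convergence on the finite measure [rho]. The pointwise limit of [peak] is Z_k / 2 at
    X_k and 0 elsewhere; its square has no cross terms because the nuclei are distinct. *)
Lemma peak_sq_cvg rho :
  (\int[rho]_x ((peak X Z n.+1%:R^-1 x ^+ 2)%:E))%E @[n --> \oo] -->
  (4^-1%:E * \sum_(k < M) (Z k ^+ 2)%:E * rho [set X k])%E.
Proof.
have Z2 k : 0 <= Z k / 2 by rewrite divr_ge0// ltW.
have h0 n : 0 < n.+1%:R^-1 :> R by rewrite invr_gt0.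
have mX k := measurable_point (X k).
pose S2 x := \sum_(k < M) Z k ^+ 2 / 4 * \1_[set X k] x.
have mS2 : measurable3 S2.
  by apply: measurable3_sum => k; apply: (measurable3M (measurable3_cst _)); exact: measurable_indic.
have -> : (4^-1%:E * \sum_(k < M) (Z k ^+ 2)%:E * rho [set X k] = \int[rho]_x (S2 x)%:E)%E.
  transitivity (\int[rho]_x (\sum_(k < M) (Z k ^+ 2 / 4)%:E * (\1_[set X k] x)%:E))%E; last first.
    by apply: eq_integral => x _; rewrite /S2 -sumEFin.
  rewrite ge0_integral_sum//; last 2 first.
  - move=> k; apply: emeasurable_funM => //; apply/measurable_EFinP; exact: measurable_indic.
  - by move=> k x _; rewrite -EFinM lee_fin mulr_ge0// divr_ge0// sqr_ge0.
  rewrite ge0_sume_distrr; last by move=> k _; rewrite mule_ge0// lee_fin sqr_ge0.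
  apply: eq_bigr => k _; rewrite ge0_integralZl//; last 2 first.
  - by apply/measurable_EFinP; exact: measurable_indic.
  - by rewrite lee_fin divr_ge0// sqr_ge0.
  by rewrite integral_indic// setIT muleA -EFinM mulrC.
have S2E x : S2 x = (\sum_(k < M) Z k / 2 * \1_[set X k] x) ^+ 2.
  have [[k kx]|nk] := pselect (exists k, x = X k).
    have sk (f : 'I_M -> R) : \sum_(j < M) f j * \1_[set X j] x = f k.
      rewrite (bigD1 k)//= big1; first by rewrite indicE mem_set// addr0 mulr1.
      move=> j jk; rewrite indicE memNset ?mulr0//= kx => /X_inj kj.
      by rewrite kj eqxx in jk.
    by rewrite /S2 !sk expr_div_n -natrX.
  rewrite /S2 !big1 ?expr0n// => k _; rewrite indicE memNset ?mulr0// => xk; apply: nk; by exists k.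
pose C := \sum_(k < M) Z k / 2.
have [] := @dominated_convergence _ _ _ rho setT measurableT
  (fun n x => (peak X Z n.+1%:R^-1 x ^+ 2)%:E) (fun x => (S2 x)%:E) (fun=> (C ^+ 2)%:E) => //.
- move=> n; apply/measurable_EFinP; apply: (measurable3X 2); apply: continuous_measurable3.
  exact: continuous_peak.
- exact/measurable_EFinP.
- apply: aeW => x _; apply/fine_cvgP; split; first exact: nearW.
  rewrite S2E; under eq_fun do rewrite expr2; rewrite expr2.
  suff pc : peak X Z n.+1%:R^-1 x @[n --> \oo] --> \sum_(k < M) Z k / 2 * \1_[set X k] x.
    exact: cvgM.
  rewrite /peak; elim: (index_enum _) => [|k r IH].
    by under eq_fun do rewrite big_nil; rewrite big_nil; exact: cvg_cst.
  under eq_fun do rewrite big_cons; rewrite big_cons; apply: cvgD => //.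
  apply: cvgM; first exact: cvg_cst.
  rewrite indicE; case: (boolP (x \in _)) => [|xk].
    rewrite inE/= => ->; apply: cvg_near_cst; apply: nearW => n.
    by rewrite subrr /sq3 big1 ?addr0 ?divff ?expf_neq0 ?gt_eqF// => i _; rewrite /co/= !if_same expr0n.
  have s0 : sq3 (x - X k) != 0.
    apply: contra xk => s0; rewrite inE/=.
    have ci i : co i (x - X k) = 0.
      apply/eqP; rewrite -sqrf_eq0 eq_le sqr_ge0 andbT -(eqP s0); exact: co_sq_le.
    have := ci 0; have := ci (inord 1); have := ci (inord 2).
    rewrite /co !inordK//= => /eqP + /eqP + /eqP; rewrite !subr_eq0.
    by case: (x) (X k) => -[a b] c [[a' b'] c']/= /eqP -> /eqP -> /eqP ->.
  have hh : n.+1%:R^-1 ^+ 2 @[n --> \oo] --> (0 : R).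
    rewrite -(mulr0 0); under eq_fun do rewrite expr2.
    by apply: cvgM; exact: cvg_harmonic.
  rewrite -[X in _ --> X](mul0r (0 + sq3 (x - X k))^-1).
  apply: cvgM => //; apply: cvgV; first by rewrite add0r.
  by apply: cvgD => //; exact: cvg_cst.
- exact: finite_measure_integrable_cst.
- apply: aeW => x n _; rewrite lee_fin normrX lerXn2r ?nnegrE//.
    by apply: sumr_ge0.
  by rewrite ger0_norm ?peak_ge0//; exact: peak_le.
Qed.

Lemma Gamma_liminf_ge rho :
  (- (4^-1%:E * \sum_(k < M) (Z k ^+ 2)%:E * rho [set X k]) <=
   Gamma_liminf (G0_ X Z) rho)%E.
Proof.
apply: le_ereal_inf_tmp => _ [rho_ wcv <-].
have low (eta : R) : 0 < eta ->
  ((- (\int[rho]_x (peak X Z eta x ^+ 2)))%:E <= limf_einf (fun e => G0_ X Z e (rho_ e)) 0^'+)%E.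
  (* Here [d] is an error tolerance: one half covers the convergence of the integral of the squared
     peak, the other the term e B. The divisor [B + 1] stays positive when there are no nuclei. *)
  move=> eta0; apply/lee_addgt0Pr => d d0; rewrite -leeBlDr//.
  apply: limf_einf_ge.
  have cv : \int[rho_ e]_x (peak X Z eta x ^+ 2) @[e --> 0^'+] --> \int[rho]_x (peak X Z eta x ^+ 2).
    apply: wcv.
      move=> x; under eq_fun do rewrite expr2.
      by apply: cvgM; exact: continuous_peak.
    under eq_fun do rewrite expr2.
    apply: (@vanishM _ _ _ (\sum_(k < M) Z k / 2)).
      apply: vanish_sum => k.
      apply: (@vanishM _ _ _ (Z k / 2)).
        exact: (vanish_shift (- X k) (vanish_lorentz eta0)).
      by move=> x; rewrite ger0_norm// divr_ge0// ltW.
    by move=> x; rewrite ger0_norm ?peak_ge0//; exact: peak_le.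
  have d2 : 0 < d / 2 by rewrite divr_gt0.
  pose B := (\sum_(k < M) Z k) / eta.
  have B0 : 0 <= B by rewrite divr_ge0 ?(ltW eta0)// sumr_ge0// => k _; rewrite ltW.
  have B1 : 0 < B + 1 by rewrite ltr_wpDl.
  move/cvgrPdist_lt : cv => /(_ _ d2) cv.
  near=> e.
  have e0 : 0 < e by near: e; exact: nbhs_right_gt.
  have eB : e < d / 2 / (B + 1) by near: e; apply: nbhs_right_lt; exact: divr_gt0.
  have hd : `|\int[rho]_x (peak X Z eta x ^+ 2) - \int[rho_ e]_x (peak X Z eta x ^+ 2)| < d / 2.
    by near: e.
  apply: le_trans (energy_lower_bound X Z_gt0 (rho_ e) e0 eta0).
  rewrite -EFinB lee_fin -mulrA -/B.
  move: hd eB; rewrite ltr_norml => /andP[? ?]; rewrite ltr_pdivlMr// mulrDr mulr1 => ?.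
  by lra.
have cv := @peak_sq_cvg rho.
rewrite leeNl; apply: (cvge_ge _ cv); apply: nearW => n.
have n0 : 0 < n.+1%:R^-1 :> R by rewrite invr_gt0.
rewrite leeNl; apply: le_trans (low _ n0); rewrite EFinN leeN2 fineK//.
have pb x : `|peak X Z n.+1%:R^-1 x ^+ 2| <= (\sum_(k < M) Z k / 2) ^+ 2.
  rewrite normrX lerXn2r ?nnegrE//.
    by apply: sumr_ge0 => k _; rewrite divr_ge0// ltW.
  by rewrite ger0_norm ?peak_ge0//; exact: peak_le.
apply: integrable_fin_num => //; apply: measurable_bounded_integrable => //.
- by rewrite ltey_eq fin_num_measure.
- by apply: (measurable3X 2); apply: continuous_measurable3; exact: continuous_peak.
- exists ((\sum_(k < M) Z k / 2) ^+ 2); split; first exact: num_real.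
  by move=> D CD x _; apply: le_trans (pb x) (ltW CD).
Unshelve. all: by end_near.
Qed.

End Liminf.

(** * Upper bound *)

Section Positivity.
Context d (T : measurableType d) {R : realType} (mu : {measure set T -> \bar R}).

Lemma integral_gt0 (f : T -> R) : measurable_fun setT f -> (forall x, 0 < f x) ->
  mu setT != 0%E -> (0 < \int[mu]_x (f x)%:E)%E.
Proof.
move=> mf f0 mu0; rewrite lt_def; apply/andP; split; last first.
  by apply: integral_ge0 => x _; rewrite lee_fin ltW.
apply: contra mu0 => /eqP h.
have mf' : measurable_fun setT (fun x => (f x)%:E) by apply/measurable_EFinP.
have : (\int[mu]_x `|(f x)%:E| = 0)%E.
  by rewrite -[RHS]h; apply: eq_integral => x _; rewrite gee0_abs// lee_fin ltW.
move=> /(ae_eq_integral_abs mu measurableT mf').1 [N [mN N0 sN]].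
rewrite -measure_le0 -N0 le_measure ?inE// => x _; apply: sN => /= /(_ I) [fx].
by have := f0 x; rewrite fx ltxx.
Qed.

End Positivity.

(** * Integrability of exponentials *)

Section ExpIntegrable.
Context {R : realType}.
Notation mu := (@lebesgue_measure R).

(** On the positive half-line the integrand is 1/b times the density of the exponential distribution
    of rate [b]; the negative half-line follows by reflection. *)
Lemma integral_exp_abs_lty (b : R) : 0 < b ->
  (\int[mu]_t (expR (- b * `|t|))%:E < +oo)%E.
Proof.
move=> b0.
have me : measurable_fun setT (fun t : measurableTypeR R => (expR (- b * `|t|))%:E).
  by apply/measurable_EFinP; apply: measurableT_comp => //; apply: measurable_funM.
have h0 : (\int[mu]_(t in `[0%R, +oo[) (expR (- b * `|t|))%:E < +oo)%E.
  apply: (@le_lt_trans _ _ (\int[mu]_t (b^-1 * exponential_pdf b t)%:E)%E); last first.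
    under eq_integral do rewrite EFinM.
    rewrite ge0_integralZl//; last 3 first.
    - by apply/measurable_EFinP; exact: measurable_exponential_pdf.
    - by move=> x _; rewrite lee_fin exponential_pdf_ge0// ltW.
    - by rewrite lee_fin invr_ge0 ltW.
    by rewrite integral_exponential_pdf// mule1 ltry.
  rewrite integral_mkcond; apply: ge0_le_integral => //.
  - by move=> t _; rewrite erestrict_ge0// => s _; rewrite lee_fin expR_ge0.
  - by apply/(measurable_restrictT _ _).1 => //; exact: measurable_funTS.
  - by apply/measurable_EFinP; apply: measurable_funM => //; exact: measurable_exponential_pdf.
  - move=> t _; rewrite /patch; case: ifPn => [|_].
      rewrite inE/= in_itv/= andbT => t0.
      by rewrite exponential_pdfE//= ger0_norm// mulrA mulVf ?gt_eqF// mul1r.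
    by rewrite -[X in (X <= _)%E]/(0%E) lee_fin mulr_ge0 ?invr_ge0 ?exponential_pdf_ge0 ?ltW.
have h1 : (\int[mu]_(t in `]-oo, 0%R]) (expR (- b * `|t|))%:E < +oo)%E.
  have := @ge0_integration_by_substitution0 R (fun t => (expR (- b * `|t|))%:E) me
    (fun _ => expR_ge0 _).
  under [in RHS]eq_integral do rewrite normrN.
  by move=> <-.
rewrite -(setUv `[0%R, +oo[%classic) ge0_integral_setU//; last 3 first.
- exact: measurableC.
- by rewrite setUv.
- exact/disj_setPCl.
rewrite lte_add_pinfty//; apply: le_lt_trans h1.
apply: ge0_subset_integral => //; first exact: measurableC.
  exact: measurable_funTS.
by move=> t /=; rewrite !in_itv/= andbT => /negP; rewrite -ltNge => /ltW.
Qed.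

Lemma integral_prod3 (f g h : R -> R) : measurable_fun setT (f : measurableTypeR R -> R) ->
  measurable_fun setT (g : measurableTypeR R -> R) ->
  measurable_fun setT (h : measurableTypeR R -> R) ->
  (forall t, 0 <= f t) -> (forall t, 0 <= g t) -> (forall t, 0 <= h t) ->
  (\int[leb3]_x (f x.1.1 * g x.1.2 * h x.2)%:E =
   \int[mu]_t (f t)%:E * (\int[mu]_t (g t)%:E * \int[mu]_t (h t)%:E))%E.
Proof.
move=> mf mg mh f0 g0 h0.
have m1 : measurable_fun setT (fun x : mR3 R => x.1.1).
  exact: (measurableT_comp measurable_fst measurable_fst).
have m2 : measurable_fun setT (fun x : mR3 R => x.1.2).
  exact: (measurableT_comp measurable_snd measurable_fst).
rewrite leb3_iter; last 2 first.
- apply/measurable_EFinP; apply: measurable_funM; first apply: measurable_funM.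
  + exact: (measurableT_comp mf m1).
  + exact: (measurableT_comp mg m2).
  + exact: (measurableT_comp mh measurable_snd).
- by move=> x; rewrite lee_fin !mulr_ge0.
have hp : (0 <= \int[mu]_t (h t)%:E)%E by apply: integral_ge0 => t _; rewrite lee_fin.
have gp : (0 <= \int[mu]_t (g t)%:E)%E by apply: integral_ge0 => t _; rewrite lee_fin.
move: hp gp; set Ih : \bar R := (\int[mu]_t (h t)%:E)%E.
set Ig : \bar R := (\int[mu]_t (g t)%:E)%E => hp gp.
have E1 x y : (\int[mu]_z (f x * g y * h z)%:E = (f x)%:E * ((g y)%:E * Ih))%E.
  under eq_integral do rewrite EFinM.
  rewrite muleA -EFinM; apply: ge0_integralZl => //; first exact/measurable_EFinP.
    by move=> z _; rewrite lee_fin.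
  by rewrite lee_fin mulr_ge0.
have E2 x : (\int[mu]_y ((f x)%:E * ((g y)%:E * Ih)) = (f x)%:E * (Ig * Ih))%E.
  have mgI : measurable_fun setT (fun y : measurableTypeR R => (g y)%:E * Ih)%E.
    by apply: emeasurable_funM => //; exact/measurable_EFinP.
  have gI0 y : (0 <= (g y)%:E * Ih)%E by rewrite mule_ge0 ?lee_fin.
  have fx0 : (0 <= (f x)%:E)%E by rewrite lee_fin.
  rewrite (ge0_integralZl mu measurableT mgI (fun y _ => gI0 y) fx0).
  congr (_ * _)%E; apply: ge0_integralZr => //; first exact/measurable_EFinP.
  by move=> y _; rewrite lee_fin.
under eq_integral => x _.
  under eq_integral => y _ do rewrite E1.
  rewrite E2; over.
apply: ge0_integralZr => //; first exact/measurable_EFinP.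
- by move=> y _; rewrite lee_fin.
- exact: mule_ge0.
Qed.

End ExpIntegrable.

(** * The smoothed hydrogen profile *)

Section Profile.
Context {R : realType}.
Variable d : R.
Hypothesis d0 : 0 < d.
Implicit Types (x v : R3 R) (i : 'I_3).

Lemma local_line_lipschitz (F dF : R3 R -> R) v (L h : R) x : 0 < h ->
  (forall x, is_derive x v F (dF x)) ->
  (forall t : R, 0 <= t <= h -> `|dF (x + t *: v)| <= L) ->
  `|F (x + h *: v) - F x| <= L * h.
Proof.
move=> h0 Fd dL; pose f (s : R) := F (x + s *: v).
have fd (s : R) : is_derive s (1 : R) f (dF (x + s *: v)) by exact: is_derive_line.
have [c cI fc] := @MVT _ f _ 0 h h0 (fun s _ => fd s)
  ltac:(by apply: derivable_within_continuous => s _; have [] := fd s).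
have -> : F x = f 0 by rewrite /f scale0r addr0.
rewrite fc subr0 normrM [`|h|]gtr0_norm// ler_wpM2r ?(ltW h0)//.
by apply: dL; have := subset_itv_oo_cc cI; rewrite in_itv.
Qed.

(** This is an unnormalized probability density, so the corresponding wave function is exp(-soft /
    2). *)
Definition wexp (s : R3 R) : R := expR (- soft d s).

Lemma wexp_gt0 (s : R3 R) : 0 < wexp s. Proof. exact: expR_gt0. Qed.

Lemma continuous_wexp : continuous wexp.
Proof.
move=> x; apply: (@continuous_comp _ _ _ (fun y => - soft d y) expR).
  by apply: cvgN; exact: continuous_soft.
exact: continuous_expR.
Qed.

Lemma measurable_wexp : measurable3 wexp.
Proof. by apply: continuous_measurable3; exact: continuous_wexp. Qed.

Lemma is_derive_wexp i (s : R3 R) : is_derive s (basis3 i) wexp (- (co i s / soft d s) * wexp s).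
Proof.
apply: line_is_derive.
have h1 : is_derive (0 : R) (1 : R) (fun t : R => soft d (s + t *: basis3 i)) (co i s / soft d s).
  by apply: is_derive_line; rewrite scale0r addr0; exact: is_derive_soft.
have h2 := @is_deriveN R R R _ 0 1 _ h1.
have h3 := @is_derive1_comp _ expR (fun t : R => - soft d (s + t *: basis3 i)) 0 _ _ (is_derive_expR _) h2.
by move/is_derive_eq: h3; apply; rewrite scale0r addr0 mulrC.
Qed.

Lemma co_le_soft i (s : R3 R) : `|co i s| <= soft d s.
Proof.
have r0 := soft_gt0 d0 s.
rewrite -ler_sqr ?nnegrE ?(ltW r0)// real_normK ?num_real// soft_sq//.
by apply: le_trans (co_sq_le i s) _; rewrite lerDr sqr_ge0.
Qed.

Lemma dsoft_le1 i (s : R3 R) : `|co i s / soft d s| <= 1.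
Proof.
have r0 := soft_gt0 d0 s.
by rewrite normrM normfV [`|soft d s|]gtr0_norm// ler_pdivrMr// mul1r co_le_soft.
Qed.

(** Along each axis [soft] is 1-Lipschitz. The estimate lets [wexp] itself dominate its own small
    translates, as difference quotients require. *)
Lemma wexp_line i (s : R3 R) (t : R) : wexp (s + t *: basis3 i) <= expR `|t| * wexp s.
Proof.
rewrite /wexp -expRD ler_expR.
have := line_lipschitz (is_derive_soft d0 i) (dsoft_le1 i) s t.
by rewrite mul1r distrC => /(le_trans (ler_norm _)) h; lra.
Qed.

Lemma wexp_le1 (s : R3 R) : wexp s <= 1.
Proof. by rewrite /wexp expR_le1 oppr_le0 ltW// soft_gt0. Qed.

Lemma integrable_wexp : integrable3 wexp.
Proof.
(* [soft] dominates each |coordinate|, hence the mean of the three; the rate 1/3 makes the majorant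
   of [wexp] a product of one-variable functions. *)
pose g (t : R) := expR (- 3^-1 * `|t|).
have g0 t : 0 <= g t by exact: expR_ge0.
have mg : measurable_fun setT (g : measurableTypeR R -> R).
  by apply: measurableT_comp => //; apply: measurable_funM.
have gl := integral_exp_abs_lty (ltac:(by rewrite invr_gt0) : 0 < 3^-1 :> R).
have mG : measurable3 (fun x => g x.1.1 * g x.1.2 * g x.2).
  have m1 := measurableT_comp mg (measurableT_comp measurable_fst measurable_fst : measurable_fun setT (fun x : mR3 R => x.1.1)).
  have m2 := measurableT_comp mg (measurableT_comp measurable_snd measurable_fst : measurable_fun setT (fun x : mR3 R => x.1.2)).
  have m3 := measurableT_comp mg (measurable_snd : measurable_fun setT (fun x : mR3 R => x.2)).
  by apply: measurable3M m3; exact: measurable3M.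
have iG : integrable3 (fun x => g x.1.1 * g x.1.2 * g x.2).
  apply/integrableP; split; first exact/measurable_EFinP.
  under eq_integral do rewrite gee0_abs ?lee_fin ?mulr_ge0//.
  rewrite integral_prod3// !lte_mul_pinfty//.
  - by apply: integral_ge0 => x _; rewrite lee_fin.
  - rewrite ge0_fin_numE//; apply: integral_ge0 => x _; by rewrite lee_fin.
  - by apply: integral_ge0 => x _; rewrite lee_fin.
  - rewrite ge0_fin_numE//; apply: integral_ge0 => x _; by rewrite lee_fin.
apply: le_integrable3 iG _; first exact: measurable_wexp.
move=> x; rewrite gtr0_norm ?wexp_gt0// ger0_norm ?mulr_ge0// /g -!expRD ler_expR.
have h i := co_le_soft i x.
have h1 : `|x.1.1| <= soft d x by have := h 0; rewrite /co.
have h2 : `|x.1.2| <= soft d x by have := h (inord 1); rewrite /co inordK.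
have h3 : `|x.2| <= soft d x by have := h (inord 2); rewrite /co inordK.
lra.
Qed.

Definition wmass : R := \int[leb3]_x wexp x.

Lemma leb3_setT_neq0 : leb3 [set: mR3 R] != 0%E.
Proof.
rewrite gt_eqF//; apply: (@lt_le_trans _ _ (leb3 (cube 1 : set (mR3 R)))).
  rewrite leb3_box// lebesgue_measure_itv/= lte_fin ifT; last by lra.
  by rewrite -EFinB -!EFinM lte_fin; lra.
by apply: le_measure; rewrite ?inE//; exact: measurable_cube.
Qed.

Lemma wmassE : (\int[leb3]_x (wexp x)%:E)%E = wmass%:E.
Proof. by rewrite fineK//; apply: integrable_fin_num => //; exact: integrable_wexp. Qed.

Lemma wmass_gt0 : 0 < wmass.
Proof.
rewrite -lte_fin -wmassE; apply: integral_gt0; first exact: measurable_wexp.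
  exact: wexp_gt0.
exact: leb3_setT_neq0.
Qed.

(** By translation invariance every difference quotient of [P] integrates to 0. For steps at most 1
    they are dominated by C e times [wexp], so the integral of the derivative is 0 as well. *)
Lemma integral_derive_eq0 i (P dP : R3 R -> R) (C : R) : measurable3 dP ->
  integrable3 P -> (forall x, is_derive x (basis3 i) P (dP x)) ->
  (forall x, `|dP x| <= C * wexp x) -> \int[leb3]_x dP x = 0.
Proof.
move=> mdP iP Pd dPC; have mP := integrable3_measurable iP.
have C0 : 0 <= C.
  have := le_trans (normr_ge0 _) (dPC 0); rewrite pmulr_lge0//; exact: wexp_gt0.
pose h (n : nat) : R := n.+1%:R^-1.
have h0 n : 0 < h n by rewrite invr_gt0.
have h1 n : h n <= 1 by rewrite invf_le1// ler1n.
pose Q n x := (h n)^-1 * (P (x + h n *: basis3 i) - P x).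
have iQ n : integrable3 (Q n).
  by apply: integrable3Z; apply: integrable3B => //; exact: integrable3_shift.
have Q0 n : \int[leb3]_x Q n x = 0.
  rewrite Rintegral3Z; last by apply: integrable3B => //; exact: integrable3_shift.
  rewrite Rintegral3B//; last exact: integrable3_shift.
  by rewrite Rintegral_shift3// subrr mulr0.
have cv : \int[leb3]_x Q n x @[n --> \oo] --> \int[leb3]_x dP x.
  apply: (@dominated_Rintegral3 _ _ _ (fun x => C * expR 1 * wexp x)) => //.
  - by move=> n; exact: integrable3_measurable.
  - move=> x; apply: (diff_quotient_cvg (Pd x)) => [n|]; first by rewrite gt_eqF.
    exact: cvg_harmonic.
  - by apply: integrable3Z; exact: integrable_wexp.
  - move=> n x; rewrite /Q normrM [`|_^-1|]gtr0_norm ?invr_gt0// mulrC ler_pdivrMr//.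
    apply: (local_line_lipschitz (h0 n) Pd) => t /andP[t0 t1].
    apply: le_trans (dPC _) _; rewrite -mulrA ler_wpM2l//.
    apply: le_trans (wexp_line i x t) _; rewrite ler_wpM2r ?(ltW (wexp_gt0 x))//.
    by rewrite ler_expR ger0_norm// (le_trans t1).
move/cvg_lim : cv => <- //.
by under eq_fun do rewrite Q0; rewrite lim_cst.
Qed.

(* [|grad soft|^2], so that [b^2 slope2 / 4] is the kinetic energy density of the
   square root of the profile [wexp] at scale [1 / b], relative to its mass. *)
Definition slope2 (s : R3 R) : R := sq3 s / soft d s ^+ 2.

Lemma slope2E s : slope2 s = 1 - d ^+ 2 / soft d s ^+ 2.
Proof.
have r0 := soft_gt0 d0 s; rewrite /slope2.
have -> : sq3 s = soft d s ^+ 2 - d ^+ 2 by rewrite soft_sq// addrAC subrr add0r.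
by rewrite mulrBl divff// gt_eqF// exprn_gt0.
Qed.

Lemma slope2_ge0 s : 0 <= slope2 s.
Proof. by rewrite divr_ge0 ?sq3_ge0// sqr_ge0. Qed.

Lemma slope2_le1 s : slope2 s <= 1.
Proof. by rewrite slope2E gerBl divr_ge0 ?sqr_ge0. Qed.

Lemma measurable_softV : measurable3 (fun s => (soft d s)^-1).
Proof.
apply: continuous_measurable3 => x; apply: cvgV; first by rewrite gt_eqF// soft_gt0.
exact: continuous_soft.
Qed.

Lemma measurable_slope2 : measurable3 slope2.
Proof.
apply: measurable3M; first exact: measurable_sq3.
under [X in measurable3 X]eq_fun do rewrite -exprVn.
by apply: measurable3X; exact: measurable_softV.
Qed.

Lemma softV_le s : (soft d s)^-1 <= d^-1.
Proof. by rewrite lef_pV2 ?posrE ?soft_gt0//; exact: soft_ge. Qed.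

(* The partial derivatives of the field [s / soft s * wexp s], whose divergence
   integrates to 0; this links the kinetic and the Coulomb energy of the profile. *)
Let dradial i (s : R3 R) : R :=
  ((soft d s)^-1 - co i s ^+ 2 / soft d s ^+ 3 - co i s ^+ 2 / soft d s ^+ 2) * wexp s.

Let is_derive_radial i s :
  is_derive s (basis3 i) (fun s => co i s / soft d s * wexp s) (dradial i s).
Proof.
have r0 : soft d s != 0 by rewrite gt_eqF// soft_gt0.
have h1 := is_derive_inv3 r0 (is_derive_soft d0 i s).
have h2 := is_derive_mul3 (is_derive_co i s) h1.
have h3 := is_derive_mul3 h2 (is_derive_wexp i s).
by move/is_derive_eq: h3; apply; rewrite /dradial; field.
Qed.

Let measurable_dradial i : measurable3 (dradial i).
Proof.
have mr := measurable_softV; have mc := measurable3X 2 (measurable_co (R := R) i).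
apply: measurable3M; last exact: measurable_wexp.
have mrn n : measurable3 (fun s => (soft d s ^+ n)^-1).
  by under [X in measurable3 X]eq_fun do rewrite -exprVn; exact: measurable3X.
apply: measurable3B; last exact: measurable3M.
by apply: measurable3B => //; exact: measurable3M.
Qed.

Let dradial_le i s : `|dradial i s| <= (d^-1 + 1) * wexp s.
Proof.
rewrite normrM [`|wexp s|]gtr0_norm ?wexp_gt0//.
apply: ler_wpM2r; first exact/ltW/wexp_gt0.
have r0 := soft_gt0 d0 s; set q := co i s ^+ 2 / soft d s ^+ 2.
have q0 : 0 <= q by rewrite divr_ge0 ?sqr_ge0.
have q1 : q <= 1.
  rewrite /q -expr_div_n -real_normK ?num_real// expr_le1//; exact: dsoft_le1.
have -> : co i s ^+ 2 / soft d s ^+ 3 = q * (soft d s)^-1.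
  by rewrite /q; field; rewrite gt_eqF.
have rV : 0 <= (soft d s)^-1 by rewrite invr_ge0 ltW.
have qr : q * (soft d s)^-1 <= (soft d s)^-1 by rewrite ler_piMl.
have qr0 : 0 <= q * (soft d s)^-1 by rewrite mulr_ge0.
by have := softV_le s => rd; rewrite ler_norml; lra.
Qed.

Let integrable_dradial i : integrable3 (dradial i).
Proof.
apply: le_integrable3 (integrable3Z (d^-1 + 1) integrable_wexp) _ => // s.
exact: le_trans (dradial_le i s) (ler_norm _).
Qed.

Let integral_dradial i : \int[leb3]_s dradial i s = 0.
Proof.
have iP : integrable3 (fun s => co i s / soft d s * wexp s).
  apply: integrable3_bounded integrable_wexp _; last exact: dsoft_le1.
  by apply: measurable3M; [exact: measurable_co|exact: measurable_softV].
exact: (integral_derive_eq0 (measurable_dradial i) iP (is_derive_radial i) (dradial_le i)).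
Qed.

Lemma integrable_slope2 : integrable3 (fun s => slope2 s * wexp s).
Proof.
apply: (integrable3_bounded (C := 1) measurable_slope2 integrable_wexp) => s.
by rewrite ger0_norm ?slope2_ge0// slope2_le1.
Qed.

Lemma integrable_softV : integrable3 (fun s => (soft d s)^-1 * wexp s).
Proof.
apply: (integrable3_bounded (C := d^-1) measurable_softV integrable_wexp) => s.
by rewrite ger0_norm ?softV_le// invr_ge0 ltW// soft_gt0.
Qed.

(** The field s / soft has divergence 3/r - |s|^2 / r^3 = 2/r + d^2 / r^3 with r = soft, while the
    gradient of [wexp] contributes -slope2 times [wexp], which is moved to the other side. *)
Let radial_identity s : (2 / soft d s + d ^+ 2 / soft d s ^+ 3) * wexp s =
  \sum_(i < 3) dradial i s + slope2 s * wexp s.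
Proof.
have r0 : soft d s != 0 by rewrite gt_eqF// soft_gt0.
have dE : d ^+ 2 = soft d s ^+ 2 - sq3 s by rewrite soft_sq// addrK.
rewrite dE /slope2 /dradial -mulr_suml -mulrDl; congr (_ * _).
rewrite !sumrB -!mulr_suml -/(sq3 s) sumr_const card_ord.
by rewrite -[_ *+ 3]mulr_natl; field.
Qed.

Lemma integrable_radial :
  integrable3 (fun s => (2 / soft d s + d ^+ 2 / soft d s ^+ 3) * wexp s).
Proof.
under [X in integrable3 X]eq_fun do rewrite radial_identity.
by apply: integrable3D; [exact: integrable3_sum|exact: integrable_slope2].
Qed.

Lemma integral_radial_identity :
  \int[leb3]_s ((2 / soft d s + d ^+ 2 / soft d s ^+ 3) * wexp s) =
  \int[leb3]_s (slope2 s * wexp s).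
Proof.
under eq_Rintegral do rewrite radial_identity.
rewrite Rintegral3D//; [|exact: integrable3_sum|exact: integrable_slope2].
rewrite Rintegral3_sum// big1 ?add0r//.
Qed.

(** The mean of [slope2] under the normalized profile, that is, four times its kinetic energy. It
    measures the loss due to smoothing and tends to 1 as [d] tends to 0. *)
Definition tau : R := (\int[leb3]_s (slope2 s * wexp s)) / wmass.

Lemma tau_le1 : tau <= 1.
Proof.
rewrite /tau ler_pdivrMr ?wmass_gt0// mul1r /wmass.
apply: le_Rintegral3; [exact: integrable_slope2|exact: integrable_wexp|] => s.
by rewrite ler_piMl ?slope2_le1// ltW// wexp_gt0.
Qed.

Lemma tau_ge0 : 0 <= tau.
Proof.
rewrite /tau divr_ge0 ?(ltW wmass_gt0)//; apply: Rintegral_ge0 => s _.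
by rewrite mulr_ge0 ?slope2_ge0// ltW// wexp_gt0.
Qed.

(** Let I and J be the integrals of [slope2] and 1/soft against [wexp]. The virial identity gives 2
    J <= I <= wmass, and soft >= d gives slope2 >= 1 - d / soft; hence I >= wmass - d J >= (1 - d/2)
    wmass. *)
Lemma tau_ge : 1 - d / 2 <= tau.
Proof.
have h1 : 2 * \int[leb3]_s ((soft d s)^-1 * wexp s) <= \int[leb3]_s (slope2 s * wexp s).
  rewrite -integral_radial_identity -Rintegral3Z; last exact: integrable_softV.
  apply: le_Rintegral3; [exact: integrable3Z integrable_softV|exact: integrable_radial|].
  move=> s; rewrite mulrA ler_wpM2r ?(ltW (wexp_gt0 s))// lerDl.
  by rewrite divr_ge0 ?sqr_ge0// exprn_ge0// ltW// soft_gt0.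
have h2 : wmass - d * \int[leb3]_s ((soft d s)^-1 * wexp s) <=
    \int[leb3]_s (slope2 s * wexp s).
  rewrite /wmass -Rintegral3Z; last exact: integrable_softV.
  rewrite -Rintegral3B; [|exact: integrable_wexp|exact: integrable3Z integrable_softV].
  apply: le_Rintegral3; [|exact: integrable_slope2|].
    by apply: integrable3B; [exact: integrable_wexp|exact: integrable3Z integrable_softV].
  move=> s; rewrite mulrA -[X in X - _]mul1r -mulrBl ler_wpM2r ?(ltW (wexp_gt0 s))//.
  rewrite slope2E lerD2l lerN2 expr2 expr2 -mulrA ler_wpM2l ?(ltW d0)//.
  have r0 := soft_gt0 d0 s.
  by rewrite ler_pdivrMr ?mulr_gt0// mulrA mulVf ?gt_eqF// mul1r soft_ge.
have h3 : \int[leb3]_s (slope2 s * wexp s) <= wmass.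
  by have := tau_le1; rewrite /tau ler_pdivrMr ?wmass_gt0// mul1r.
rewrite /tau ler_pdivlMr ?wmass_gt0//.
have := ler_wpM2l (ltW d0) (le_trans h1 h3); lra.
Qed.

(** With a = |s| and r = soft, the difference of the two sides is (r - a)^2 (2 r + a) / (a r^3); at
    s = 0 the right side is +oo. This passes from the virial identity of the smoothed profile to the
    true Coulomb kernel. *)
Lemma slope_le_invr (s : R3 R) :
  ((2 / soft d s + d ^+ 2 / soft d s ^+ 3)%:E <= 2%:E * ((enorm s)%:E)^-1)%E.
Proof.
have r0 := soft_gt0 d0 s.
have n0 : 0 <= enorm s by exact: sqrtr_ge0.
have [e0|en0] := eqVneq (enorm s) 0.
  by rewrite e0 inve0 gt0_muley ?lte_fin// leey.
have e0 : 0 < enorm s by rewrite lt_def en0.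
rewrite inver (negbTE en0) -EFinM lee_fin.
have dE : d ^+ 2 = soft d s ^+ 2 - enorm s ^+ 2.
  by rewrite soft_sq// enormE sqr_sqrtr ?sq3_ge0// addrK.
rewrite dE -subr_ge0.
set r := soft d s in r0 *; set a := enorm s in e0 en0 *.
have -> : 2 / a - (2 / r + (r ^+ 2 - a ^+ 2) / r ^+ 3) =
  (r - a) ^+ 2 * (2 * r + a) / (a * r ^+ 3) by field; rewrite en0 gt_eqF.
have r1 := ltW r0; have e1 := ltW e0.
by apply: divr_ge0; apply: mulr_ge0; rewrite ?sqr_ge0 ?exprn_ge0 ?addr_ge0 ?mulr_ge0.
Qed.

(** The virial identity divided by 2 wmass, followed by [slope_le_invr] under the integral. A lower
    bound of the attraction is what an upper bound of the energy calls for. *)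
Lemma tau_le_potential :
  ((tau / 2)%:E <= \int[leb3]_s ((wexp s / wmass)%:E * ((enorm s)%:E)^-1))%E.
Proof.
have W0 := wmass_gt0.
have -> : ((tau / 2)%:E = \int[leb3]_s
   ((2 * wmass)^-1 * ((2 / soft d s + d ^+ 2 / soft d s ^+ 3) * wexp s))%:E)%E.
  rewrite -[RHS]fineK; last first.
    apply: integrable_fin_num => //; exact: (integrable3Z _ integrable_radial).
  rewrite -/(Rintegral _ _ _) Rintegral3Z; last exact: integrable_radial.
  rewrite integral_radial_identity /tau; congr EFin.
  by field; rewrite gt_eqF.
apply: ge0_le_integral => //.
- move=> s _; rewrite lee_fin; have r0 := soft_gt0 d0 s; have w0 := wexp_gt0 s.
  rewrite mulr_ge0 ?invr_ge0 ?mulr_ge0 ?(ltW w0) ?(ltW W0)//.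
  by rewrite addr_ge0 ?divr_ge0 ?sqr_ge0 ?exprn_ge0 ?(ltW r0).
- by apply/measurable_EFinP; apply: integrable3_measurable; exact: (integrable3Z _ integrable_radial).
- apply: emeasurable_funM.
    apply/measurable_EFinP; apply: (measurable3M measurable_wexp); exact: measurable3_cst.
  have := measurable_enormV (0 : R3 R); by under eq_fun do rewrite subr0.
move=> s _; have w0 := wexp_gt0 s.
have -> : (2 * wmass)^-1 * ((2 / soft d s + d ^+ 2 / soft d s ^+ 3) * wexp s) =
  (wexp s / wmass * 2^-1) * (2 / soft d s + d ^+ 2 / soft d s ^+ 3).
  by field; rewrite !gt_eqF ?soft_gt0.
rewrite EFinM EFinM -muleA lee_wpmul2l ?lee_fin ?divr_ge0 ?(ltW w0) ?(ltW W0)//.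
rewrite lee_pdivrMl// ; exact: slope_le_invr.
Qed.

End Profile.

(** * Kinetic energy of a probability given by a density *)

Section DensityProbability.
Context {R : realType}.

Lemma ae_leb3_impl (P Q : R3 R -> Prop) : {ae leb3, forall x, P x} ->
  (forall x, P x -> Q x) -> {ae leb3, forall x, Q x}.
Proof.
move=> [N [mN N0 sN]] PQ; exists N; split => // x /= nQ.
by apply: sN => /= /PQ.
Qed.

Lemma weak_partial_ae i (u v g : R3 R -> R) : measurable3 u -> measurable3 v ->
  {ae leb3, forall x, u x = v x} -> weak_partial i u g -> weak_partial i v g.
Proof.
move=> mu mv uv wu phi tphi; rewrite -wu//; congr fine.
have mD := test_measurable (test_derive i tphi).
apply: ae_eq_integral => //.
- by apply/measurable_EFinP; exact: (measurable3M mv mD).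
- by apply/measurable_EFinP; exact: (measurable3M mu mD).
by apply: ae_leb3_impl uv _ => x -> _.
Qed.

(** A translation moves the difference quotient from [phi] to [u]. On one side the limit is the
    pairing of [u] with the derivative of [phi]; on the other, dominated convergence with the
    Lipschitz bound [L] yields minus the pairing of [g] with [phi]. *)
Lemma weak_partial_C1 i (u g : R3 R -> R) (L : R) : L2 u -> measurable3 g ->
  (forall x, is_derive x (basis3 i) u (g x)) -> (forall x, `|g x| <= L) ->
  weak_partial i u g.
Proof.
move=> u2 mg ud gL phi tphi.
have iphi := test_integrable tphi; have phi2 := test_L2 tphi.
pose h (n : nat) : R := - n.+1%:R^-1.
have h0 n : h n != 0 by rewrite oppr_eq0 invr_eq0.
have hcv : h n @[n --> \oo] --> (0 : R) by rewrite -oppr0; apply: cvgN; exact: cvg_harmonic.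
pose F (t : R) := \int[leb3]_x (u x * phi (x + t *: basis3 i)).
have Fd : is_derive (0 : R) (1 : R) F (\int[leb3]_x (u x * 'D_(basis3 i) phi x)).
  have := @is_derive_pairing _ i u phi 1 0 u2 tphi; rewrite ltrN10 ltr01 => /(_ isT).
  by under eq_Rintegral do rewrite scale0r addr0.
have cvF : (h n)^-1 * (F (0 + h n *: 1) - F 0) @[n --> \oo] -->
    \int[leb3]_x (u x * 'D_(basis3 i) phi x).
  exact: (@diff_quotient_cvg).
pose Q n x := (h n)^-1 * (u (x - h n *: basis3 i) - u x) * phi x.
have us2 n : L2 (fun x => u (x - h n *: basis3 i)) by exact: L2_shift.
have FQ n : (h n)^-1 * (F (0 + h n *: 1) - F 0) = \int[leb3]_x Q n x.
  rewrite /F /Q add0r scale0r [_ *: 1]mulr1.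
  have i1 := L2_mul (us2 n) phi2; have i2 := L2_mul u2 phi2.
  under [RHS]eq_Rintegral do rewrite -mulrA mulrBl.
  rewrite Rintegral3Z; last exact: integrable3B.
  rewrite Rintegral3B//; congr (_ * (_ - _)).
    rewrite -[RHS](@Rintegral_shift3 _ _ (h n *: basis3 i)).
      by apply: eq_Rintegral => x _; rewrite addrK.
    exact: integrable3_measurable.
  by apply: eq_Rintegral => x _; rewrite addr0.
have cvQ : \int[leb3]_x Q n x @[n --> \oo] --> \int[leb3]_x (- g x * phi x).
  apply: (@dominated_Rintegral3 _ _ _ (fun x => L * `|phi x|)).
  - move=> n; apply: measurable3M (test_measurable tphi).
    apply: measurable3M; first exact: measurable3_cst.
    by apply: measurable3B; exact: L2_measurable.
  - apply: measurable3M (test_measurable tphi).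
    by under [X in measurable3 X]eq_fun do rewrite -mulN1r; apply: measurable3M => //; exact: measurable3_cst.
  - move=> x; apply: cvgM; last exact: cvg_cst.
    have h0' n : - h n != 0 by rewrite oppr_eq0.
    have hcv' : - h n @[n --> \oo] --> (0 : R) by rewrite -oppr0; apply: cvgN.
    under eq_fun do rewrite -[(h _)^-1]opprK -invrN mulNr -(scaleNr _ (basis3 i)).
    have dq := diff_quotient_cvg (ud x) h0' hcv'.
    exact: cvgN dq.
  - by apply: integrable3Z; exact: integrable3_norm.
  - move=> n x; rewrite /Q normrM ler_wpM2r// normrM normfV.
    rewrite ler_pdivrMl ?normr_gt0// -scaleNr mulrC -[in leRHS]normrN.
    exact: line_lipschitz ud gL x (- h n).
have <- : \int[leb3]_x (- g x * phi x) = \int[leb3]_x (u x * 'D_(basis3 i) phi x).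
  move: cvF; under eq_fun do rewrite FQ.
  by move/cvg_lim => <- //; apply/esym; exact: (cvg_lim _ cvQ).
under eq_Rintegral do rewrite mulNr -mulN1r.
rewrite Rintegral3Z ?mulN1r//.
by apply: integrable3_bounded gL.
Qed.

(* The proofs are arguments so that the measure structures below can be inferred. *)
Definition density_prob (f : R3 R -> R) (mf : measurable3 f) (f0 : forall x, 0 <= f x)
  (f1 : (\int[leb3]_x (f x)%:E = 1)%E) (A : set (mR3 R)) : \bar R :=
  (\int[leb3]_(x in A) (f x)%:E)%E.

Variables (f : R3 R -> R) (mf : measurable3 f) (f0 : forall x, 0 <= f x)
  (f1 : (\int[leb3]_x (f x)%:E = 1)%E).
Local Notation nu := (density_prob mf f0 f1).

Let nu0 : nu set0 = 0%E.
Proof. exact: integral_set0. Qed.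

Let nu_ge0 A : (0 <= nu A)%E.
Proof. by apply: integral_ge0 => x _; rewrite lee_fin. Qed.

Let nu_sigma : semi_sigma_additive nu.
Proof.
apply: semi_sigma_additive_nng_induced; first exact/measurable_EFinP.
by move=> x; rewrite lee_fin.
Qed.

HB.instance Definition _ := isMeasure.Build _ _ _ nu nu0 nu_ge0 nu_sigma.

HB.instance Definition _ := @Measure_isProbability.Build _ _ R nu f1.

Lemma density_dominates : (nu : probability (mR3 R) R) `<< leb3.
Proof.
apply/null_content_dominatesP => A mA A0; rewrite /= /density_prob.
by apply: null_set_integral => //; apply: measurable_funTS; exact/measurable_EFinP.
Qed.

Let Ef0 x : (0 <= (f x)%:E)%E. Proof. by rewrite lee_fin. Qed.
Let mEf : measurable_fun setT (EFin \o f : mR3 R -> \bar R).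
Proof. exact/measurable_EFinP. Qed.

Lemma integrable_density : integrable3 f.
Proof.
apply/integrableP; split => //.
by under eq_integral do rewrite gee0_abs//; rewrite f1 ltry.
Qed.

Let u := sqrt_density (nu : probability (mR3 R) R).

Let mu2 : measurable3 (fun x => u x ^+ 2).
Proof. by apply: measurable3X; exact: measurable_sqrt_density density_dominates. Qed.

Let u2E (A : set (mR3 R)) : measurable A ->
  (\int[leb3]_(x in A) (u x ^+ 2)%:E = \int[leb3]_(x in A) (f x)%:E)%E.
Proof.
move=> mA; rewrite -[RHS]/(nu A).
rewrite integral_mkcond.
transitivity (\int[leb3]_x ((\1_A x)%:E * (u x ^+ 2)%:E))%E.
  apply: eq_integral => x _; rewrite /patch indicE.
  by case: ifP => _; rewrite ?mul1e ?mul0e.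
rewrite (ge0_integral_sqrt_density density_dominates)//.
  by rewrite integral_indic// setIT.
by apply/measurable_EFinP; exact: measurable_indic.
Qed.

(** The square of [u] and [f] have the same integral over every measurable set, hence agree almost
    everywhere. *)
Lemma sqrt_density_prob : {ae leb3, forall x, u x = Num.sqrt (f x)}.
Proof.
have : ae_eq leb3 setT (EFin \o f : mR3 R -> \bar R) (fun x => (u x ^+ 2)%:E).
  apply: integral_ae_eq => //; [exact: integrable_density|exact/measurable_EFinP|].
  by move=> A _ mA; rewrite u2E.
move/ae_leb3_impl; apply => x /= /(_ I) [->]; rewrite sqrtr_sqr ger0_norm//.
exact: sqrtr_ge0.
Qed.

Lemma L2_sqrt_density_prob : L2 u.
Proof.
apply/L2P; split; first exact: measurable_sqrt_density density_dominates.
apply/integrableP; split; first exact/measurable_EFinP.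
under eq_integral do rewrite gee0_abs ?lee_fin ?sqr_ge0//.
by rewrite u2E// f1 ltry.
Qed.

Lemma measurable_sqrt3 (p : R3 R -> R) : measurable3 p -> measurable3 (fun x => Num.sqrt (p x)).
Proof.
move=> mp; have ms : measurable_fun setT (Num.sqrt : R -> R).
  by apply: continuous_measurable_fun; exact: sqrt_continuous.
exact: (measurableT_comp ms mp).
Qed.

Lemma L2_sqrt : L2 (fun x => Num.sqrt (f x)).
Proof.
apply/L2P; split; first exact: measurable_sqrt3.
by under [X in integrable3 X]eq_fun do rewrite sqr_sqrtr//; exact: integrable_density.
Qed.

(** [kinetic] uses a chosen weak gradient of a chosen density. The latter is [f] up to a null set,
    so [g] is also a weak gradient of its root, and uniqueness identifies [g] with the chosen one
    almost everywhere. *)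
Lemma kinetic_density_prob (g : 'I_3 -> R3 R -> R) : (forall i, L2 (g i)) ->
  (forall i, weak_partial i (fun x => Num.sqrt (f x)) (g i)) ->
  kinetic (nu : probability (mR3 R) R) = (\int[leb3]_x (\sum_(i < 3) g i x ^+ 2)%:E)%E.
Proof.
move=> g2 wg; have mu := L2_measurable L2_sqrt_density_prob.
have wu i : weak_partial i u (g i).
  apply: weak_partial_ae (wg i) => //; first exact: measurable_sqrt3.
  by apply: ae_leb3_impl sqrt_density_prob _ => x ->.
rewrite /kinetic asboolT; last first.
  split; first exact: density_dominates.
  split; first exact: L2_sqrt_density_prob.
  by move=> i; exists (g i); [exact: g2|exact: wu].
have wG i : L2 (weak_grad u i) /\ weak_partial i u (weak_grad u i).
  by apply: (@xgetPex _ (cst 0) [set g | L2 g /\ weak_partial i u g]); exists (g i).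
have ae i : {ae leb3, forall x, weak_grad u i x = g i x}.
  have [G2 wGi] := wG i; exact: weak_partial_unique wGi (wu i).
under eq_integral do rewrite -sumEFin.
under [RHS]eq_integral do rewrite -sumEFin.
have mE (h : R3 R -> R) : L2 h -> measurable_fun setT (fun x : mR3 R => (h x ^+ 2)%:E).
  by move=> h2; apply/measurable_EFinP; apply: measurable3X; exact: L2_measurable.
rewrite !ge0_integral_sum//; last 4 first.
- by move=> i; exact: mE (g2 i).
- by move=> i x _; rewrite lee_fin sqr_ge0.
- by move=> i; exact: mE (wG i).1.
- by move=> i x _; rewrite lee_fin sqr_ge0.
apply: eq_bigr => i _; apply: ae_eq_integral => //.
- exact: mE (wG i).1.
- exact: mE (g2 i).
by apply: ae_leb3_impl (ae i) _ => x -> _.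
Qed.

Lemma integral_density_prob (h : mR3 R -> \bar R) : measurable_fun setT h ->
  (forall x, 0 <= h x)%E ->
  (\int[(nu : probability (mR3 R) R)]_x h x = \int[leb3]_x (h x * (f x)%:E))%E.
Proof.
move=> mh h0; rewrite -(ge0_integral_sqrt_density density_dominates)//.
apply: ae_eq_integral => //.
- by apply: emeasurable_funM => //; exact/measurable_EFinP.
- by apply: emeasurable_funM => //; exact/measurable_EFinP.
by apply: ae_leb3_impl sqrt_density_prob _ => x xE _; rewrite -/u xE sqr_sqrtr.
Qed.

End DensityProbability.

Section PointMass.
Context {R : realType}.

Lemma le_integral_point (mu : {measure set (mR3 R) -> \bar R}) (X : R3 R)
    (K : mR3 R -> \bar R) (c : R) : measurable_fun setT K ->
  (forall y, 0 <= K y)%E -> 0 <= c -> (c%:E <= K X)%E ->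
  (c%:E * mu [set X] <= \int[mu]_y K y)%E.
Proof.
move=> mK K0 c0 cK; have mX := measurable_point X.
apply: (@le_trans _ _ (\int[mu]_(y in [set X]) K y)%E); last first.
  exact: (ge0_subset_integral mu mX measurableT mK (fun y _ => K0 y) (@subsetT _ _)).
rewrite -(integral_cst mu mX); apply: ge0_le_integral => //.
- exact: (measurable_funTS mK).
- by move=> y ->.
Qed.

End PointMass.

(** * Smearing a probability at a position-dependent scale *)

Section Mixture.
Context {R : realType}.
Variables (d : R) (mu : probability (mR3 R) R) (b : R3 R -> R) (B : R).
Hypotheses (d0 : 0 < d) (mb : measurable3 b) (b0 : forall y, 0 < b y)
  (bB : forall y, b y <= B).
Implicit Types (x y : R3 R) (i : 'I_3).

Let W := wmass d.
Let w := wexp d.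
Let W0 : 0 < W. Proof. exact: wmass_gt0. Qed.
Let w0 s : 0 < w s. Proof. exact: wexp_gt0. Qed.
Let B0 : 0 < B. Proof. exact: lt_le_trans (b0 0) (bB 0). Qed.

Definition blowup (y x : R3 R) : R3 R := b y *: (x - y).

(* The bump of unit mass at scale [1 / b y] around [y]. *)
Definition kap y x : R := b y ^+ 3 / W * w (blowup y x).

Lemma kap_gt0 y x : 0 < kap y x.
Proof. by rewrite mulr_gt0// divr_gt0// exprn_gt0. Qed.

Lemma kap_le y x : kap y x <= B ^+ 3 / W.
Proof.
have bp : b y ^+ 3 <= B ^+ 3 by rewrite lerXn2r ?nnegrE ?(ltW (b0 y)) ?(ltW B0).
apply: (@le_trans _ _ (b y ^+ 3 / W)).
  by rewrite ler_piMr ?wexp_le1// divr_ge0 ?exprn_ge0// ltW.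
by rewrite ler_wpM2r// invr_ge0 ltW.
Qed.

Lemma measurable_blowup :
  measurable_fun setT (fun z : mR3 R * mR3 R => blowup z.2 z.1 : mR3 R).
Proof.
have mb2 : measurable_fun setT (fun z : mR3 R * mR3 R => b z.2).
  exact: (measurableT_comp mb measurable_snd).
have m1 : measurable_fun setT (fun z : mR3 R * mR3 R => z.1) := measurable_fst.
have m2 : measurable_fun setT (fun z : mR3 R * mR3 R => z.2) := measurable_snd.
have c1 : measurable_fun setT (fun x : mR3 R => x.1.1) :=
  measurableT_comp measurable_fst measurable_fst.
have c2 : measurable_fun setT (fun x : mR3 R => x.1.2) :=
  measurableT_comp measurable_snd measurable_fst.
have c3 : measurable_fun setT (fun x : mR3 R => x.2) := measurable_snd.
apply: measurable_fun_pair; first apply: measurable_fun_pair;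
  apply: measurable_funM => //; apply: measurable_funB.
- exact: (measurableT_comp c1 m1).
- exact: (measurableT_comp c1 m2).
- exact: (measurableT_comp c2 m1).
- exact: (measurableT_comp c2 m2).
- exact: (measurableT_comp c3 m1).
- exact: (measurableT_comp c3 m2).
Qed.

Lemma measurable_blowup_l x : measurable_fun setT (fun y : mR3 R => blowup y x : mR3 R).
Proof. exact: (measurableT_comp measurable_blowup (measurable_pair1 x)). Qed.

Lemma measurable_kap : measurable_fun setT (fun z : mR3 R * mR3 R => kap z.2 z.1).
Proof.
apply: measurable_funM; last exact: (measurableT_comp (measurable_wexp d) measurable_blowup).
apply: measurable_funM => //; apply: measurable_funX.
exact: (measurableT_comp mb measurable_snd).
Qed.

Lemma measurable_kap_l x : measurable3 (fun y => kap y x).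
Proof. exact: (measurableT_comp measurable_kap (measurable_pair1 x)). Qed.

(** The factor [b y ^+ 3] in [kap] is the Jacobian of the dilation, so every bump becomes the
    normalized profile in its blown-up coordinate. *)
Lemma integral_blowup y (F : mR3 R -> \bar R) : measurable_fun setT F ->
  (forall s, 0 <= F s)%E ->
  (\int[leb3]_x (F (blowup y x) * (kap y x)%:E) = \int[leb3]_s (F s * (w s / W)%:E))%E.
Proof.
move=> mF F0; rewrite -[RHS](@ge0_integral_affine3 _ (b y) (- (b y *: y)))//; last 2 first.
- apply: emeasurable_funM => //; apply/measurable_EFinP.
  by apply: (measurable3M (measurable_wexp d)); exact: measurable3_cst.
- by move=> s; rewrite mule_ge0// lee_fin divr_ge0// ltW.
rewrite -ge0_integralZl//; last 3 first.
- apply: (measurableT_comp (f := fun s => F s * (w s / W)%:E)%E); last exact: measurable_affine3.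
  apply: emeasurable_funM => //; apply/measurable_EFinP.
  by apply: (measurable3M (measurable_wexp d)); exact: measurable3_cst.
- by move=> s _; rewrite mule_ge0// lee_fin divr_ge0// ltW.
- by rewrite lee_fin exprn_ge0// ltW.
apply: eq_integral => x _; rewrite -scalerBr -/(blowup y x) muleCA -EFinM.
by congr (_ * _%:E)%E; rewrite /kap; field; rewrite gt_eqF.
Qed.

Lemma integral_kap y : (\int[leb3]_x (kap y x)%:E = 1)%E.
Proof.
transitivity (\int[leb3]_x (cst 1 (blowup y x) * (kap y x)%:E))%E.
  by apply: eq_integral => x _; rewrite mul1e.
rewrite integral_blowup//.
transitivity (\int[leb3]_s ((W^-1)%:E * (w s)%:E))%E.
  by apply: eq_integral => s _; rewrite mul1e -EFinM mulrC.
rewrite ge0_integralZl//.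
- by rewrite wmassE// -EFinM mulVf// gt_eqF.
- by apply/measurable_EFinP; exact: measurable_wexp.
- by move=> s _; rewrite lee_fin ltW.
- by rewrite lee_fin invr_ge0 ltW.
Qed.

Definition mixture x : R := \int[mu]_y kap y x.

Lemma integrable_kap x : mu.-integrable setT (fun y => (kap y x)%:E).
Proof.
apply: (@integrable_bounded_rho _ mu _ (B ^+ 3 / W)); first exact: measurable_kap_l.
by move=> y; rewrite gtr0_norm ?kap_gt0// kap_le.
Qed.

Lemma mixtureE x : ((mixture x)%:E = \int[mu]_y (kap y x)%:E)%E.
Proof. by rewrite fineK//; apply: integrable_fin_num => //; exact: integrable_kap. Qed.

Lemma mixture_gt0 x : 0 < mixture x.
Proof.
rewrite -lte_fin mixtureE; apply: integral_gt0; first exact: measurable_kap_l.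
  by move=> y; exact: kap_gt0.
by rewrite [X in X != _](_ : _ = 1%E) ?oner_eq0//; exact: probability_setT.
Qed.

Lemma mixture_ge0 x : 0 <= mixture x. Proof. exact/ltW/mixture_gt0. Qed.

Lemma mixture_le x : mixture x <= B ^+ 3 / W.
Proof.
rewrite -lee_fin mixtureE.
apply: (@le_trans _ _ (\int[mu]_y (B ^+ 3 / W)%:E)%E).
  apply: ge0_le_integral => //.
  - by move=> y _; rewrite lee_fin ltW// kap_gt0.
  - by apply/measurable_EFinP; exact: measurable_kap_l.
  - by move=> y _; rewrite lee_fin kap_le.
rewrite integral_cst//= [X in (_ * X)%E](_ : _ = 1%E) ?mule1//; exact: probability_setT.
Qed.

Lemma measurable_mixture : measurable3 mixture.
Proof.
apply/measurable_EFinP; rewrite (_ : EFin \o mixture = fun x => \int[mu]_y (kap y x)%:E)%E.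
  apply: (@measurable_fun_fubini_tonelli_F _ _ _ _ _ mu (fun z => (kap z.2 z.1)%:E)).
    by apply/measurable_EFinP; exact: measurable_kap.
  by move=> z; rewrite lee_fin ltW// kap_gt0.
by apply/funext => x; rewrite /= mixtureE.
Qed.

Lemma integralM_mixture (h : mR3 R -> \bar R) : measurable_fun setT h ->
  (forall x, 0 <= h x)%E ->
  (\int[leb3]_x (h x * (mixture x)%:E) = \int[mu]_y \int[leb3]_x (h x * (kap y x)%:E))%E.
Proof.
move=> mh h0.
transitivity (\int[leb3]_x \int[mu]_y (h x * (kap y x)%:E))%E.
  apply: eq_integral => x _; rewrite mixtureE ge0_integralZl//.
    by apply/measurable_EFinP; exact: measurable_kap_l.
  by move=> y _; rewrite lee_fin ltW// kap_gt0.
apply: (@fubini_tonelli _ _ _ _ _ leb3 mu (fun z => h z.1 * (kap z.2 z.1)%:E)%E).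
  apply: emeasurable_funM; first exact: (measurableT_comp mh measurable_fst).
  by apply/measurable_EFinP; exact: measurable_kap.
by move=> z; rewrite mule_ge0// lee_fin ltW// kap_gt0.
Qed.

Lemma integral_mixture : (\int[leb3]_x (mixture x)%:E = 1)%E.
Proof.
transitivity (\int[leb3]_x (cst 1 x * (mixture x)%:E))%E.
  by apply: eq_integral => x _; rewrite mul1e.
rewrite integralM_mixture//.
transitivity (\int[mu]_y 1)%E.
  apply: eq_integral => y _; apply: etrans (integral_kap y).
  by apply: eq_integral => x _; rewrite mul1e.
by rewrite integral_cst// mul1e; exact: probability_setT.
Qed.

Definition dkap i y x : R :=
  - (b y * (co i (blowup y x) / soft d (blowup y x)) * kap y x).

Lemma is_derive_kap i y x : is_derive x (basis3 i) (kap y) (dkap i y x).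
Proof.
apply: line_is_derive.
set s := blowup y x.
have hs : is_derive (b y * 0) (1 : R) (fun t : R => w (s + t *: basis3 i)) (- (co i s / soft d s) * w s).
  by apply: is_derive_line; rewrite mulr0 scale0r addr0; exact: is_derive_wexp.
have hl : is_derive (0 : R) (1 : R) (fun t : R => b y * t) (b y).
  have := is_derive_affine 0 (b y) 0; congr (is_derive _ _ _ _).
  by apply/funext => t; rewrite add0r mulrC.
have hc := @is_derive1_comp _ (fun t : R => w (s + t *: basis3 i)) (fun t : R => b y * t) 0 _ _ hs hl.
have h := @is_deriveZ R R R _ (b y ^+ 3 / W) (0 : R) 1 _ hc.
have := is_derive_eq h; move/(_ (dkap i y x)); rewrite (_ : _ \*: _ = fun t : R => kap y (x + t *: basis3 i)).
  by apply; rewrite /dkap /kap -/s /GRing.scale/=; ring.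
apply/funext => t; rewrite /kap /=; congr (_ * w _).
by rewrite /s /blowup [in RHS]addrAC [in RHS]scalerDr scalerA.
Qed.

Lemma dkap_le i y x : `|dkap i y x| <= b y * kap y x.
Proof.
rewrite /dkap normrN normrM [`|kap y x|]gtr0_norm ?kap_gt0// normrM [`|b y|]gtr0_norm//.
rewrite ler_wpM2r ?(ltW (kap_gt0 y x))// ler_piMr ?(ltW (b0 y))//.
exact: dsoft_le1.
Qed.

Lemma dkap_le_cst i y x : `|dkap i y x| <= B ^+ 4 / W.
Proof.
apply: le_trans (dkap_le i y x) _; rewrite exprS -mulrA.
by rewrite ler_pM ?kap_le// ltW// kap_gt0.
Qed.

Lemma measurable_dkap_l i x : measurable3 (fun y => dkap i y x).
Proof.
have ms : measurable3 (fun s => co i s / soft d s).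
  by apply: measurable3M; [exact: measurable_co|exact: measurable_softV].
apply: (measurable_funN (T := mR3 R)).
apply: measurable3M (measurable_kap_l x); apply: measurable3M => //.
exact: (measurableT_comp ms (measurable_blowup_l x)).
Qed.

Lemma integrable_dkap i x : mu.-integrable setT (fun y => (dkap i y x)%:E).
Proof.
apply: (@integrable_bounded_rho _ mu _ (B ^+ 4 / W)); first exact: measurable_dkap_l.
by move=> y; exact: dkap_le_cst.
Qed.

Definition dmixture i x : R := \int[mu]_y dkap i y x.

Lemma is_derive_mixture i x : is_derive x (basis3 i) mixture (dmixture i x).
Proof.
apply: line_is_derive.
pose f (t : R) (y : mR3 R) := kap y (x + t *: basis3 i).
have fd t y : is_derive t (1 : R) (f ^~ y) (dkap i y (x + t *: basis3 i)).
  by apply: is_derive_line; exact: is_derive_kap.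
have d1 t y : partial1of2 f t y = dkap i y (x + t *: basis3 i).
  by rewrite partial1of2E; have [] := fd t y.
(* The majorant is the constant [B ^+ 4 / W], integrable because [mu] is finite; this is where the
   uniform bound [B] on the inverse scales enters. *)
have cv := @cvg_differentiation_under_integral _ _ _ mu f setT measurableT 0 (-1) 1
  ltac:(by rewrite /= in_itv/= ltrN10 ltr01) (fun t _ => integrable_kap (x + t *: basis3 i))
  (fun t y _ _ => @ex_derive _ _ _ _ _ _ _ (fd t y)) (cst (B ^+ 4 / W))
  (fun=> ltac:(by rewrite divr_ge0 ?exprn_ge0 ?(ltW B0) ?(ltW W0)))
  (finite_measure_integrable_cst mu _ measurableT)
  (fun t y It _ => ltac:(by rewrite d1; exact: dkap_le_cst)).
have E : dmixture i x = \int[mu]_y partial1of2 f 0 y.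
  by apply: eq_Rintegral => y _; rewrite d1 scale0r addr0.
rewrite E; split.
- by apply/cvg_ex; eexists; under eq_fun do rewrite [_ *: 1]mulr1; exact: cv.
- rewrite /derive; under eq_fun do rewrite [_ *: 1]mulr1.
  exact: cvg_lim cv.
Qed.

(** Each bump has logarithmic derivative at most b y <= B, and averaging preserves such a bound. It
    makes the gradient of the root of the mixture bounded and square-integrable. *)
Lemma dmixture_le i x : `|dmixture i x| <= B * mixture x.
Proof.
apply: le_trans (le_normr_Rintegral measurableT (integrable_dkap i x)) _.
rewrite -RintegralZl//; last exact: integrable_kap.
apply: le_Rintegral => //.
- have := integrable_dkap i x; exact: integrable_norm.
- by have := integrableZl measurableT B (integrable_kap x).
- move=> y _; apply: le_trans (dkap_le i y x) _.
  by rewrite ler_wpM2r// ltW// kap_gt0.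
Qed.

(** The Fisher information density |grad kap|^2 / kap of the bump at [y], written without a quotient
    by [kap]. *)
Definition fisher y x : R := b y ^+ 2 * slope2 d (blowup y x) * kap y x.

Lemma fisher_ge0 y x : 0 <= fisher y x.
Proof. by apply: mulr_ge0 (ltW (kap_gt0 y x)); rewrite mulr_ge0 ?sqr_ge0 ?slope2_ge0. Qed.

Lemma fisher_le y x : fisher y x <= B ^+ 5 / W.
Proof.
have h1 : slope2 d (blowup y x) <= 1 by exact: slope2_le1.
have h2 := kap_le y x; have h3 := kap_gt0 y x.
have bp : b y ^+ 2 <= B ^+ 2 by rewrite lerXn2r ?nnegrE ?(ltW (b0 y)) ?(ltW B0).
rewrite /fisher (exprD B 2 3) -mulrA -[leRHS]mulrA ler_pM ?sqr_ge0//.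
  by rewrite mulr_ge0 ?slope2_ge0// ltW.
by apply: le_trans h2; rewrite ler_piMl// ltW.
Qed.

Lemma measurable_fisher : measurable_fun setT (fun z : mR3 R * mR3 R => fisher z.2 z.1).
Proof.
apply: measurable_funM; last exact: measurable_kap.
apply: measurable_funM; last exact: (measurableT_comp (measurable_slope2 d0) measurable_blowup).
by apply: measurable_funX; exact: (measurableT_comp mb measurable_snd).
Qed.

Lemma measurable_fisher_l x : measurable3 (fun y => fisher y x).
Proof. exact: (measurableT_comp measurable_fisher (measurable_pair1 x)). Qed.

Lemma integrable_fisher x : mu.-integrable setT (fun y => (fisher y x)%:E).
Proof.
apply: (@integrable_bounded_rho _ mu _ (B ^+ 5 / W)); first exact: measurable_fisher_l.
by move=> y; rewrite ger0_norm ?fisher_ge0// fisher_le.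
Qed.

Lemma sum_dkap_sq y x : \sum_i dkap i y x ^+ 2 = fisher y x * kap y x.
Proof.
have r0 : soft d (blowup y x) != 0 by rewrite gt_eqF// soft_gt0.
transitivity (\sum_i (b y ^+ 2 * kap y x ^+ 2 / soft d (blowup y x) ^+ 2) *
    co i (blowup y x) ^+ 2).
  by apply: eq_bigr => i _; rewrite /dkap; field.
by rewrite -mulr_sumr -/(sq3 _) /fisher /slope2; field.
Qed.

(* AM-GM under the integral with weights [l = dmixture / mixture]:
   [2 l . dkap <= |l|^2 kap + |dkap|^2 / kap]. *)
Lemma mixture_fisher x :
  \sum_i dmixture i x ^+ 2 <= mixture x * \int[mu]_y fisher y x.
Proof.
have p0 := mixture_gt0 x.
pose l i := dmixture i x / mixture x.
have pt y : \sum_i l i * dkap i y x <= 2^-1 * ((\sum_i l i ^+ 2) * kap y x + fisher y x).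
  have k0 := kap_gt0 y x.
  rewrite -(ler_pM2r k0) -mulrA mulrDl -sum_dkap_sq.
  rewrite -mulrA 2!mulr_suml -big_split/= mulr_sumr; apply: ler_sum => i _.
  by have := sqr_ge0 (l i * kap y x - dkap i y x); rewrite sqrrB => h; lra.
have ild i : mu.-integrable setT (fun y => (l i * dkap i y x)%:E).
  by have := integrableZl measurableT (l i) (integrable_dkap i x).
have iS : mu.-integrable setT (fun y => (\sum_i l i * dkap i y x)%:E).
  under eq_fun do rewrite -sumEFin; exact: integrable_sum.
have iK := integrableZl measurableT (\sum_i l i ^+ 2) (integrable_kap x).
have iR : mu.-integrable setT
    (fun y => ((\sum_i l i ^+ 2) * kap y x + fisher y x)%:E).
  by have := integrableD measurableT iK (integrable_fisher x).
have iR2 : mu.-integrable setT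
    (fun y => (2^-1 * ((\sum_i l i ^+ 2) * kap y x + fisher y x))%:E).
  by have := integrableZl measurableT 2^-1 iR.
have := le_Rintegral measurableT iS iR2 (fun y _ => pt y).
rewrite RintegralZl// RintegralD//; last exact: integrable_fisher.
rewrite RintegralZl//; last exact: integrable_kap.
rewrite -/(mixture x).
have -> : \int[mu]_y (\sum_i l i * dkap i y x) = \sum_i l i * dmixture i x.
  rewrite /Rintegral; under eq_integral do rewrite -sumEFin.
  rewrite integral_sum// -sum_fine; last by move=> i _; exact: integrable_fin_num.
  by apply: eq_bigr => i _; rewrite -/(Rintegral _ _ _) RintegralZl//; exact: integrable_dkap.
have -> : \sum_i l i * dmixture i x = (\sum_i dmixture i x ^+ 2) / mixture x.
  by rewrite mulr_suml; apply: eq_bigr => i _; rewrite /l expr2 mulrAC.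
have -> : \sum_i l i ^+ 2 = (\sum_i dmixture i x ^+ 2) / mixture x ^+ 2.
  by rewrite mulr_suml; apply: eq_bigr => i _; rewrite /l expr_div_n.
set S := \sum_i _; set I := \int[mu]_y _.
have -> : S / mixture x ^+ 2 * mixture x = S / mixture x by field; rewrite gt_eqF.
move=> h; rewrite -ler_pdivrMl// mulrC; lra.
Qed.

Definition smear : probability (mR3 R) R :=
  density_prob measurable_mixture mixture_ge0 integral_mixture.

Let g i x := dmixture i x / (2 * Num.sqrt (mixture x)).

Let sqrt_mixture_gt0 x : 0 < Num.sqrt (mixture x).
Proof. by rewrite sqrtr_gt0 mixture_gt0. Qed.

Let is_derive_sqrt_mixture i x :
  is_derive x (basis3 i) (fun x => Num.sqrt (mixture x)) (g i x).
Proof.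
apply: line_is_derive.
have h1 : is_derive (0 : R) (1 : R) (fun t : R => mixture (x + t *: basis3 i)) (dmixture i x).
  by apply: is_derive_line; rewrite scale0r addr0; exact: is_derive_mixture.
have p0 : 0 < mixture (x + (0 : R) *: basis3 i) by exact: mixture_gt0.
have := @is_derive1_comp _ Num.sqrt _ 0 _ _ (is_derive1_sqrt p0) h1.
by move/is_derive_eq; apply; rewrite scale0r addr0 /g mulrC.
Qed.

Let g_le i x : `|g i x| <= B / 2 * Num.sqrt (mixture x).
Proof.
have s0 := sqrt_mixture_gt0 x.
rewrite /g normrM normfV [`|2 * _|]gtr0_norm ?mulr_gt0// ler_pdivrMr ?mulr_gt0//.
apply: le_trans (dmixture_le i x) _.
rewrite -{1}(sqr_sqrtr (mixture_ge0 x)); lra.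
Qed.

(** A derivative is a pointwise limit of difference quotients, here of the measurable root of the
    mixture. *)
Let measurable_g i : measurable3 (g i).
Proof.
pose Q n x := n.+1%:R^-1^-1 *
  (Num.sqrt (mixture (x + n.+1%:R^-1 *: basis3 i)) - Num.sqrt (mixture x)).
have ms := measurable_sqrt3 measurable_mixture.
apply: (@measurable_fun_cvg _ (mR3 R) R setT Q).
  move=> n; apply: measurable3M; first exact: measurable3_cst.
  apply: measurable3B; last exact: ms.
  by apply: measurable_sqrt3; apply: measurable3_shift; exact: measurable_mixture.
move=> x _; apply: (diff_quotient_cvg (is_derive_sqrt_mixture i x)) => [n|].
  by rewrite invr_eq0.
exact: cvg_harmonic.
Qed.

Let L2_sqrt_mixture : L2 (fun x => Num.sqrt (mixture x)).
Proof. exact: (L2_sqrt measurable_mixture mixture_ge0 integral_mixture). Qed.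

Let L2_g i : L2 (g i).
Proof.
apply: le_L2 (measurable_g i) (L2Z (B / 2) L2_sqrt_mixture) _ => x.
exact: le_trans (g_le i x) (ler_norm _).
Qed.

Let weak_g i : weak_partial i (fun x => Num.sqrt (mixture x)) (g i).
Proof.
apply: (@weak_partial_C1 _ _ _ _ (B / 2 * Num.sqrt (B ^+ 3 / W))) => //.
move=> x; apply: le_trans (g_le i x) _; rewrite ler_wpM2l ?divr_ge0 ?(ltW B0)//.
by rewrite ler_wsqrtr// mixture_le.
Qed.

(** The factor 1/4 is that of |grad sqrt p|^2 = |grad p|^2 / (4 p); [mixture_fisher] then exchanges
    square and average. *)
Let sum_g_le x : \sum_i g i x ^+ 2 <= 4^-1 * \int[mu]_y fisher y x.
Proof.
have p0 := mixture_gt0 x; have s0 := sqrt_mixture_gt0 x.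
have -> : \sum_i g i x ^+ 2 = (\sum_i dmixture i x ^+ 2) / (4 * mixture x).
  rewrite mulr_suml; apply: eq_bigr => i _.
  rewrite /g expr_div_n exprMn sqr_sqrtr ?mixture_ge0//; congr (_ / (_ * _)).
  by rewrite expr2 -natrM.
rewrite ler_pdivrMr ?mulr_gt0//; have := mixture_fisher x; lra.
Qed.

Let fisherE x : ((\int[mu]_y fisher y x)%:E = \int[mu]_y (fisher y x)%:E)%E.
Proof. by rewrite fineK//; apply: integrable_fin_num => //; exact: integrable_fisher. Qed.

Let mE_fisher : measurable_fun setT (fun z : mR3 R * mR3 R => (fisher z.2 z.1)%:E).
Proof. by apply/measurable_EFinP; exact: measurable_fisher. Qed.

Let E_fisher_ge0 y x : (0 <= (fisher y x)%:E)%E.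
Proof. by rewrite lee_fin fisher_ge0. Qed.

Let measurable_int_fisher : measurable_fun setT (fun x : mR3 R => \int[mu]_y (fisher y x)%:E)%E.
Proof.
exact: (@measurable_fun_fubini_tonelli_F _ _ _ _ _ mu _ mE_fisher (fun z => E_fisher_ge0 _ _)).
Qed.

(** A squared gradient scales by [b y ^+ 2]; what remains in blown-up coordinates is the mean of
    [slope2]. *)
Lemma integral_fisher y : (\int[leb3]_x (fisher y x)%:E = (tau d * b y ^+ 2)%:E)%E.
Proof.
transitivity (\int[leb3]_x ((b y ^+ 2 * slope2 d (blowup y x))%:E * (kap y x)%:E))%E.
  by apply: eq_integral => x _; rewrite -EFinM.
rewrite (@integral_blowup y (fun s => (b y ^+ 2 * slope2 d s)%:E)).
- transitivity (\int[leb3]_s ((b y ^+ 2 / W) * (slope2 d s * w s))%:E)%E.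
    by apply: eq_integral => s _; rewrite -EFinM; congr EFin; ring.
  have iw := integrable_slope2 d0.
  rewrite -[LHS]fineK; last by apply: integrable_fin_num => //; exact: (integrable3Z _ iw).
  rewrite -/(Rintegral _ _ _) Rintegral3Z//; congr EFin.
  by rewrite /tau -/W -/w; ring.
- apply/measurable_EFinP.
  by apply: measurable3M; [exact: measurable3_cst|exact: measurable_slope2].
- by move=> s; rewrite lee_fin mulr_ge0 ?sqr_ge0// slope2_ge0.
Qed.

Lemma kinetic_smear :
  (kinetic smear <= (4^-1 * tau d)%:E * \int[mu]_y (b y ^+ 2)%:E)%E.
Proof.
rewrite /smear (@kinetic_density_prob _ _ _ _ _ g)//.
apply: (@le_trans _ _ (\int[leb3]_x ((4^-1)%:E * \int[mu]_y (fisher y x)%:E))%E).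
  apply: ge0_le_integral => //.
  - by move=> x _; rewrite lee_fin sumr_ge0// => i _; exact: sqr_ge0.
  - by apply/measurable_EFinP; apply: measurable3_sum => i; exact: measurable3X.
  - exact: emeasurable_funM.
  - by move=> x _; rewrite -fisherE -EFinM lee_fin.
rewrite (ge0_integralZl _ measurableT measurable_int_fisher); last 2 first.
- by move=> x _; exact: integral_ge0.
- by rewrite lee_fin.
rewrite (@fubini_tonelli _ _ _ _ _ leb3 mu (fun z => (fisher z.2 z.1)%:E))//.
under eq_integral do rewrite /= integral_fisher EFinM.
rewrite ge0_integralZl//.
- by rewrite muleA -EFinM.
- by apply/measurable_EFinP; exact: measurable3X.
- by move=> y _; rewrite lee_fin sqr_ge0.
- by rewrite lee_fin tau_ge0.
Qed.

Lemma integral_smear_kap (h : mR3 R -> \bar R) : measurable_fun setT h ->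
  (forall x, 0 <= h x)%E ->
  (\int[smear]_x h x = \int[mu]_y \int[leb3]_x (h x * (kap y x)%:E))%E.
Proof. by move=> mh h0; rewrite /smear integral_density_prob// integralM_mixture. Qed.

Lemma integral_kap_blowup y (h : mR3 R -> \bar R) : measurable_fun setT h ->
  (forall x, 0 <= h x)%E ->
  (\int[leb3]_x (h x * (kap y x)%:E) =
   \int[leb3]_s (h (y + (b y)^-1 *: s)%R * (w s / W)%:E))%E.
Proof.
move=> mh h0.
rewrite -(@integral_blowup y (fun s => h (y + (b y)^-1 *: s)) _ (fun=> h0 _)).
- apply: eq_integral => x _; rewrite /blowup scalerA mulVf ?gt_eqF// scale1r.
  by rewrite addrC subrK.
- have := measurableT_comp mh (measurable_affine3 (b y)^-1 y).
  by congr (measurable_fun _ _); apply/funext => s; rewrite /= addrC.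
Qed.

Lemma measurable_integral_kap (h : mR3 R -> \bar R) : measurable_fun setT h ->
  (forall x, 0 <= h x)%E ->
  measurable_fun setT (fun y : mR3 R => \int[leb3]_x (h x * (kap y x)%:E))%E.
Proof.
move=> mh h0; apply: (@measurable_fun_fubini_tonelli_G _ _ _ _ _ leb3
  (fun z : mR3 R * mR3 R => h z.1 * (kap z.2 z.1)%:E)%E).
  apply: emeasurable_funM; first exact: (measurableT_comp mh measurable_fst).
  by apply/measurable_EFinP; exact: measurable_kap.
by move=> z; rewrite mule_ge0// lee_fin ltW// kap_gt0.
Qed.

(** Every bump contributes a nonnegative amount, so it suffices to keep the one centred at [X]. In
    its blown-up coordinate the kernel 1/|x - X| becomes b X / |s|, and [tau_le_potential]
    applies. *)
Lemma coulomb_smear X :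
  ((b X * (tau d / 2))%:E * mu [set X] <= \int[smear]_x ((enorm (x - X))%:E)^-1)%E.
Proof.
have mV := measurable_enormV X.
have V0 (x : R3 R) : (0 <= ((enorm x)%:E)^-1)%E by rewrite inve_ge0 lee_fin sqrtr_ge0.
rewrite (integral_smear_kap mV (fun=> V0 _)).
pose K (y : mR3 R) : \bar R := (\int[leb3]_x (((enorm (x - X))%:E)^-1 * (kap y x)%:E))%E.
have K0 y : (0 <= K y)%E.
  by apply: integral_ge0 => x _; rewrite mule_ge0// lee_fin ltW// kap_gt0.
have mK : measurable_fun setT K.
  exact: (measurable_integral_kap mV (fun=> V0 _)).
have mV0 : measurable_fun setT (fun s : mR3 R => ((enorm s)%:E)^-1)%E.
  by have := measurable_enormV (0 : R3 R); under eq_fun do rewrite subr0.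
have KX : ((b X * (tau d / 2))%:E <= K X)%E.
  rewrite EFinM; apply: (le_trans (lee_wpmul2l _ (tau_le_potential d0))).
    by rewrite lee_fin ltW.
  rewrite -ge0_integralZl//; last 3 first.
  - apply: emeasurable_funM => //; apply/measurable_EFinP.
    by apply: (measurable3M (measurable_wexp d)); exact: measurable3_cst.
  - by move=> s _; rewrite mule_ge0// lee_fin divr_ge0 ?(ltW W0) ?(ltW (w0 s)).
  - by rewrite lee_fin ltW.
  rewrite le_eqVlt; apply/orP; left; apply/eqP.
  transitivity (\int[leb3]_s (((b X)%:E * ((enorm s)%:E)^-1) * (w s / W)%:E))%E.
    by apply: eq_integral => s _; rewrite muleCA muleC.
  rewrite -(@integral_blowup X (fun s => (b X)%:E * ((enorm s)%:E)^-1)%E).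
  - apply: eq_integral => x _; congr (_ * _)%E.
    rewrite /blowup enormE sq3Z sqrtrM ?sqr_ge0// sqrtr_sqr gtr0_norm// -enormE.
    have [->|s0] := eqVneq (enorm (x - X)) 0.
      by rewrite mulr0 inve0 gt0_muley// lte_fin.
    rewrite !inver mulf_eq0 (negbTE s0) gt_eqF//= -EFinM invfM mulrA mulfV ?mul1r//.
    by rewrite gt_eqF.
  - by apply: emeasurable_funM.
  - by move=> s; rewrite mule_ge0// lee_fin ltW.
have c0 : 0 <= b X * (tau d / 2) by rewrite mulr_ge0 ?(ltW (b0 X))// divr_ge0// tau_ge0.
exact: (le_integral_point mu mK K0 c0 KX).
Qed.

End Mixture.

(** * Completing a subprobability by a distant point mass *)

Section Escape.
Context {R : realType}.
Variables (rho : subprobability (mR3 R) R) (z : R3 R).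

Definition mass : R := fine (rho setT).

Lemma massE : rho setT = mass%:E.
Proof. by rewrite fineK// fin_num_measure. Qed.

Lemma mass_le1 : 0 <= 1 - mass.
Proof. by rewrite subr_ge0 -lee_fin -massE; exact: sprobability_setT. Qed.

Definition escape : set (mR3 R) -> \bar R :=
  measure_add rho (mscale (NngNum mass_le1) (@dirac _ (mR3 R) z R)).

HB.instance Definition _ := Measure.on escape.

Lemma escapeE A : measurable A -> (escape A = rho A + (1 - mass)%:E * (\1_A z)%:E)%E.
Proof. by move=> mA; rewrite /escape measure_addE. Qed.

Let escape_setT : escape setT = 1%E.
Proof. by rewrite escapeE// massE indicT mule1 -EFinD addrC subrK. Qed.

HB.instance Definition _ := @Measure_isProbability.Build _ _ R escape escape_setT.

Lemma integral_escape (f : mR3 R -> \bar R) : measurable_fun setT f ->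
  (forall x, 0 <= f x)%E ->
  (\int[(escape : probability (mR3 R) R)]_x f x =
   \int[rho]_x f x + (1 - mass)%:E * f z)%E.
Proof.
move=> mf f0; rewrite ge0_integral_measure_add//; congr (_ + _)%E.
by rewrite ge0_integral_mscale// integral_dirac// diracT mul1e.
Qed.

Lemma escape_set1 X : z != X -> escape [set X] = rho [set X].
Proof.
move=> zX; rewrite escapeE; last exact: measurable_point.
by rewrite indicE memNset ?mule0 ?adde0// => /eqP; rewrite (negbTE zX).
Qed.

Lemma integrable_bounded_sub (g : R3 R -> R) (D : R) : measurable3 g ->
  (forall x, `|g x| <= D) -> rho.-integrable setT (fun x => (g x)%:E).
Proof.
move=> mg gD; apply: measurable_bounded_integrable => //.
  by rewrite ltey_eq fin_num_measure.
exists D; split; first exact: num_real.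
by move=> E DE x _; apply: le_trans (gD x) (ltW DE).
Qed.

End Escape.

(** * Weak* limit of the smeared measures *)

Section SmearWeakLimit.
Context {R : realType}.
Variables (d : R) (rho : subprobability (mR3 R) R) (b_ : nat -> R3 R -> R)
  (B_ c_ : nat -> R) (z_ : nat -> R3 R).
Hypotheses (d0 : 0 < d) (mb_ : forall n, measurable3 (b_ n))
  (b0_ : forall n y, 0 < b_ n y) (bB_ : forall n y, b_ n y <= B_ n)
  (bc_ : forall n y, (b_ n y)^-1 <= c_ n)
  (c0 : c_ n @[n --> \oo] --> (0 : R)) (z_oo : (z_ n).1.1 @[n --> \oo] --> +oo).

Implicit Types (n : nat) (y s : R3 R).

Let P n := smear (escape rho (z_ n)) d0 (mb_ n) (b0_ n) (bB_ n).
Let W := wmass d.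
Let W0 : 0 < W. Proof. exact: wmass_gt0. Qed.

Let bV_cvg0 (y_ : nat -> R3 R) : (b_ n (y_ n))^-1 @[n --> \oo] --> (0 : R).
Proof.
apply: (@squeeze_cvgr _ _ _ _ (cst 0) c_) => //; last exact: cvg_cst.
by apply: nearW => n; rewrite bc_ invr_ge0 ltW.
Qed.

Let scale_cvg0 (y_ : nat -> R3 R) (s : R3 R) :
  (b_ n (y_ n))^-1 *: s @[n --> \oo] --> (0 : R3 R).
Proof.
by rewrite -(scale0r s); apply: cvgZr_tmp; exact: bV_cvg0.
Qed.

Lemma vanish_bounded (f : R3 R -> R) : continuous f -> vanishes_at_infinity f ->
  exists C, forall x, `|f x| <= C.
Proof.
move=> cf /(_ 1 ltr01)[K cK fK].
have : compact (f @` K).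
  by apply: continuous_compact cK; apply: continuous_subspaceT; exact: cf.
move=> /compact_bounded [M [Mr MK]]; exists (Num.max 1 (M + 1)).
move=> x; have [Kx|nKx] := pselect (K x).
  by apply: MK; [rewrite lt_max ltrDl ltr01 orbT|exists x].
by rewrite le_max (ltW (fK _ nKx)).
Qed.

Variable f : R3 R -> R.
Hypotheses (cf : continuous f) (vf : vanishes_at_infinity f).

Section Bounded.
Variable C : R.
Hypothesis fC : forall x, `|f x| <= C.

Let mf : measurable3 f. Proof. exact: continuous_measurable3. Qed.

Let fC0 x : 0 <= f x + C.
Proof. by have := fC x; rewrite ler_norml => /andP[? _]; lra. Qed.

Let fC2 x : f x + C <= 2 * C.
Proof. by have := fC x; rewrite ler_norml => /andP[_ ?]; lra. Qed.

(** [f] is raised by its bound [C] so that the integral formulas for nonnegative functions apply;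
    [C] is subtracted again at the end. *)
Let h (x : mR3 R) : \bar R := (f x + C)%:E.

Let mh : measurable_fun setT h.
Proof. by apply/measurable_EFinP; apply: measurable3D => //; exact: measurable3_cst. Qed.

Let h0 x : (0 <= h x)%E. Proof. by rewrite lee_fin. Qed.

Let phi n (y : R3 R) : R := \int[leb3]_s ((f (y + (b_ n y)^-1 *: s) + C) * (wexp d s / W)).

Let iw : integrable3 (fun s => wexp d s / W).
Proof.
by under [X in integrable3 X]eq_fun do rewrite mulrC; apply: integrable3Z; exact: integrable_wexp.
Qed.

Let w0 s : 0 <= wexp d s / W.
Proof. by rewrite divr_ge0 ?(ltW W0)// ltW// wexp_gt0. Qed.

Let mint n y : measurable3 (fun s => (f (y + (b_ n y)^-1 *: s) + C) * (wexp d s / W)).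
Proof.
apply: measurable3M (integrable3_measurable iw).
apply: measurable3D; last exact: measurable3_cst.
have := measurableT_comp mf (measurable_affine3 (b_ n y)^-1 y).
by congr (measurable_fun _ _); apply/funext => s; rewrite /= addrC.
Qed.

Let int_le n y s :
  `|(f (y + (b_ n y)^-1 *: s) + C) * (wexp d s / W)| <= 2 * C * (wexp d s / W).
Proof.
have -> : `|(f (y + (b_ n y)^-1 *: s) + C) * (wexp d s / W)| =
    (f (y + (b_ n y)^-1 *: s) + C) * (wexp d s / W) by apply: ger0_norm; exact: mulr_ge0.
exact: ler_wpM2r.
Qed.

Let iint n y : integrable3 (fun s => (f (y + (b_ n y)^-1 *: s) + C) * (wexp d s / W)).
Proof.
apply: le_integrable3 (integrable3Z (2 * C) iw) _ => // s.
exact: le_trans (int_le n y s) (ler_norm _).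
Qed.

Let phiE n y : (\int[leb3]_x (h x * (kap d (b_ n) y x)%:E) = (phi n y)%:E)%E.
Proof.
rewrite (integral_kap_blowup d0 (b0_ n) y mh h0).
by rewrite fineK//; apply: integrable_fin_num => //; exact: iint.
Qed.

Let int_w : \int[leb3]_s (wexp d s / W) = 1.
Proof.
under eq_Rintegral do rewrite mulrC.
by rewrite Rintegral3Z ?mulVf ?gt_eqF//; exact: integrable_wexp.
Qed.

Let phi_ge0 n y : 0 <= phi n y.
Proof. by apply: Rintegral_ge0 => s _; rewrite mulr_ge0. Qed.

Let phi_le n y : phi n y <= 2 * C.
Proof.
have -> : 2 * C = \int[leb3]_s (2 * C * (wexp d s / W)) by rewrite Rintegral3Z// int_w mulr1.
apply: le_Rintegral3 => //; first exact: integrable3Z.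
by move=> s; apply: le_trans (int_le n y s); exact: ler_norm.
Qed.

Let measurable_phi n : measurable3 (phi n).
Proof.
apply/measurable_EFinP.
have := measurable_integral_kap d0 (mb_ n) (b0_ n) mh h0.
by congr (measurable_fun _ _); apply/funext => y; rewrite phiE.
Qed.

Let integrable_phi n : rho.-integrable setT (fun y => (phi n y)%:E).
Proof.
apply: (@integrable_bounded_sub _ rho _ (2 * C)) => // y.
by rewrite ger0_norm.
Qed.

(** The centre [y_] may move with [n], so that one statement serves both a fixed point and the
    escaping point [z_ n]. *)
Let phi_cvg (y_ : nat -> R3 R) (L : R) :
  (forall s, f (y_ n + (b_ n (y_ n))^-1 *: s) @[n --> \oo] --> L) ->
  phi n (y_ n) @[n --> \oo] --> L + C.
Proof.
move=> fL.
have -> : L + C = \int[leb3]_s ((L + C) * (wexp d s / W)) by rewrite Rintegral3Z// int_w mulr1.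
apply: (@dominated_Rintegral3 _ _ _ (fun s => 2 * C * (wexp d s / W))).
- by move=> n; exact: mint.
- by apply: measurable3M; [exact: measurable3_cst|exact: integrable3_measurable].
- by move=> s; apply: cvgM; [apply: cvgD => //; exact: cvg_cst|exact: cvg_cst].
- exact: integrable3Z.
- by move=> n s; exact: int_le.
Qed.

Let phi_cvg_pt y : phi n y @[n --> \oo] --> f y + C.
Proof.
apply: (phi_cvg (y_ := fun=> y)) => s.
have h1 : y + (b_ n y)^-1 *: s @[n --> \oo] --> y.
  rewrite -[X in _ --> X]addr0; apply: cvgD; first exact: cvg_cst.
  exact: (scale_cvg0 (fun=> y)).
by apply: continuous_cvg; [exact: cf|exact: h1].
Qed.

(** The bump at [z_ n] leaves every compact set, where [f] is small; of f + C only [C] survives in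
    the limit. *)
Let phi_cvg_z : phi n (z_ n) @[n --> \oo] --> C.
Proof.
rewrite -[X in _ --> X]add0r; apply: phi_cvg => s.
apply/cvgr0Pnorm_lt => e e0; have [K cK fK] := vf e0.
have [m m0 Km] := compact_cubeP cK.
have s1 : ((b_ n (z_ n))^-1 *: s).1.1 @[n --> \oo] --> (0 : R).
  by rewrite -(mul0r s.1.1); apply: cvgM; [exact: bV_cvg0|exact: cvg_cst].
move/cvgrPdist_lt : s1 => /(_ _ ltr01) s1.
(* The displacement within the bump is eventually below 1, so [m + 1] keeps the displaced first
   coordinate above [m], outside the cube containing [K]. *)
move/cvgryPgt : z_oo => /(_ (m + 1)) zm.
near=> n; apply: fK => /Km [[+ _] _].
have h1 : m + 1 < (z_ n).1.1 by near: n.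
have : `|0 - ((b_ n (z_ n))^-1 *: s).1.1| < 1 by near: n.
rewrite sub0r normrN ltr_norml => /andP[h2 _].
have -> : (z_ n + (b_ n (z_ n))^-1 *: s).1.1 = (z_ n).1.1 + ((b_ n (z_ n))^-1 *: s).1.1 by [].
set v := (_ *: s).1.1 in h2 *.
by rewrite /= in_itv/= => /andP[_ ?]; lra.
Unshelve. all: by end_near. Qed.

Let integral_P n :
  \int[P n]_x f x + C = \int[rho]_y phi n y + (1 - mass rho) * phi n (z_ n).
Proof.
have iP := integrable_bounded_rho (P n) mf fC.
have <- : \int[P n]_x (f x + C) = \int[P n]_x f x + C.
  rewrite RintegralD//; last exact: finite_measure_integrable_cst.
  rewrite Rintegral_cst//; congr (_ + _).
  have PT : P n setT = 1%E := probability_setT (P n).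
  by rewrite -[RHS]mulr1; congr (_ * _); exact: (congr1 fine PT).
have iphi : (\int[rho]_y (phi n y)%:E)%E \is a fin_num.
  by apply: integrable_fin_num => //; exact: integrable_phi.
rewrite /Rintegral -[X in _ + X]/(fine ((1 - mass rho) * phi n (z_ n))%:E).
rewrite -fineD//; congr fine.
rewrite (integral_smear_kap _ d0 (mb_ n) (b0_ n) (bB_ n) mh h0).
transitivity (\int[escape rho (z_ n)]_y (phi n y)%:E)%E.
  by apply: eq_integral => y _; exact: phiE.
have mp : measurable_fun setT (fun y : mR3 R => (phi n y)%:E).
  by apply/measurable_EFinP; exact: measurable_phi.
exact: (integral_escape rho (z_ n) mp (fun y => ltac:(by rewrite lee_fin))).
Qed.

Let phi_cvg_rho :
  \int[rho]_y phi n y @[n --> \oo] --> \int[rho]_y f y + C * mass rho.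
Proof.
have <- : \int[rho]_y (f y + C) = \int[rho]_y f y + C * mass rho.
  rewrite RintegralD//; last exact: finite_measure_integrable_cst.
    by rewrite Rintegral_cst.
  exact: integrable_bounded_sub fC.
have iC : rho.-integrable setT (fun x => (f x + C)%:E).
  apply: (@integrable_bounded_sub _ rho _ (2 * C)); first by apply/measurable_EFinP.
  by move=> x; rewrite ger0_norm.
have [_ _ cv] := @dominated_convergence _ _ _ rho setT measurableT
  (fun n x => (phi n x)%:E) (fun x => (f x + C)%:E) (fun=> (2 * C)%:E)
  (fun n => (measurable_EFinP _ _).2 (measurable_phi n)) mh
  ltac:(by apply: aeW => x _; apply/fine_cvgP; split; [exact: nearW|exact: phi_cvg_pt])
  (finite_measure_integrable_cst _ _ measurableT)
  ltac:(by apply: aeW => x n _; rewrite lee_fin ger0_norm).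
apply: fine_cvg; rewrite fineK//; exact: integrable_fin_num.
Qed.

Lemma smear_cvg_bounded : \int[P n]_x f x @[n --> \oo] --> \int[rho]_x f x.
Proof.
have -> : (fun n => \int[P n]_x f x) =
    (fun n => \int[rho]_y phi n y + (1 - mass rho) * phi n (z_ n) - C).
  by apply/funext => n; rewrite -integral_P addrK.
have -> : \int[rho]_x f x =
    \int[rho]_x f x + C * mass rho + (1 - mass rho) * C - C by ring.
apply: cvgB; last exact: cvg_cst.
apply: cvgD => //; apply: cvgM => //; exact: cvg_cst.
Qed.

End Bounded.

Lemma smear_cvg : \int[P n]_x f x @[n --> \oo] --> \int[rho]_x f x.
Proof. have [C fC] := vanish_bounded cf vf; exact: (smear_cvg_bounded fC). Qed.

End SmearWeakLimit.

(** * Recovery families and the limsup inequality *)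

Section Recovery.
Context {R : realType} {M : nat} (X : 'I_M -> R3 R) (Z : 'I_M -> R).
Hypothesis X_inj : injective X.
Hypothesis Z_gt0 : forall k, 0 < Z k.
Implicit Types (rho : subprobability (mR3 R) R) (y : R3 R) (e : R).

Lemma sum_indic_in (f : 'I_M -> R) k : \sum_(j < M) f j * \1_[set X j] (X k) = f k.
Proof.
rewrite (bigD1 k)//= big1; first by rewrite indicE mem_set// addr0 mulr1.
move=> j jk; rewrite indicE memNset ?mulr0//= => /X_inj kj.
by rewrite kj eqxx in jk.
Qed.

Lemma sum_indic_out (f : 'I_M -> R) y : (forall k, y <> X k) ->
  \sum_(j < M) f j * \1_[set X j] y = 0.
Proof. by move=> yX; rewrite big1// => j _; rewrite indicE memNset ?mulr0//; exact: yX. Qed.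

Lemma measurable_sum_indic (f : 'I_M -> R) :
  measurable3 (fun y => \sum_(j < M) f j * \1_[set X j] y).
Proof.
apply: measurable3_sum => k; apply: measurable3M; first exact: measurable3_cst.
by apply: measurable_indic; exact: measurable_point.
Qed.

(* Inverse length scale of the bump replacing a point mass at [y]: the nuclei
   are resolved at their natural scale [e / Z k], all other points at the
   coarser scale [sqrt e], so that their kinetic energy is negligible. *)
Definition conc e y : R :=
  (Num.sqrt e)^-1 + \sum_(k < M) (Z k / e - (Num.sqrt e)^-1) * \1_[set X k] y.

Lemma conc_in e k : conc e (X k) = Z k / e.
Proof. by rewrite /conc sum_indic_in addrC subrK. Qed.

Lemma conc_out e y : (forall k, y <> X k) -> conc e y = (Num.sqrt e)^-1.
Proof. by move=> yX; rewrite /conc sum_indic_out// addr0. Qed.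

Lemma point_cases y : (exists k, y = X k) \/ (forall k, y <> X k).
Proof.
have [|n] := pselect (exists k, y = X k); first by left.
by right => k yk; apply: n; exists k.
Qed.

Lemma measurable_conc e : measurable3 (conc e).
Proof.
by apply: measurable3D; [exact: measurable3_cst|exact: measurable_sum_indic].
Qed.

Section Scale.
Variable e : R.
Hypothesis e0 : 0 < e.

Let s0 : 0 < Num.sqrt e. Proof. by rewrite sqrtr_gt0. Qed.

Lemma conc_gt0 y : 0 < conc e y.
Proof.
have [[k ->]|h] := point_cases y; first by rewrite conc_in divr_gt0.
by rewrite conc_out// invr_gt0.
Qed.

Lemma sum_ge_term (f : 'I_M -> R) k : (forall j, 0 <= f j) -> f k <= \sum_(j < M) f j.
Proof. by move=> f0; rewrite (bigD1 k)//= lerDl sumr_ge0. Qed.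

Lemma conc_le y : conc e y <= \sum_(k < M) Z k / e + (Num.sqrt e)^-1.
Proof.
have t0 k : 0 <= Z k / e by rewrite divr_ge0 ?ltW.
have [[k ->]|h] := point_cases y.
  by rewrite conc_in ler_wpDr ?invr_ge0 ?(ltW s0)//; exact: (@sum_ge_term (fun k => Z k / e)).
by rewrite conc_out// lerDr sumr_ge0.
Qed.

(** The bound on the length scales is uniform in [y] and vanishes with [e], as the weak limit
    requires; the sum over the nuclei stands in for a maximum. *)
Lemma concV_le y : (conc e y)^-1 <= Num.sqrt e + e * \sum_(k < M) (Z k)^-1.
Proof.
have t0 k : 0 <= (Z k)^-1 by rewrite invr_ge0 ltW.
have [[k ->]|h] := point_cases y.
  rewrite conc_in invf_div ler_wpDl ?(ltW s0)// ler_wpM2l ?(ltW e0)//.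
  exact: sum_ge_term.
by rewrite conc_out// invrK lerDl mulr_ge0 ?sumr_ge0// ltW.
Qed.

(** In the energy this is multiplied by e^2: the first term then contributes order [e], and the
    second yields Z_k^2 at each nucleus. *)
Lemma conc_sq_le y :
  conc e y ^+ 2 <= e^-1 + \sum_(k < M) (Z k / e) ^+ 2 * \1_[set X k] y.
Proof.
have [[k ->]|h] := point_cases y.
  by rewrite conc_in sum_indic_in ler_wpDl// invr_ge0 ltW.
by rewrite conc_out// sum_indic_out// addr0 exprVn sqr_sqrtr// ltW.
Qed.

Lemma integral_conc_sq (mu : probability (mR3 R) R) :
  (\int[mu]_y (conc e y ^+ 2)%:E <=
   (e^-1 + \sum_(k < M) (Z k / e) ^+ 2 * fine (mu [set X k]))%:E)%E.
Proof.
have mS := measurable_sum_indic (fun k => (Z k / e) ^+ 2).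
have t0 y : 0 <= \sum_(k < M) (Z k / e) ^+ 2 * \1_[set X k] y.
  by apply: sumr_ge0 => k _; rewrite mulr_ge0 ?sqr_ge0.
have mX k := measurable_point (X k).
apply: (@le_trans _ _ (\int[mu]_y (e^-1%:E + (\sum_(k < M) (Z k / e) ^+ 2 * \1_[set X k] y)%:E))%E).
  apply: ge0_le_integral => //.
  - by move=> y _; rewrite lee_fin sqr_ge0.
  - by apply/measurable_EFinP; apply: measurable3X; exact: measurable_conc.
  - by apply: emeasurable_funD => //; exact/measurable_EFinP.
  - by move=> y _; rewrite -EFinD lee_fin conc_sq_le.
rewrite ge0_integralD//; last 3 first.
- by move=> y _; rewrite lee_fin invr_ge0 ltW.
- by move=> y _; rewrite lee_fin.
- exact/measurable_EFinP.
rewrite integral_cst// EFinD leeD//.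
  by rewrite -[leRHS]mule1 lee_wpmul2l ?lee_fin ?invr_ge0 ?(ltW e0)// probability_le1.
under eq_integral do rewrite -sumEFin.
rewrite ge0_integral_sum//; last 2 first.
- move=> k; apply/measurable_EFinP; apply: measurable3M; first exact: measurable3_cst.
  exact: measurable_indic.
- by move=> k y _; rewrite lee_fin mulr_ge0 ?sqr_ge0.
rewrite -sumEFin; apply: lee_sum => k _.
under eq_integral do rewrite EFinM.
rewrite ge0_integralZl//; last 2 first.
- by apply/measurable_EFinP; exact: measurable_indic.
- by rewrite lee_fin sqr_ge0.
by rewrite integral_indic// setIT [leRHS]EFinM fineK// fin_num_measure.
Qed.

(** With S the sum of the Z_k^2 mu{X_k}, the kinetic part is at most tau (e + S) / 4 and the Coulomb
    part at least tau S / 2. The concentration Z_k / e balances them as in the virial theorem,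
    leaving - tau S / 4. *)
Lemma energy_smear (d : R) (d0 : 0 < d) (mu : probability (mR3 R) R) :
  (G0_ X Z e (smear mu d0 (measurable_conc e) conc_gt0 conc_le) <=
   (4^-1 * tau d * e - 4^-1 * tau d * \sum_(k < M) Z k ^+ 2 * fine (mu [set X k]))%:E)%E.
Proof.
set P := smear _ _ _ _ _.
pose S := \sum_(k < M) Z k ^+ 2 * fine (mu [set X k]).
have t0 : 0 <= 4^-1 * tau d by rewrite mulr_ge0// tau_ge0.
have kinP : (kinetic P <= (4^-1 * tau d * (e^-1 + S / e ^+ 2))%:E)%E.
  apply: le_trans (kinetic_smear _ d0 (measurable_conc e) conc_gt0 conc_le) _.
  rewrite [leRHS]EFinM; apply: lee_wpmul2l; first by rewrite lee_fin.
  apply: le_trans (integral_conc_sq mu) _; rewrite lee_fin lerD2l mulr_suml.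
  by apply: ler_sum => k _; rewrite expr_div_n mulrAC.
have potP : ((tau d / 2 * (S / e))%:E <= potential X Z P)%E.
  rewrite /potential /S mulr_suml mulr_sumr -sumEFin; apply: lee_sum => k _.
  have -> : tau d / 2 * (Z k ^+ 2 * fine (mu [set X k]) / e) =
    Z k * (Z k / e * (tau d / 2) * fine (mu [set X k])) by ring.
  rewrite [leLHS]EFinM lee_wpmul2l ?lee_fin ?(ltW (Z_gt0 k))//.
  apply: le_trans (coulomb_smear _ d0 (measurable_conc e) conc_gt0 conc_le (X k)).
  by rewrite conc_in [leLHS]EFinM fineK// fin_num_measure//; exact: measurable_point.
rewrite /G0_ ifF; last first.
  by apply/negbTE; rewrite -ltey; apply: le_lt_trans kinP (ltry _).
apply: (@le_trans _ _ ((e ^+ 2)%:E * (4^-1 * tau d * (e^-1 + S / e ^+ 2))%:E -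
   e%:E * (tau d / 2 * (S / e))%:E)%E).
  apply: leeB; first by rewrite lee_wpmul2l// lee_fin sqr_ge0.
  by rewrite lee_wpmul2l// lee_fin ltW.
rewrite -!EFinM -EFinB lee_fin le_eqVlt; apply/orP; left; apply/eqP.
by rewrite -/S; field; rewrite gt_eqF.
Qed.

End Scale.

(* Families are indexed by all of [R]; values at [e <= 0] are irrelevant. *)
Let pos e : R := if 0 < e then e else 1.

Let pos_gt0 e : 0 < pos e.
Proof. by rewrite /pos; case: ifP. Qed.

Section Family.
Variables (d : R) (d0 : 0 < d) (rho : subprobability (mR3 R) R).

(** The distance 1/e sends the point to infinity as [e] tends to 0, so for small [e] it also differs
    from every nucleus and leaves the masses there unchanged. *)
Let z e : R3 R := (e^-1, 0, 0).

Definition recovery e : probability (mR3 R) R :=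
  smear (escape rho (z (pos e))) d0 (measurable_conc (pos e))
    (conc_gt0 (pos_gt0 e)) (conc_le (pos_gt0 e)).

Let S := \sum_(k < M) Z k ^+ 2 * fine (rho [set X k]).

Lemma recovery_cvg : weak_star_cvg recovery rho.
Proof.
move=> f cf vf; apply/cvg_at_rightP => u [u0 ucv].
(* The one-sided limit has been reduced to sequences of positive numbers, to which [smear_cvg]
   applies. *)
have pu n : pos (u n) = u n by rewrite /pos u0.
apply: (@smear_cvg _ _ rho (fun n => conc (pos (u n))) _
  (fun n => Num.sqrt (u n) + u n * \sum_(k < M) (Z k)^-1) (fun n => z (pos (u n))) d0
  (fun n => measurable_conc (pos (u n))) (fun n => conc_gt0 (pos_gt0 (u n)))
  (fun n => conc_le (pos_gt0 (u n)))) => //.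
- by move=> n y; rewrite pu; exact: concV_le.
- rewrite -[X in _ --> X]addr0; apply: cvgD.
    rewrite -[X in _ --> X](sqrtr0 R).
    by apply: continuous_cvg; [exact: sqrt_continuous|exact: ucv].
  rewrite -[X in _ --> X](mul0r (\sum_(k < M) (Z k)^-1)).
  by apply: cvgM; [exact: ucv|exact: cvg_cst].
- apply/cvgryPgt => A.
  have A1 : 0 < `|A| + 1 by rewrite ltr_wpDl.
  have A2 : 0 < (`|A| + 1)^-1 by rewrite invr_gt0.
  move/cvgrPdist_lt : ucv => /(_ _ A2).
  apply: filterS => n; rewrite sub0r normrN gtr0_norm// => un.
  rewrite /= pu; apply: (@lt_trans _ _ (`|A| + 1)).
    by rewrite (le_lt_trans (ler_norm A))// ltrDl.
  by rewrite -[ltLHS]invrK ltf_pV2 ?posrE.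
Qed.

Lemma recovery_energy (h : R) : 0 < h ->
  (limf_esup (fun e => G0_ X Z e (recovery e)) 0^'+ <= (h - 4^-1 * tau d * S)%:E)%E.
Proof.
move=> h0; apply: limf_esup_le.
(* [A] exceeds the first coordinate of every nucleus, and the summand 1 keeps it positive when there
   are none; 1/e > A then separates the escaping point from the nuclei. *)
pose A := 1 + \sum_(k < M) `|(X k).1.1|.
have A0 : 0 < A by rewrite ltr_wpDr// sumr_ge0.
near=> e.
have e0 : 0 < e by near: e; exact: nbhs_right_gt.
have eA : e < A^-1 by near: e; apply: nbhs_right_lt; rewrite invr_gt0.
have eh : e < h by near: e; exact: nbhs_right_lt.
have pe : pos e = e by rewrite /pos e0.
have zX k : z (pos e) != X k.
  apply/eqP => /(congr1 (fun x : R3 R => x.1.1)); rewrite /= pe => eX.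
  have : A < e^-1 by rewrite -[ltLHS]invrK ltf_pV2 ?posrE ?invr_gt0.
  rewrite eX ltNge (le_trans (ler_norm _))// /A ler_wpDl//.
  exact: (@sum_ge_term (fun k => `|(X k).1.1|)).
have := energy_smear (pos_gt0 e) d0 (escape rho (z (pos e))).
rewrite -/(recovery e) {1}pe => /le_trans; apply; rewrite lee_fin.
rewrite (_ : \sum_(k < M) _ = S); last first.
  by apply: eq_bigr => k _; congr (_ * fine _); exact: escape_set1.
rewrite pe lerD2r.
have t1 := tau_le1 d0; have t0 := tau_ge0 d0.
have : tau d * e <= e by rewrite ler_piMl// ltW.
have := mulr_ge0 t0 (ltW e0); lra.
Unshelve. all: by end_near. Qed.

End Family.

Lemma Gamma_limsup_le rho :
  (Gamma_limsup (G0_ X Z) rho <=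
   - (4^-1%:E * \sum_(k < M) (Z k ^+ 2)%:E * rho [set X k]))%E.
Proof.
pose S := \sum_(k < M) Z k ^+ 2 * fine (rho [set X k]).
have S0 : 0 <= S by apply: sumr_ge0 => k _; rewrite mulr_ge0 ?sqr_ge0// fine_ge0.
have -> : (4^-1%:E * \sum_(k < M) (Z k ^+ 2)%:E * rho [set X k] = (4^-1 * S)%:E)%E.
  rewrite EFinM -sumEFin; congr (_ * _)%E; apply: eq_bigr => k _.
  by rewrite [RHS]EFinM fineK// fin_num_measure//; exact: measurable_point.
apply/lee_addgt0Pr => h h0.
have h2 : 0 < h / 2 by rewrite divr_gt0.
(* Taking d = h / (S + 1) in [tau_ge], smoothing costs at most d S / 8 <= h / 8, while the energy
   bound spends h / 2; the total stays below [h]. *)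
have d0 : 0 < h / (S + 1) by rewrite divr_gt0// ltr_wpDl.
apply: le_trans (le_trans (recovery_energy d0 rho h2) _).
  by apply: ereal_inf_lbound; exists (recovery d0 rho) => //; exact: recovery_cvg.
rewrite -EFinN -EFinD lee_fin -/S.
have t1 := tau_ge d0.
have hS : h / (S + 1) * S <= h.
  by rewrite mulrAC ler_pdivrMr ?ltr_wpDl// ler_wpM2l ?(ltW h0)// lerDl.
have := ler_wpM2r S0 t1; lra.
Qed.

End Recovery.

Unset Implicit Arguments.

Theorem theorem4p4 (R : realType) (M : nat) (X : 'I_M -> R3 R) (Z : 'I_M -> R)
    (X_inj : injective X) (Z_gt0 : forall k, 0 < Z k) :
  is_Gamma_limit (G0_ X Z)
    (fun rho => - ((4^-1)%:E * \sum_(k < M) (Z k ^+ 2)%:E * rho [set X k]))%E.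
Proof.
move=> rho.
have lower := Gamma_liminf_ge X_inj Z_gt0 rho.
have upper := Gamma_limsup_le X_inj Z_gt0 rho.
have mid : (Gamma_liminf (G0_ X Z) rho <= Gamma_limsup (G0_ X Z) rho)%E.
  apply: le_ereal_inf_tmp => _ [rho_ wc <-].
  apply: le_trans (limf_einf_le_esup _ _); apply: ereal_inf_lbound.
  by exists rho_.
split; apply/eqP; rewrite eq_le.
  by rewrite lower (le_trans mid upper).
by rewrite upper (le_trans lower mid).
Qed.
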